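(* Let $N\ge 1$ and $p>1$. Let $f\in\mathcal L$, and let $h\in\mathcal L'$ if $1<p<2$ and $h=0$ if $p\ge2$. For any $\alpha>1$, there exists $\gamma=\gamma(N,p,\alpha)>0$ (depending only on $N,p,\alpha$) with the following property: if there exists $T>0$ such that $$\sup_{x\in\overline\Omega}\int_{B_\Omega(x,\sigma)}\frac{y_N}{y_N+\sigma}f(y)^\alpha\,dy\le\gamma\sigma^{N-\frac{2\alpha}{p-1}}\quad\text{and}\quad\sup_{x'\in\mathbb R^{N-1}}\int_{B'(x',\sigma)}h(y')^\alpha\,dy'\le\gamma\sigma^{N-1+2\alpha\frac{p-2}{p-1}}$$ for all $\sigma\in(0,\sqrt T)$, then problem (P) with $\mu=x_Nf(x)+h(x')\otimes\delta_1(x_N)\in\mathcal M$ possesses a solution $u$ in $Q_T$, with $u$ satisfying $$0\le u(x,t)\le2[G(t)f^\alpha](x)^{\frac1\alpha}+2\frac{x_N}t\Gamma_1(x_N,t)\,[\Gamma_{N-1}(t)h^\alpha](x')^{\frac1\alpha}\qquad\text{for almost all }(x,t)\in Q_T.$$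
   Context: $\Omega:=\mathbb R^{N-1}\times(0,\infty)$ if $N\ge2$ and $\Omega:=(0,\infty)$ if $N=1$; points are written $x=(x',x_N)$; $\partial\Omega$ is identified with $\mathbb R^{N-1}$ ($\{0\}$ if $N=1$). $B(x,r)$ is the open ball in $\mathbb R^N$, $B_\Omega(x,r):=B(x,r)\cap\overline\Omega$, and $B'(x',r)$ is the open ball in $\mathbb R^{N-1}$ (for $N=1$, integrals over $B'$ are evaluation at $0$). $Q_T:=\Omega\times(0,T)$. $\mathcal M$ is the set of nonnegative Radon measures on $\overline\Omega$; a locally integrable function $g$ on $\overline\Omega$ is identified with the measure $g(x)\,dx$. $\mathcal L$ (resp. $\mathcal L'$) is the set of nonnegative measurable functions on $\Omega$ (resp. $\partial\Omega$). $\mathcal L(Q_T)$ is the set of nonnegative, measurable, almost everywhere finite functions on $Q_T$. $\delta_1$ is the Dirac measure at $0$ in the variable $x_N$, and $h(x')\otimes\delta_1(x_N)$ is the measure carried by $\partial\Omega$ with density $h$ with respect to $dx'$ (for $N=1$ it is $h(0)\delta_1$). Kernels: $\Gamma_d(x,t):=(4\pi t)^{-d/2}\exp(-|x|^2/(4t))$ on $\mathbb R^d\times(0,\infty)$. The Dirichlet heat kernel of $\Omega$ is $$G(x,y,t):=\Gamma_N(x-y,t)\left(1-\exp\left(-\frac{x_Ny_N}{t}\right)\right),\qquad x,y\in\overline\Omega,\ t>0,$$ and, for $x,y\in\overline\Omega$, $t>0$, $K(x,y,t):=y_N^{-1}G(x,y,t)$ if $y_N>0$ and $K(x,y,t):=(\partial_{y_N}G)(x,y,t)=\frac{x_N}{t}\Gamma_N(x-y,t)$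 if $y_N=0$. $[G(t)f](x):=\int_\Omega G(x,y,t)f(y)\,dy$ and $[\Gamma_{N-1}(t)h](x'):=\int_{\mathbb R^{N-1}}\Gamma_{N-1}(x'-y',t)h(y')\,dy'$ (for $N=1$, $[\Gamma_0(t)h]:=h(0)$). Problem (P) is $\partial_tu=\Delta u+u^p$ in $\Omega$, $t>0$, with $u=0$ on $\partial\Omega$ and $x_Nu(x,0)=\mu$ on $\overline\Omega$. A function $u\in\mathcal L(Q_T)$ is a solution to (P) in $Q_T$ if $$u(x,t)=\int_{\overline\Omega}K(x,y,t)\,d\mu(y)+\int_0^t\int_\Omega G(x,y,t-s)u(y,s)^p\,dy\,ds$$ for almost all $(x,t)\in Q_T$. *)

(* Defs.v *)
From HB Require Import structures.
From mathcomp Require Import all_boot all_order all_algebra.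
From mathcomp Require Import all_classical all_reals all_analysis.
From mathcomp Require Import measurable_realfun ring.

Set Implicit Arguments.
Unset Strict Implicit.
Unset Printing Implicit Defensive.
Import Order.TTheory GRing.Theory Num.Theory.
Import numFieldNormedType.Exports.

Local Open Scope classical_set_scope.
Local Open Scope ring_scope.
Local Open Scope ereal_scope.

(** * Lebesgue measure on R^n

R^n is the type of n-tuples with its product (i.e. Borel) sigma-algebra.  Its
Lebesgue measure is the n-fold product of the one-dimensional one; on R^0 it is
the Dirac mass at the only point, so an integral over R^0 is an evaluation. *)

Notation euclid R n := (n.-tuple (measurableTypeR R)).

(* The product of two sigma-finite measures, bundled: the canonical instance
   that the library infers for [\x] only covers subprobabilities. *)
Section product.
Context d1 d2 (T1 : measurableType d1) (T2 : measurableType d2) (R : realType).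
Variables (m1 : {sigma_finite_measure set T1 -> \bar R})
          (m2 : {sigma_finite_measure set T2 -> \bar R}).

Let prod : set (T1 * T2)%type -> \bar R := m1 \x m2.

HB.instance Definition _ := Measure.on prod.

Let prod_sigma_finite : sigma_finite setT prod.
Proof.
have /sigma_finiteP[F [TF ndF Foo]] := sigma_finiteT m1.
have /sigma_finiteP[G [TG ndG Goo]] := sigma_finiteT m2.
exists (fun n => F n `*` G n).
  rewrite -setXTT TF TG predeqE => -[x y]; split.
    move=> [/= [n _ Fnx] [k _ Gky]]; exists (maxn n k) => //; split.
    - by move: x Fnx; exact/subsetPset/ndF/leq_maxl.
    - by move: y Gky; exact/subsetPset/ndG/leq_maxr.
  by move=> [n _ []/= ? ?]; split; exists n.
move=> k; have [? ?] := Foo k; have [? ?] := Goo k.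
split; first exact: measurableX.
by rewrite /prod product_measure1E// lte_mul_pinfty// ge0_fin_numE.
Qed.

HB.instance Definition _ :=
  Measure_isSigmaFinite.Build _ _ _ prod prod_sigma_finite.

Definition product_measure :
    {sigma_finite_measure set (T1 * T2)%type -> \bar R} :=
  prod.

End product.

Section lebesgue_step.
Variables (R : realType) (n : nat).
Variable m : {sigma_finite_measure set (euclid R n) -> \bar R}.

Definition euclid_cons (z : measurableTypeR R * euclid R n) : euclid R n.+1 :=
  [tuple of z.1 :: z.2].

Lemma measurable_euclid_cons : measurable_fun [set: _] euclid_cons.
Proof. exact: measurable_cons. Qed.

Definition lebesgue_step : set (euclid R n.+1) -> \bar R :=
  pushforward (product_measure (@lebesgue_measure R) m) euclid_cons.

Let nu : {measure set (euclid R n.+1) -> \bar R} :=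
  measure_function_pushforward__canonical__measure_function_Measure
    (product_measure (@lebesgue_measure R) m) measurable_euclid_cons.

Let step0 : lebesgue_step set0 = 0.
Proof. exact: (measure0 nu). Qed.

Let step_ge0 A : 0 <= lebesgue_step A.
Proof. exact: (measure_ge0 nu). Qed.

Let step_sigma_additive : semi_sigma_additive lebesgue_step.
Proof. exact: (@measure_semi_sigma_additive _ _ _ nu). Qed.

HB.instance Definition _ :=
  isMeasure.Build _ _ _ lebesgue_step step0 step_ge0 step_sigma_additive.

Let step_sigma_finite : sigma_finite setT lebesgue_step.
Proof.
have [F FT mF] := sigma_finiteT (product_measure (@lebesgue_measure R) m).
pose u (x : euclid R n.+1) : measurableTypeR R * euclid R n :=
  (thead x, [tuple of behead x]).
have uK z : u (euclid_cons z) = z.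
  by case: z => a b; rewrite /u theadE; congr pair; exact: val_inj.
have mu_ : measurable_fun setT u.
  by apply: measurable_fun_pair; [exact: measurable_tnth
                                 |exact: measurable_behead].
exists (fun k => u @^-1` F k).
  by rewrite -preimage_bigcup -FT preimage_setT.
move=> k; have [mFk Fk] := mF k; split.
  by rewrite -[X in measurable X]setTI; exact: mu_.
rewrite /lebesgue_step /pushforward -comp_preimage.
by rewrite (_ : u \o _ = id) //; apply/funext => z /=; exact: uK.
Qed.

HB.instance Definition _ :=
  Measure_isSigmaFinite.Build _ _ _ lebesgue_step step_sigma_finite.

Definition lebesgue_succ :
    {sigma_finite_measure set (euclid R n.+1) -> \bar R} :=
  lebesgue_step.

End lebesgue_step.

Fixpoint lebesgue_euclid (R : realType) (n : nat) :
    {sigma_finite_measure set (euclid R n) -> \bar R} :=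
  match n return {sigma_finite_measure set (euclid R n) -> \bar R} with
  | 0%N => \d_([tuple] : euclid R 0)
  | k.+1 => lebesgue_succ (lebesgue_euclid R k)
  end.

(** * Points, balls, half-space

A point of R^N (N >= 1) is the pair (x', x_N) of R^(N-1) * R. *)

Notation ambient R N := (euclid R N.-1 * measurableTypeR R)%type.

Section geometry.
Variables (R : realType) (N : nat).
Implicit Types x y : ambient R N.

Definition lebesgue_ambient :
    {sigma_finite_measure set (ambient R N) -> \bar R} :=
  product_measure (lebesgue_euclid R N.-1) (@lebesgue_measure R).

Definition last_coord x : R := x.2.

Definition boundary_sqdist (x' y' : euclid R N.-1) : R :=
  (\sum_(i < N.-1) ((tnth x' i : R) - (tnth y' i : R)) ^+ 2)%R.

Definition sqdist x y : R :=
  (boundary_sqdist x.1 y.1 + (last_coord x - last_coord y) ^+ 2)%R.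

Definition halfspace : set (ambient R N) := [set x | (0 < last_coord x)%R].

Definition halfspace_closure : set (ambient R N) :=
  [set x | (0 <= last_coord x)%R].

Definition halfspace_ball x (r : R) : set (ambient R N) :=
  [set y | (Num.sqrt (sqdist x y) < r)%R] `&` halfspace_closure.

Definition boundary_ball (x' : euclid R N.-1) (r : R) : set (euclid R N.-1) :=
  [set y' | (Num.sqrt (boundary_sqdist x' y') < r)%R].

Definition cylinder (T : R) : set (ambient R N * measurableTypeR R)%type :=
  [set z | halfspace z.1 /\ (0 < (z.2 : R) < T)%R].

Definition lebesgue_cylinder :
    {sigma_finite_measure set (ambient R N * measurableTypeR R)%type -> \bar R} :=
  product_measure lebesgue_ambient (@lebesgue_measure R).

End geometry.

Arguments halfspace : clear implicits.
Arguments halfspace_closure : clear implicits.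

(** * Measurable functions and Radon measures *)

(* Measurability with respect to the completed measure: on [D], [f] agrees
   almost everywhere with a Borel function.  Lebesgue measurability is meant
   wherever functions are called measurable. *)
Definition lebesgue_measurable_fun d (X : measurableType d) (R : realType)
    (mu : {measure set X -> \bar R}) (D : set X) (f : X -> \bar R) :=
  exists2 g : X -> \bar R, measurable_fun D g &
    {ae mu, forall x, D x -> f x = g x}.

Definition nonneg_measurable d (X : measurableType d) (R : realType)
    (mu : {measure set X -> \bar R}) (D : set X) (f : X -> \bar R) :=
  (forall x, D x -> 0 <= f x) /\ lebesgue_measurable_fun mu D f.

Section radon.
Variables (R : realType) (N : nat).

(* Tuples carry no topology in the library: row vectors provide it. *)
Definition ambient_rV (x : ambient R N) : 'rV[R]_(N.-1) * R :=
  (\row_i (tnth x.1 i : R), last_coord x)%R.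

(* A Borel measure on the closed half-space is seen as a Borel measure on R^N
   that does not charge the complement.  It is Radon when it is finite on
   compact sets: regularity is then automatic in R^N. *)
Definition radon_halfspace (mu : {measure set (ambient R N) -> \bar R}) :=
  mu (~` halfspace_closure R N) = 0 /\
  forall A : set (ambient R N), measurable A -> compact (ambient_rV @` A) ->
    mu A < +oo.

(* mu = x_N f(x) dx + h(x') (x) delta_1(x_N) *)
Definition is_initial_measure (f : ambient R N -> \bar R)
    (h : euclid R N.-1 -> \bar R)
    (mu : {measure set (ambient R N) -> \bar R}) :=
  forall A : set (ambient R N), measurable A ->
    mu A = \int[lebesgue_ambient R N]_(x in A `&` halfspace R N)
             ((last_coord x)%:E * f x)
         + \int[lebesgue_euclid R N.-1]_(x' in [set x' | A (x', 0%R)]) h x'.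

End radon.

(** * Heat kernels *)

Section kernels.
Variables (R : realType) (N : nat).
Implicit Types (x y : ambient R N) (t : R).

(* The heat kernel of R^d at a point of squared norm [r2]. *)
Definition heat_kernel (d : nat) (r2 t : R) : R :=
  ((4 * pi * t) `^ (- (d%:R / 2)) * expR (- (r2 / (4 * t))))%R.

Definition dirichlet_kernel x y t : R :=
  (heat_kernel N (sqdist x y) t *
     (1 - expR (- (last_coord x * last_coord y / t))))%R.

Definition weighted_kernel x y t : R :=
  (if 0 < last_coord y then (last_coord y)^-1 * dirichlet_kernel x y t
   else last_coord x / t * heat_kernel N (sqdist x y) t)%R.

(* For [y] on the boundary, [weighted_kernel] is the derivative of the Dirichlet
   kernel in the variable y_N. *)
Lemma weighted_kernel_derive x (y' : euclid R N.-1) t : (0 < t)%R ->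
  is_derive (0%R : R) (1%R : R) (fun s : R => dirichlet_kernel x (y', s) t)
    (weighted_kernel x (y', 0%R) t).
Proof.
move=> t0; have tn0 := lt0r_neq0 t0.
rewrite /dirichlet_kernel /weighted_kernel /heat_kernel /sqdist /last_coord /=.
rewrite ltxx.
set c := (_ `^ _)%R; set a := boundary_sqdist _ _; set b : R := x.2.
pose g (s : R) : R := (c * expR (- ((a + (b - s) ^+ 2) / (4 * t))))%R.
have dg : is_derive (0%R : R) (1%R : R) g (g 0 * (b / (2 * t)))%R.
  by rewrite /g; apply: is_derive_eq; rewrite /GRing.scale/=; field.
have dk : is_derive (0%R : R) (1%R : R)
    (fun s : R => 1 - expR (- (b * s / t)))%R (b / t)%R.
  apply: is_derive_eq; rewrite /GRing.scale/=.
  by rewrite mulr0 mul0r oppr0 expR0; field.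
apply: (@is_derive_eq _ _ _ (g \* (fun s : R => 1 - expR (- (b * s / t))))%R).
rewrite /g /GRing.scale/=.
by rewrite mulr0 mul0r oppr0 expR0; field.
Qed.

Definition dirichlet_heat t (f : ambient R N -> \bar R) x : \bar R :=
  \int[lebesgue_ambient R N]_(y in halfspace R N)
    ((dirichlet_kernel x y t)%:E * f y).

Definition boundary_heat t (h : euclid R N.-1 -> \bar R)
    (x' : euclid R N.-1) : \bar R :=
  \int[lebesgue_euclid R N.-1]_y'
    ((heat_kernel N.-1 (boundary_sqdist x' y') t)%:E * h y').

End kernels.

(** * Solutions *)

Section solutions.
Variables (R : realType) (N : nat).

Definition is_solution (p T : R) (mu : {measure set (ambient R N) -> \bar R})
    (u : ambient R N -> R -> \bar R) :=
  [/\ nonneg_measurable (lebesgue_cylinder R N) (@cylinder R N T)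
        (fun z => u z.1 z.2),
      {ae lebesgue_cylinder R N, forall z, cylinder T z ->
        u z.1 z.2 \is a fin_num} &
      {ae lebesgue_cylinder R N, forall z, cylinder T z ->
        u z.1 z.2 =
          \int[mu]_(y in halfspace_closure R N) (weighted_kernel z.1 y z.2)%:E
        + \int[@lebesgue_measure R]_(s in `]0%R, (z.2 : R)[)
            \int[lebesgue_ambient R N]_(y in halfspace R N)
              ((dirichlet_kernel z.1 y (z.2 - s))%:E * u y s `^ p)}].

End solutions.

(* Main.v *)
From HB Require Import structures.
Require Import Defs.
From mathcomp Require Import all_boot all_order all_algebra.
From mathcomp Require Import all_classical all_reals all_analysis.
From mathcomp Require Import measurable_realfun ring lra.
Set Implicit Arguments.
Unset Strict Implicit.
Unset Printing Implicit Defensive.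
Import Order.TTheory GRing.Theory Num.Theory.
Import numFieldNormedType.Exports.
Local Open Scope classical_set_scope.
Local Open Scope ring_scope.
Local Open Scope ereal_scope.

(** Let a = min(alpha, p) and consider the two functions
      w = [G(t) f^a]^(1/a),
      v = (x_N / t) Gamma_1(x_N, t) [Gamma_(N-1)(t) h^a]^(1/a).
    Since G is sub-Markov and Gamma_(N-1) is Markov, Jensen's inequality bounds
    the free evolution of the initial measure by w + v ([free_evolution_le]), and
    it bounds w and v by the same expressions with alpha in place of a.  So it is
    enough that the Duhamel operator send (2w + 2v)^p below w + v: then 2w + 2v is
    a supersolution, and the Picard iterates started from 0 increase to a solution
    below it ([monotone_iteration]).

    The Duhamel bound ([duhamel_le]) combines the semigroup law with a sup bound.
    Write w^p = w^(p-a) w^a.  The factor w^a = G(s) f^a is carried by the semigroup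
    to G(t) f^a, whatever s is.  If w <= eps s^(-1/(p-1)), the other factor is at
    most a power of s with exponent -(p-a)/(p-1), which is integrable at 0 because
    a > 1.  The integral is a multiple of t^((a-1)/(p-1)) w(t)^a, and the sup bound
    at time t turns this into C eps^(p-1) w(t): the powers of t cancel.  Taking a
    at most p keeps the exponent p - a nonnegative.  The argument for v is the same.
    The function K(x, (y',0), t) plays the role of G: it is the limit of
    y_N^(-1) G(x, (y',y_N), t), and Fatou's lemma passes the semigroup law of G to
    this limit as an inequality ([dirichlet0_poisson0_le]).  The time singularity
    is now integrable exactly when p < 2.

    The hypotheses on f and h enter through the sup bounds.  With sigma = sqrt s,
    G(x, y, s) is at most C s^(-N/2) y_N / (y_N + sigma) exp(-|x-y|^2 / (8s))
    ([dirichlet0_le]), and this Gaussian is at most a constant times the average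
    over z of Gamma_N(x - z, 4s) restricted to |z - y| < sigma.  Exchanging the
    integrals over y and z ([averaging]) leaves the integrals of f^alpha over balls
    of radius sigma that the hypothesis controls, whose scaling gives
    w <= eps s^(-1/(p-1)) with eps^alpha a multiple of gamma.  Hence gamma small
    makes C eps^(p-1) small.

    Finally, the free evolution is finite at some point, and on a compact set the
    kernel K at this point is bounded below; so the initial measure is Radon. *)

(** * Integrals of nonnegative functions, up to null sets *)
Section integral_tools.
Context d (T : measurableType d) (R : realType).
Variable mu : {measure set T -> \bar R}.

(** The integral of a nonnegative function is a supremum over the simple functions
    below it, so monotonicity holds without measurability. *)
Lemma ge0_le_integral_nonmeas (D : set T) (f g : T -> \bar R) :
  (forall x, D x -> 0 <= f x) -> (forall x, D x -> f x <= g x) ->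
  \int[mu]_(x in D) f x <= \int[mu]_(x in D) g x.
Proof.
move=> f0 fg.
have g0 x : D x -> 0 <= g x by move=> Dx; exact: le_trans (f0 _ Dx) (fg _ Dx).
rewrite !ge0_integralE//; apply: le_ereal_sup => _ [h /= hf <-].
exists h => //= x; apply: le_trans (hf x) _.
by rewrite !patchE; case: ifPn => // /set_mem; exact: fg.
Qed.

(** The data of the problem are only measurable for the completed measure; this is
    what replaces them by Borel representatives inside integrals. *)
Lemma ge0_ae_eq_integral_nonmeas (D : set T) (f g : T -> \bar R) :
  measurable D -> measurable_fun D g ->
  (forall x, D x -> 0 <= f x) -> (forall x, D x -> 0 <= g x) ->
  {ae mu, forall x, D x -> f x = g x} ->
  \int[mu]_(x in D) f x = \int[mu]_(x in D) g x.
Proof.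
move=> mD mg f0 g0 [N [mN N0 subN]].
have off x : D x -> ~ N x -> f x = g x.
  by move=> Dx Nx; apply: contrapT => fg; apply: Nx; apply: subN => /= /(_ Dx).
apply/eqP; rewrite eq_le; apply/andP; split.
(* On the null set N nothing is known about f: it is bounded by +oo there. *)
- apply: (@le_trans _ _ (\int[mu]_(x in D) maxe (g x) ((cst +oo \_ N) x))).
    apply: ge0_le_integral_nonmeas => // x Dx.
    rewrite patchE; case: ifPn => [_|/negP Nx]; first by rewrite maxey leey.
    by rewrite off ?le_max ?lexx// => Nx'; apply: Nx; rewrite inE.
  rewrite le_eqVlt; apply/orP; left; apply/eqP; apply: ge0_ae_eq_integral => //.
  + apply: measurable_maxe => //; apply: measurable_funTS.
    by apply/(measurable_restrictT _ _).1.
  + by move=> x Dx; rewrite le_max g0.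
  + exists N; split => // x /= /not_implyP[Dx].
    rewrite patchE; case: ifPn => [/set_mem//|_].
    by rewrite max_l ?g0// => /(_ erefl).
- rewrite (ge0_negligible_integral mN)//.
  rewrite [X in X <= _](_ : _ = \int[mu]_(x in D `\` N) f x); last first.
    by apply: eq_integral => x /set_mem[Dx Nx]; rewrite off.
  rewrite integral_mkcond [leRHS]integral_mkcond.
  apply: ge0_le_integral_nonmeas => x _.
    by apply: erestrict_ge0 => y [Dy _]; exact: f0.
  rewrite !patchE; case: ifPn => [/set_mem[Dx _]|_]; first by rewrite mem_set.
  by case: ifPn => // /set_mem; exact: f0.
Qed.

End integral_tools.

(** Monotonicity makes the product converge even for 0 * +oo, since then every term
    of the sequence vanishes. *)
Lemma cvg_mule_nondecreasing (R : realType) (k : R) (u : R^nat) (y : \bar R) :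
  (forall n, 0 <= u n)%R -> nondecreasing_seq u -> u @ \oo --> k -> 0 <= y ->
  (u n)%:E * y @[n --> \oo] --> k%:E * y.
Proof.
move=> u0 ndu uk y0.
have ule n : (u n <= k)%R.
  by rewrite -(cvg_lim _ uk)//; apply: nondecreasing_cvgn_le => //; apply/cvg_ex; exists k.
have k0 : (0 <= k)%R := le_trans (u0 0%N) (ule 0%N).
have uk' : (u n)%:E @[n --> \oo] --> k%:E by apply: cvg_EFin => //; exact: nearW.
case: y y0 => [y y0|_|//]; first by apply: cvgeZr.
have [k00|k_neq0] := eqVneq k 0%R.
  have -> : (fun n => (u n)%:E * +oo) = cst 0.
    apply/funext => n /=; have -> : u n = 0%R; last by rewrite mul0e.
    by apply/eqP; rewrite eq_le u0 -k00 ule.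
  by rewrite k00 mul0e; exact: cvg_cst.
apply: cvgeM; [by apply: mule_def_neq0_infty; rewrite ?eqe|exact: uk'|exact: cvg_cst].
Qed.

(** * Measures with a density *)
Section density.
Import HBNNSimple.
Context d (T : measurableType d) (R : realType).
Variable mu : {measure set T -> \bar R}.
Variable phi : T -> \bar R.
Hypothesis mphi : measurable_fun setT phi.
Hypothesis phi0 : forall x, 0 <= phi x.

Definition density (A : set T) : \bar R := \int[mu]_(x in A) phi x.

Let density0 : density set0 = 0.
Proof. exact: integral_set0. Qed.

Let density_ge0 A : 0 <= density A.
Proof. by apply: integral_ge0 => x _; exact: phi0. Qed.

Let density_sigma_additive : semi_sigma_additive density.
Proof.
move=> F mF tF mUF; rewrite /density ge0_integral_bigcup//.
- by apply: is_cvg_ereal_nneg_natsum => n _; exact: density_ge0.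
- exact: measurable_funTS.
Qed.

HB.instance Definition _ := isMeasure.Build _ _ _ density
  density0 density_ge0 density_sigma_additive.

Definition density_measure : {measure set T -> \bar R} := density.

Lemma integral_density (D : set T) (k : T -> R) : measurable D ->
  measurable_fun setT k -> (forall x, 0 <= k x)%R ->
  \int[density_measure]_(x in D) (k x)%:E = \int[mu]_(x in D) ((k x)%:E * phi x).
Proof.
move=> mD mk k0.
have mke : measurable_fun setT (EFin \o k) by exact/measurable_EFinP.
pose k_ := nnsfun_approx measurableT mke.
have kcvg x : (k_ n x) @[n --> \oo] --> k x.
  have : (EFin \o k_ ^~ x) n @[n --> \oo] --> (EFin \o k) x.
    by apply: cvg_nnsfun_approx => // y _; rewrite lee_fin.
  by move=> /fine_cvg.
have knd x : {homo (fun n => k_ n x) : m n / (m <= n)%N >-> (m <= n)%R}.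
  by move=> m n mn; exact/lefP/nd_nnsfun_approx.
transitivity (limn (fun n => \int[density_measure]_(x in D) (k_ n x)%:E)).
  rewrite -monotone_convergence//.
  - apply: eq_integral => y yD; apply/esym/cvg_lim => //.
  apply: cvg_EFin; [exact: nearW|exact: kcvg].
  - by move=> n; apply: measurable_funTS; exact/measurable_EFinP/measurable_funP.
  - by move=> n y _; rewrite lee_fin.
  - by move=> y _ m n mn; rewrite lee_fin; exact: knd.
rewrite (_ : (fun n => _) =
    (fun n => \int[mu]_(x in D) ((k_ n x)%:E * phi x))).
  rewrite -monotone_convergence//.
  - apply: eq_integral => y yD; apply/cvg_lim => //.
    by apply: cvg_mule_nondecreasing.
  - move=> n; apply: measurable_funTS; apply: emeasurable_funM => //.
    exact/measurable_EFinP/measurable_funP.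
  - by move=> n y _; rewrite mule_ge0// lee_fin.
  - by move=> y _ m n mn; rewrite lee_wpmul2r// lee_fin; exact: knd.
apply/funext => n.
transitivity (\sum_(r \in range (k_ n))
    \int[mu]_(x in D) (r%:E * (\1_(k_ n @^-1` [set r]) x)%:E * phi x)).
  under eq_integral do rewrite fimfunE -fsumEFin//.
  rewrite ge0_integral_fsum//; last 2 first.
  - by move=> r; exact/measurable_EFinP/measurable_funM.
  - by move=> r x _; rewrite nnfun_muleindic_ge0.
  apply: eq_fsbigr => r /set_mem[x _ <-]; set A := _ @^-1` _.
  have mA : measurable A by exact: measurable_sfunP.
  rewrite integralZl_indic_nnsfun// integral_indic//=.
  under [RHS]eq_integral do rewrite -muleA.
  rewrite ge0_integralZl//; last 3 first.
  - apply: measurable_funTS; apply: emeasurable_funM => //.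
    exact/measurable_EFinP.
  - by move=> y _; rewrite mule_ge0// lee_fin.
  - by rewrite lee_fin.
  congr (_ * _); rewrite /density setIC integral_mkcondr.
  apply: eq_integral => y _; rewrite patchE indicE; case: ifPn; rewrite ?mul1e ?mul0e//.
rewrite -ge0_integral_fsum//.
- apply: eq_integral => x _; rewrite [in RHS]fimfunE -fsumEFin// ge0_mule_fsuml//.
  by move=> r; rewrite nnfun_muleindic_ge0.
- move=> r; apply: measurable_funTS; apply: emeasurable_funM => //.
  by apply: emeasurable_funM => //; exact/measurable_EFinP.
- by move=> r x _; rewrite mule_ge0// nnfun_muleindic_ge0.
Qed.
End density.

(** * Powers of extended reals and Jensen's inequality *)
Section powers.
Context (R : realType).

(** The tangent at s = l^a of the concave function s |-> s^(1/a), evaluated at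
    s = r^a. *)
Lemma young_powR (a l r : R) : (1 < a)%R -> (0 < l)%R -> (0 <= r)%R ->
  (r <= l * (1 - a^-1) + a^-1 * l `^ (1 - a) * r `^ a)%R.
Proof.
move=> a1 l0 r0.
have a0 : (0 < a)%R by lra.
have am0 : (a - 1 != 0)%R by lra.
have := @conjugate_powR R (r * l `^ (- ((a - 1) / a)))%R (l `^ ((a - 1) / a))%R a (a / (a - 1))%R.
rewrite mulr_ge0 ?powR_ge0// => /(_ isT isT a0).
have -> : (0 < a / (a - 1))%R by rewrite divr_gt0//; lra.
have -> : (a^-1 + (a / (a - 1))^-1 = 1)%R by field; lra.
move=> /(_ isT erefl).
rewrite -mulrA -powRD ?(gt_eqF l0) ?implybT// addNr powRr0 mulr1.
rewrite powRM ?powR_ge0// -!powRrM.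
have -> : ((a - 1) / a * (a / (a - 1)) = 1)%R by field; lra.
rewrite powRr1 ?(ltW l0)//.
have -> : (- ((a - 1) / a) * a = 1 - a)%R by field; lra.
have -> : ((a / (a - 1))^-1 = 1 - a^-1)%R by field; lra.
by move=> /le_trans; apply; rewrite addrC; lra.
Qed.

Lemma young_poweR (a l : R) (r : \bar R) : (1 < a)%R -> (0 < l)%R -> 0 <= r ->
  r <= (l * (1 - a^-1))%:E + (a^-1 * l `^ (1 - a))%:E * r `^ a.
Proof.
move=> a1 l0; case: r => [r r0|_|//].
  by rewrite poweR_EFin -EFinM -EFinD lee_fin; exact: young_powR.
have a0 : (0 < a)%R by exact: lt_trans a1.
by rewrite poweRyr ?gt_eqF// gt0_muley ?addey// lte_fin mulr_gt0 ?invr_gt0// powR_gt0.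
Qed.

Lemma le_poweR (x y : \bar R) (r : R) : (0 <= r)%R -> 0 <= x -> x <= y ->
  x `^ r <= y `^ r.
Proof.
move=> r0 x0 xy; apply: gt0_ler_poweR => //; rewrite in_itv/= leey andbT//.
exact: le_trans xy.
Qed.

(** A power is an increasing bijection of [0, +oo], with the reciprocal power as
    inverse, so it commutes with suprema, +oo included. *)
Lemma limn_poweR (u : (\bar R)^nat) (r : R) : (0 < r)%R ->
  (forall n, 0 <= u n) -> nondecreasing_seq u ->
  u n `^ r @[n --> \oo] --> (limn u) `^ r.
Proof.
move=> r0 u0 ndu.
have cu := ereal_nondecreasing_cvgn ndu.
have ndv : nondecreasing_seq (fun n => u n `^ r).
  by move=> m n mn; apply: le_poweR => //; [exact: ltW|exact: ndu].
have cv := ereal_nondecreasing_cvgn ndv.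
rewrite (cvg_lim _ cu)//; set L := ereal_sup _ in cv *.
suff -> : ereal_sup (range u) `^ r = L by [].
have s0 : 0 <= ereal_sup (range u).
  by apply: le_trans (u0 0%N) _; apply: ereal_sup_ubound; exists 0%N.
apply/eqP; rewrite eq_le; apply/andP; split; last first.
  apply: ge_ereal_sup => _ [n _ <-]; apply: le_poweR; rewrite ?(ltW r0)//.
  by apply: ereal_sup_ubound; exists n.
suff : ereal_sup (range u) <= L `^ r^-1.
  move=> /(@le_poweR _ _ r (ltW r0) s0) /le_trans; apply.
  rewrite -poweRrM mulVf ?gt_eqF// poweRe1//.
  by apply: le_trans (poweR_ge0 (u 0%N) r) _; apply: ereal_sup_ubound; exists 0%N.
apply: ge_ereal_sup => _ [n _ <-].
rewrite -[leLHS]poweRe1// -(@mulfV _ r) ?gt_eqF// poweRrM.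
apply: le_poweR; rewrite ?poweR_ge0 ?invr_ge0 ?(ltW r0)//.
by apply: ereal_sup_ubound; exists n.
Qed.

(** Gains a factor from a sup bound: u^p = u^(p-a) u^a. *)
Lemma poweR_le_bound (u : \bar R) (b p a : R) : 0 <= u -> u <= b%:E -> (0 < b)%R ->
  (0 < a)%R -> (a <= p)%R -> u `^ p <= (b `^ (p - a))%:E * u `^ a.
Proof.
case: u => [u u0 ub b0 a0 ap| |//]; last by rewrite leye_eq.
move: u0 ub; rewrite !lee_fin => u0 ub.
have -> : (u `^ p = u `^ (p - a) * u `^ a)%R.
  rewrite -powRD ?subrK//.
  by rewrite gt_eqF ?implybT//= (lt_le_trans a0).
by rewrite ler_wpM2r ?powR_ge0// ge0_ler_powR ?subr_ge0// nnegrE ltW.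
Qed.

Lemma poweRK (u : \bar R) (a : R) : (0 < a)%R -> 0 <= u -> (u `^ a^-1) `^ a = u.
Proof. by move=> a0 u0; rewrite -poweRrM mulVf ?gt_eqF// poweRe1. Qed.

Lemma poweR_sum_le (u v : \bar R) (p : R) : (0 < p)%R -> 0 <= u -> 0 <= v ->
  (2%:E * u + 2%:E * v) `^ p <= (4 `^ p)%:E * (u `^ p + v `^ p).
Proof.
move=> p0 u0 v0.
have sym (x y : \bar R) : 0 <= x -> x <= y ->
    (2%:E * x + 2%:E * y) `^ p <= (4 `^ p)%:E * (x `^ p + y `^ p).
  move=> x0 xy.
  have y0 := le_trans x0 xy.
  apply: (@le_trans _ _ ((4%:E * y) `^ p)).
    apply: le_poweR; [exact: ltW|by rewrite adde_ge0// mule_ge0|].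
    rewrite (_ : 4%:E = 2%:E + 2%:E); last by rewrite -EFinD; congr EFin; ring.
    by rewrite ge0_muleDl// leeD2r// lee_wpmul2l.
  rewrite poweRM// poweR_EFin lee_wpmul2l ?lee_fin ?powR_ge0//.
  by rewrite leeDr// poweR_ge0.
have [uv|/ltW vu] := leP u v; first exact: sym.
by rewrite [2%:E * u + _]addeC [u `^ p + _]addeC; exact: sym.
Qed.

Lemma powR_sqrt (s e : R) : (0 <= s)%R -> (Num.sqrt s `^ e = s `^ (e / 2))%R.
Proof. by move=> s0; rewrite -powR12_sqrt// -powRrM mulrC. Qed.

End powers.

Section jensen.
Context d (T : measurableType d) (R : realType).
Variable mu : {measure set T -> \bar R}.

(** Young's inequality with parameter l, integrated against k, gives
    l (1 - 1/a) + l^(1-a) M / a for the integral M of k F^a, and this is at most l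
    as soon as l^a >= M. *)
Lemma jensen (k : T -> R) (F : T -> \bar R) (a : R) :
  measurable_fun setT k -> (forall x, 0 <= k x)%R ->
  measurable_fun setT F -> (forall x, 0 <= F x) ->
  \int[mu]_x (k x)%:E <= 1 -> (1 <= a)%R ->
  \int[mu]_x ((k x)%:E * F x) <= (\int[mu]_x ((k x)%:E * F x `^ a)) `^ a^-1.
Proof.
move=> mk k0 mF F0 k1 a1.
have [<-|a_neq1] := eqVneq 1%R a.
  rewrite invr1 poweRe1; last by apply: integral_ge0 => x _; rewrite mule_ge0 ?lee_fin ?poweR_ge0.
  by under [leRHS]eq_integral do rewrite poweRe1//.
have {a_neq1}a1 : (1 < a)%R by rewrite lt_neqAle a_neq1.
have a0 : (0 < a)%R by exact: lt_trans a1.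
have mke : measurable_fun setT (EFin \o k) by exact/measurable_EFinP.
have mFa : measurable_fun setT (fun x => F x `^ a).
  exact: (measurableT_comp (measurable_poweR _)).
have kFa0 x : 0 <= (k x)%:E * F x `^ a by rewrite mule_ge0 ?lee_fin ?poweR_ge0.
have mkFa : measurable_fun setT (fun x => (k x)%:E * F x `^ a) by exact: emeasurable_funM.
have : 0 <= \int[mu]_x ((k x)%:E * F x `^ a) by exact: integral_ge0.
case ME : (\int[mu]_x ((k x)%:E * F x `^ a)) => [m| |//]; last first.
  by rewrite poweRyr ?leey// invr_eq0 gt_eqF.
rewrite lee_fin => m0.
(* The optimal parameter M^(1/a) may vanish, hence the additional e. *)
rewrite poweR_EFin; apply/lee_addgt0Pr => e e0.
set l := (m `^ a^-1 + e)%R.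
have l0 : (0 < l)%R by rewrite ltr_wpDl ?powR_ge0.
have ml : (m <= l `^ a)%R.
  rewrite -[leLHS]powRr1// -(@mulVf _ a) ?gt_eqF// powRrM.
  by apply: ge0_ler_powR; rewrite ?nnegrE ?powR_ge0 ?(ltW a0) ?(ltW l0)// /l lerDl (ltW e0).
rewrite -EFinD -/l.
have c1 : (0 <= l * (1 - a^-1))%R by rewrite mulr_ge0 ?(ltW l0)// subr_ge0 invf_le1// ltW.
have c2 : (0 <= a^-1 * l `^ (1 - a))%R by rewrite mulr_ge0 ?powR_ge0// invr_ge0 (ltW a0).
apply: (@le_trans _ _ (\int[mu]_x ((l * (1 - a^-1))%:E * (k x)%:E
     + (a^-1 * l `^ (1 - a))%:E * ((k x)%:E * F x `^ a)))).
  apply: ge0_le_integral => //.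
  - by move=> x _; rewrite mule_ge0 ?lee_fin.
  - exact: emeasurable_funM.
  - apply: emeasurable_funD; apply: emeasurable_funM => //; exact: measurable_cst.
  - move=> x _; rewrite muleC [X in _ <= X + _]muleC muleCA -ge0_muleDr.
    + by rewrite muleC lee_wpmul2l ?lee_fin//; exact: young_poweR.
    + by rewrite lee_fin.
    + by rewrite mule_ge0 ?poweR_ge0// lee_fin.
rewrite ge0_integralD//; last 4 first.
- by move=> x _; rewrite mule_ge0 ?lee_fin.
- by apply: emeasurable_funM => //; exact: measurable_cst.
- by move=> x _; rewrite mule_ge0 ?lee_fin.
- by apply: emeasurable_funM => //; exact: measurable_cst.
rewrite ge0_integralZl//; last by move=> x _; rewrite lee_fin.
rewrite (ge0_integralZl mu measurableT mkFa)// ME.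
apply: (@le_trans _ _ ((l * (1 - a^-1))%:E * 1 + (a^-1 * l `^ (1 - a))%:E * (l `^ a)%:E)).
  by rewrite leeD// lee_wpmul2l// lee_fin.
rewrite mule1 -EFinM -EFinD lee_fin -mulrA -powRD ?(gt_eqF l0) ?implybT//.
by rewrite subrK powRr1 ?(ltW l0)//; lra.
Qed.

Lemma jensen_power (k : T -> R) (F : T -> \bar R) (a b : R) :
  measurable_fun setT k -> (forall x, 0 <= k x)%R ->
  measurable_fun setT F -> (forall x, 0 <= F x) ->
  \int[mu]_x (k x)%:E <= 1 -> (0 < a)%R -> (a <= b)%R ->
  (\int[mu]_x ((k x)%:E * F x `^ a)) `^ a^-1 <=
  (\int[mu]_x ((k x)%:E * F x `^ b)) `^ b^-1.
Proof.
move=> mk k0 mF F0 k1 a0 ab; have b0 : (0 < b)%R by exact: lt_le_trans ab.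
have ba : (1 <= b / a)%R by rewrite ler_pdivlMr// mul1r.
have := @jensen k (fun x => F x `^ a) (b / a) mk k0
  (measurableT_comp (measurable_poweR _) mF) (fun x => poweR_ge0 _ _) k1 ba.
under [X in _ <= X `^ _ -> _]eq_integral do rewrite -poweRrM mulrCA divff ?gt_eqF// mulr1.
move=> le1; have i0 : (0 <= a^-1)%R by rewrite invr_ge0 ltW.
apply: le_trans (le_poweR i0 _ le1) _.
  by apply: integral_ge0 => x _; rewrite mule_ge0 ?poweR_ge0 ?lee_fin.
by rewrite -poweRrM invf_div mulrAC divff ?gt_eqF// mul1r.
Qed.

End jensen.

(** * Monotone iteration *)
Section measurable_section_integral.
Context d1 d2 (X : measurableType d1) (Y : measurableType d2) (R : realType).

Lemma measurable_integral_snd (m : {sigma_finite_measure set Y -> \bar R})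
    (f : X * Y -> \bar R) :
  measurable_fun setT f -> (forall z, 0 <= f z) ->
  measurable_fun setT (fun x => \int[m]_y f (x, y)).
Proof. by move=> mf f0; exact: measurable_fun_fubini_tonelli_F. Qed.

Lemma measurable_integral_fst (m : {sigma_finite_measure set X -> \bar R})
    (f : X * Y -> \bar R) :
  measurable_fun setT f -> (forall z, 0 <= f z) ->
  measurable_fun setT (fun y => \int[m]_x f (x, y)).
Proof. by move=> mf f0; exact: measurable_fun_fubini_tonelli_G. Qed.

Lemma exchange_integral (m1 : {sigma_finite_measure set X -> \bar R})
    (m2 : {sigma_finite_measure set Y -> \bar R}) (f : X * Y -> \bar R) :
  measurable_fun setT f -> (forall z, 0 <= f z) ->
  \int[m1]_x \int[m2]_y f (x, y) = \int[m2]_y \int[m1]_x f (x, y).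
Proof. by move=> mf f0; exact: fubini_tonelli. Qed.

End measurable_section_integral.

(** The set D is where the comparison with U is known.  The kernel ignores what
    happens outside D, so that the iterates are compared with U only there. *)
Section monotone_iteration.
Context d (Z : measurableType d) (R : realType).
Variable nu : {sigma_finite_measure set Z -> \bar R}.
Variables (k : Z * Z -> R) (p : R) (D : set Z) (u0 U : Z -> \bar R).
Hypotheses (mk : measurable_fun setT k) (k0 : forall z, (0 <= k z)%R).
Hypotheses (p0 : (0 < p)%R) (kD : forall z w, ~ D w -> k (z, w) = 0%R).
Hypotheses (mu0 : measurable_fun setT u0) (u00 : forall z, 0 <= u0 z).
Hypotheses (mU : measurable_fun setT U).
Hypothesis supersol : forall z, D z ->
  u0 z + \int[nu]_w ((k (z, w))%:E * U w `^ p) <= U z.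

Let step (v : Z -> \bar R) z := u0 z + \int[nu]_w ((k (z, w))%:E * v w `^ p).

Let mkv (v : Z -> \bar R) z : measurable_fun setT v ->
  measurable_fun setT (fun w => (k (z, w))%:E * v w `^ p).
Proof.
move=> mv; apply: emeasurable_funM; last exact: (measurableT_comp (measurable_poweR _)).
by apply/measurable_EFinP; exact: measurableT_comp.
Qed.

Let kv0 (v : Z -> \bar R) z w : 0 <= (k (z, w))%:E * v w `^ p.
Proof. by rewrite mule_ge0 ?lee_fin ?poweR_ge0. Qed.

Let mstep v : measurable_fun setT v -> measurable_fun setT (step v).
Proof.
move=> mv; apply: emeasurable_funD => //.
apply: (@measurable_integral_snd _ _ _ _ _ nu
  (fun zw => (k zw)%:E * v zw.2 `^ p)).
- apply: emeasurable_funM; first exact/measurable_EFinP.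
  apply: (measurableT_comp (measurable_poweR _)).
  exact: measurableT_comp.
- by case.
Qed.

Let le_step v w : measurable_fun setT v -> measurable_fun setT w ->
  (forall z, 0 <= v z) -> (forall z, D z -> v z <= w z) ->
  forall z, step v z <= step w z.
Proof.
move=> mv mw v0 vw z; apply: leeD => //; apply: ge0_le_integral => //.
- exact: mkv.
- exact: mkv.
- move=> x _; have [Dx|nDx] := pselect (D x); last by rewrite kD// !mul0e.
  rewrite lee_wpmul2l ?lee_fin//; apply: le_poweR => //; [exact: ltW|exact: vw].
Qed.

(** The Picard iterates started from 0 increase and stay below U; the monotone
    convergence theorem identifies the equation satisfied by their limit. *)
Lemma monotone_iteration : exists u : Z -> \bar R,
  [/\ measurable_fun setT u, forall z, 0 <= u z,
      forall z, u z = u0 z + \int[nu]_w ((k (z, w))%:E * u w `^ p) &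
      forall z, D z -> u z <= U z].
Proof.
pose v n := iter n step (cst 0).
have vS n : v n.+1 = step (v n) by [].
have mv n : measurable_fun setT (v n).
  by elim: n => [|n IH]; [exact: measurable_cst|rewrite vS; exact: mstep].
have v0 n z : 0 <= v n z.
  by case: n => [//|n]; rewrite vS adde_ge0// integral_ge0.
have vle n z : v n z <= v n.+1 z.
  elim: n z => [z|n IH z]; first exact: v0.
  by rewrite (vS n) (vS n.+1); apply: le_step.
have ndv z : nondecreasing_seq (v ^~ z).
  by apply/nondecreasing_seqP => n; exact: vle.
have vU n z : D z -> v n z <= U z.
  elim: n z => [|n IH] z Dz; last first.
    by apply: le_trans (supersol Dz); rewrite vS; exact: le_step.
  apply: le_trans (supersol Dz); rewrite adde_ge0// integral_ge0//.
pose u z := limn (v ^~ z).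
have cu z : v n z @[n --> \oo] --> u z.
  exact: ereal_nondecreasing_is_cvgn.
have mu : measurable_fun setT u by apply: (emeasurable_fun_cvg v) => // z _.
exists u; split => //.
- by move=> z; apply: lime_ge; [exact: cu|exact: nearW].
- move=> z.
  have c1 : v n.+1 z @[n --> \oo] --> u z by rewrite (cvg_shiftS (v ^~ z)); exact: cu.
  suff c2 : v n.+1 z @[n --> \oo] --> u0 z + \int[nu]_w ((k (z, w))%:E * u w `^ p).
    exact: etrans (esym (cvg_lim _ c1)) (cvg_lim _ c2).
  have cint : \int[nu]_w ((k (z, w))%:E * v n w `^ p) @[n --> \oo] -->
      \int[nu]_w ((k (z, w))%:E * u w `^ p).
    rewrite (_ : \int[nu]_w _ = \int[nu]_w limn (fun n => (k (z, w))%:E * v n w `^ p)).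
      apply: cvg_monotone_convergence => //.
      - by move=> n; exact: mkv.
      - move=> w _ m n mn; rewrite lee_wpmul2l ?lee_fin//.
        by apply: le_poweR => //; [exact: ltW|exact: ndv].
    apply: eq_integral => w _; apply/esym/cvg_lim => //.
    by apply: cvgeZl => //; exact: limn_poweR.
  have [zoo|zoo] := eqVneq (u0 z) +oo.
    rewrite zoo addye; last by rewrite gt_eqF// (@lt_le_trans _ _ 0)// integral_ge0.
    rewrite (_ : (fun _ => _) = cst +oo); first exact: cvg_cst.
    apply/funext => n; rewrite vS /step zoo addye//.
    by rewrite gt_eqF// (@lt_le_trans _ _ 0)// integral_ge0.
  apply: cvgeD => //; last exact: cvg_cst.
  by rewrite fin_num_adde_defr// ge0_fin_numE// ltey.
- by move=> z Dz; apply: lime_le; [exact: cu|apply: nearW => n; exact: vU].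
Qed.

End monotone_iteration.

(** * Averaging and Duhamel integrals *)
Section averaging.
Context d (X : measurableType d) (R : realType).
Variable nu : {sigma_finite_measure set X -> \bar R}.

(** If k y is at most the average of q over the points z close to y, the integrals of
    Phi near each z control the integral of k Phi: exchange the integrals over y
    and z. *)
Lemma averaging (k q : X -> R) (Q : set (X * X)) (Phi : X -> \bar R) (C M : R) :
  measurable_fun setT k -> (forall y, 0 <= k y)%R ->
  measurable_fun setT q -> (forall z, 0 <= q z)%R -> measurable Q ->
  measurable_fun setT Phi -> (forall y, 0 <= Phi y) ->
  (0 <= C)%R -> (0 <= M)%R ->
  \int[nu]_z (q z)%:E <= 1 ->
  (forall y, (k y)%:E <= C%:E * \int[nu]_z (q z * \1_Q (z, y))%:E) ->
  (forall z, \int[nu]_y ((\1_Q (z, y))%:E * Phi y) <= M%:E) ->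
  \int[nu]_y ((k y)%:E * Phi y) <= (C * M)%:E.
Proof.
move=> mk k0 mq q0 mQ mPhi Phi0 C0 M0 q1 kQ QM.
have mQ1 : measurable_fun setT (\1_Q : X * X -> R) by exact: measurable_indic.
have mf : measurable_fun setT (fun zy : X * X =>
    (q zy.1)%:E * ((\1_Q zy)%:E * Phi zy.2)).
  apply: emeasurable_funM; first by apply/measurable_EFinP; exact: measurableT_comp.
  apply: emeasurable_funM; first exact/measurable_EFinP.
  exact: measurableT_comp.
have f0 zy : 0 <= (q zy.1)%:E * ((\1_Q zy)%:E * Phi zy.2).
  by rewrite !mule_ge0 ?lee_fin.
have mqQ y : measurable_fun setT (fun z => (q z * \1_Q (z, y))%:E).
  apply/measurable_EFinP; apply: measurable_funM => //.
  exact: (measurableT_comp mQ1).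
have iqQ0 y : 0 <= \int[nu]_z (q z * \1_Q (z, y))%:E.
  by apply: integral_ge0 => z _; rewrite lee_fin mulr_ge0.
have mG : measurable_fun setT (fun y => \int[nu]_z (q z * \1_Q (z, y))%:E).
  apply: (@measurable_integral_fst _ _ _ _ _ nu
     (fun zy => (q zy.1 * \1_Q zy)%:E)).
  - apply/measurable_EFinP; apply: measurable_funM => //; exact: measurableT_comp.
  - by move=> zy; rewrite lee_fin mulr_ge0.
apply: (@le_trans _ _ (\int[nu]_y (C%:E *
   (\int[nu]_z ((q z)%:E * ((\1_Q (z, y))%:E * Phi y)))))).
  apply: ge0_le_integral => //.
  - by move=> y _; rewrite mule_ge0 ?lee_fin.
  - by apply: emeasurable_funM => //; exact/measurable_EFinP.
  - apply: emeasurable_funM; first exact: measurable_cst.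
    exact: (measurable_integral_fst nu mf f0).
  - move=> y _; under eq_integral do rewrite muleA -EFinM.
    rewrite ge0_integralZr//; last by move=> z _; rewrite lee_fin mulr_ge0.
    by rewrite muleA lee_wpmul2r.
have i0 z : 0 <= \int[nu]_y ((\1_Q (z, y))%:E * Phi y).
  by apply: integral_ge0 => y _; rewrite mule_ge0 ?lee_fin.
rewrite ge0_integralZl//; last 2 first.
- exact: (measurable_integral_fst nu mf f0).
- by move=> y _; apply: integral_ge0 => z _; exact: (f0 (z, y)).
rewrite EFinM lee_wpmul2l ?lee_fin//.
have /= <- := exchange_integral nu nu mf f0.
apply: (@le_trans _ _ (\int[nu]_z ((q z)%:E * M%:E))).
  apply: ge0_le_integral => //.
  - by move=> z _; apply: integral_ge0 => y _; exact: (f0 (z, y)).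
  - exact: (measurable_integral_snd nu mf f0).
  - by apply: emeasurable_funM => //; exact/measurable_EFinP.
  - move=> z _; rewrite ge0_integralZl//; last 3 first.
    + by apply: emeasurable_funM => //; apply/measurable_EFinP; exact: (measurableT_comp mQ1).
    + by move=> y _; rewrite mule_ge0 ?lee_fin.
    + by rewrite lee_fin.
    + by rewrite lee_wpmul2l ?lee_fin.
rewrite ge0_integralZr//; last 2 first.
- exact/measurable_EFinP.
- by move=> z _; rewrite lee_fin.
by rewrite -[leRHS]mul1e lee_wpmul2r ?lee_fin.
Qed.

End averaging.

Section time_integral.
Context (R : realType).
Notation leb := (@lebesgue_measure R).

Lemma is_derive_powR (b s : R) : (0 < s)%R ->
  is_derive (s : R) (1%R : R) (fun s : R => s `^ b)%R (b * s `^ (b - 1))%R.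
Proof.
move=> s0; have sin : s \in `]0%R, +oo[ by rewrite in_itv/= s0.
apply: DeriveDef; first exact: derivable_powR.
by rewrite -derive1E powR_derive1//.
Qed.

(** The integral over [t/(n+2), t] is computed from the antiderivative, and these
    intervals increase to a set containing ]0, t[. *)
Lemma integral_powR_lt1 (theta t : R) : (theta < 1)%R -> (0 < t)%R ->
  \int[leb]_(s in `]0%R, t[) (s `^ (- theta))%:E <=
  (t `^ (1 - theta) / (1 - theta))%:E.
Proof.
move=> th1 t0.
have th0 : (1 - theta != 0)%R by lra.
pose F (s : R) : R := (s `^ (1 - theta) * (1 - theta)^-1)%R.
have dF (s : R) : (0 < s)%R -> is_derive (s : R) (1%R : R) F (s `^ (- theta))%R.
  move=> s0; rewrite /F; have := is_derive_powR (1 - theta) s0 => d.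
  apply: is_derive_eq; rewrite /GRing.scale/= ?mulr0 ?add0r ?addr0.
  by rewrite (_ : (1 - theta - 1 = - theta)%R); [field|lra].
have cF (s : R) : (0 < s)%R -> {for s, continuous F}.
  move=> s0; apply/differentiable_continuous/derivable1_diffP.
  by case: (dF _ s0).
pose E n := [set` `[(t / n.+2%:R)%R, t]].
have e0 n : (0 < t / n.+2%:R)%R by rewrite divr_gt0.
have mf : measurable_fun setT (fun s : R => (s `^ (- theta))%:E).
  by apply/measurable_EFinP; exact: measurable_powR.
have E_le n : \int[leb]_(s in E n) (s `^ (- theta))%:E <=
    (t `^ (1 - theta) / (1 - theta))%:E.
  have et : (t / n.+2%:R < t)%R by rewrite ltr_pdivrMr// ltr_pMr// ltr1n.
  rewrite /E (@continuous_FTC2 _ _ F)//.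
  - rewrite -EFinB lee_fin /F gerBl mulr_ge0 ?powR_ge0// invr_ge0; lra.
  - apply: derivable_within_continuous => x; rewrite in_itv/= => /andP[ex _].
    by apply: derivable_powR; rewrite in_itv/= andbT (lt_le_trans (e0 n)).
  - split.
    + move=> x; rewrite in_itv/= => /andP[ex _].
      by case: (dF x) => //; exact: lt_trans ex.
    + by apply: cvg_at_right_filter; apply: cF.
    + by apply: cvg_at_left_filter; apply: cF.
  - move=> x; rewrite in_itv/= => /andP[ex _]; rewrite derive1E.
    by case: (dF x) => //; exact: lt_trans ex.
have EU : `]0%R, t[%classic `<=` \bigcup_n E n.
  move=> s /=; rewrite in_itv/= => /andP[s0 st].
exists (Num.truncn (t / s)) => //; rewrite /E /= in_itv/= (ltW st) andbT.
  rewrite ler_pdivrMr// mulrC -ler_pdivrMr//.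
  apply: (@le_trans _ _ (Num.truncn (t / s)).+1%:R); last by rewrite ler_nat.
  by rewrite ltW// truncnS_gt.
have ndE : nondecreasing_seq E.
  move=> m n mn; rewrite subsetEset /E; apply: subset_itvr; rewrite bnd_simp.
  by rewrite ler_pM2l// lef_pV2 ?posrE// ler_nat ltnS.
apply: (@le_trans _ _ (\int[leb]_(s in \bigcup_n E n) (s `^ (- theta))%:E)).
  apply: ge0_subset_integral => //.
- by apply: bigcup_measurable => n _; exact: measurable_itv.
  - exact: measurable_funTS.
  - by move=> s _; rewrite lee_fin powR_ge0.
have cvE : \int[leb]_(s in E n) (s `^ (- theta))%:E @[n --> \oo] -->
    \int[leb]_(s in \bigcup_n E n) (s `^ (- theta))%:E.
  apply: ge0_nondecreasing_set_cvg_integral => //.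
  - by move=> n; exact: measurable_itv.
  - by move=> n; exact: measurable_funTS.
  - by move=> n s _; rewrite lee_fin powR_ge0.
rewrite -(cvg_lim _ cvE)//; apply: lime_le; [by apply/cvg_ex; eexists; exact: cvE|exact: nearW].
Qed.

End time_integral.

Section duhamel.
Context d (X : measurableType d) (R : realType).
Variable nu : {sigma_finite_measure set X -> \bar R}.
Notation leb := (@lebesgue_measure R).

(** P is a quantity that the kernel propagates: its image at time t is at most Q, for
    every starting time s.  If W^p costs only an integrable power of s times P, the
    time integral separates from Q, and the last hypothesis returns from Q to W. *)
Lemma duhamel_le (t A B theta p : R) (g : X * measurableTypeR R -> R)
    (W P : X * measurableTypeR R -> \bar R) (Q w : \bar R) :
  (theta < 1)%R -> (0 < t)%R -> (0 <= A)%R -> (0 <= B)%R ->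
  measurable_fun setT g -> (forall z, 0 <= g z)%R ->
  measurable_fun setT W -> measurable_fun setT P -> (forall z, 0 <= P z) ->
  0 <= Q -> 0 <= w ->
  (forall (s : R) y, (0 < s < t)%R -> (g (y, s))%:E * W (y, s) `^ p <=
     (A * s `^ (- theta))%:E * ((g (y, s))%:E * P (y, s))) ->
  (forall s : R, (0 < s < t)%R -> \int[nu]_y ((g (y, s))%:E * P (y, s)) <= Q) ->
  Q <= (B * t `^ (- (1 - theta)))%:E * w ->
  \int[leb]_(s in `]0%R, t[) \int[nu]_y ((g (y, s))%:E * W (y, s) `^ p) <=
  (A * B / (1 - theta))%:E * w.
Proof.
move=> th1 t0 A0 B0 mg g0 mW mP P0 Q0 w0 WP PQ Qw.
have mge : measurable_fun setT (EFin \o g) by exact/measurable_EFinP.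
have mgW : measurable_fun setT (fun z => (g z)%:E * W z `^ p).
  by apply: emeasurable_funM => //; exact: (measurableT_comp (measurable_poweR _)).
have mgP : measurable_fun setT (fun z => (g z)%:E * P z) by exact: emeasurable_funM.
have gW0 z : 0 <= (g z)%:E * W z `^ p by rewrite mule_ge0 ?poweR_ge0 ?lee_fin.
have gP0 z : 0 <= (g z)%:E * P z by rewrite mule_ge0 ?lee_fin.
have ms : measurable_fun setT (fun s : measurableTypeR R => (s `^ (- theta))%:E).
  by apply/measurable_EFinP; exact: measurable_powR.
apply: (@le_trans _ _ (\int[leb]_(s in `]0%R, t[) ((s `^ (- theta))%:E * (A%:E * Q)))).
  apply: ge0_le_integral => //.
  - by move=> s _; apply: integral_ge0 => y _; exact: gW0.
  - apply: measurable_funTS.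
    exact: (measurable_integral_fst nu mgW gW0).
  - apply: measurable_funTS; apply: emeasurable_funM => //.
  - move=> s; rewrite /= in_itv/= => st.
    rewrite muleA -EFinM mulrC.
    apply: (@le_trans _ _ (\int[nu]_y ((A * s `^ (- theta))%:E * ((g (y, s))%:E * P (y, s))))).
      apply: ge0_le_integral => //.
      + exact: (measurableT_comp mgW (measurable_pair2 s)).
      + apply: emeasurable_funM => //; exact: (measurableT_comp mgP (measurable_pair2 s)).
      + by move=> y _; exact: WP.
    rewrite ge0_integralZl//; last 2 first.
    + exact: (measurableT_comp mgP (measurable_pair2 s)).
    + by rewrite lee_fin mulr_ge0 ?powR_ge0.
    by rewrite lee_wpmul2l ?PQ// lee_fin mulr_ge0 ?powR_ge0.
rewrite ge0_integralZr//; last 3 first.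
- exact: measurable_funTS.
- by move=> s _; rewrite lee_fin powR_ge0.
- by rewrite mule_ge0.
apply: (@le_trans _ _ ((t `^ (1 - theta) / (1 - theta))%:E *
    (A%:E * ((B * t `^ (- (1 - theta)))%:E * w)))).
  apply: lee_pmul.
  - by apply: integral_ge0 => s _; rewrite lee_fin powR_ge0.
  - by rewrite mule_ge0.
  - exact: integral_powR_lt1.
  - by rewrite lee_wpmul2l.
rewrite !muleA -!EFinM lee_wpmul2r// lee_fin.
have tt : (t `^ (1 - theta) * t `^ (- (1 - theta)) = 1)%R.
  by rewrite -powRD ?subrr ?powRr0// (gt_eqF t0) implybT.
rewrite le_eqVlt; apply/orP; left; apply/eqP.
move: tt; set u := (t `^ _)%R; set v := (t `^ _)%R => uv.
transitivity (A * B / (1 - theta) * (u * v))%R; last by rewrite uv mulr1.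
by field; lra.
Qed.

End duhamel.

(** * Gaussian kernels on the line *)
Section gaussian.
Context (R : realType).
Notation leb := (@lebesgue_measure R).
Notation hk := (@heat_kernel R).

Lemma heat_kernel_ge0 d (r t : R) : (0 <= hk d r t)%R.
Proof. by rewrite mulr_ge0 ?powR_ge0 ?expR_ge0. Qed.

Lemma heat_kernelD d e (a b t : R) : (0 < t)%R ->
  hk (d + e) (a + b)%R t = (hk d a t * hk e b t)%R.
Proof.
move=> t0; rewrite /heat_kernel mulrACA -expRD -powRD; last first.
  by rewrite (gt_eqF (mulr_gt0 _ t0)) ?implybT// mulr_gt0 ?pi_gt0.
congr (_ `^ _ * expR _)%R; last by field; lra.
by rewrite natrD; field.
Qed.

Lemma heat_kernel_prod n (a : 'I_n -> R) (t : R) : (0 < t)%R ->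
  hk n (\sum_(i < n) a i)%R t = (\prod_(i < n) hk 1 (a i) t)%R.
Proof.
move=> t0; elim: n a => [|n IH] a.
  by rewrite !big_ord0 /heat_kernel !mul0r oppr0 powRr0 expR0 mulr1.
by rewrite !big_ord_recl -IH -heat_kernelD.
Qed.

Lemma heat_kernel1_normal_pdf (m t z : R) : (0 < t)%R ->
  hk 1 ((z - m) ^+ 2)%R t = normal_pdf m (Num.sqrt (2 * t))%R z.
Proof.
move=> t0.
have t2 : (0 < 2 * t)%R by lra.
have s0 : (Num.sqrt (2 * t) != 0)%R by rewrite gt_eqF// sqrtr_gt0.
rewrite normal_pdfE// /normal_peak /normal_fun sqr_sqrtr ?ltW//.
rewrite /heat_kernel; congr (_ * expR _)%R; last by field; lra.
rewrite powRN mul1r powR12_sqrt; last by rewrite !mulr_ge0 ?pi_ge0 ?(ltW t0).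
by congr (Num.sqrt _)^-1%R; ring.
Qed.

Lemma integral_heat_kernel1 (m t : R) : (0 < t)%R ->
  \int[leb]_z (hk 1 ((z - m) ^+ 2)%R t)%:E = 1.
Proof.
move=> t0; under eq_integral do rewrite heat_kernel1_normal_pdf//.
by apply: integral_normal_pdf; rewrite gt_eqF// sqrtr_gt0; lra.
Qed.

(** Completing the square in z.  The semigroup law of the line and, by reflections,
    that of the half-line follow by integrating in z. *)
Lemma heat_kernel1_mul (x y z t s : R) : (0 < t)%R -> (0 < s)%R ->
  (hk 1 ((x - z) ^+ 2) t * hk 1 ((z - y) ^+ 2) s =
   hk 1 ((x - y) ^+ 2) (t + s) *
   hk 1 ((z - (x * s + y * t) / (t + s)) ^+ 2) (t * s / (t + s)))%R.
Proof.
move=> t0 s0.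
have ts0 : (0 < t + s)%R by lra.
have tau0 : (0 < t * s / (t + s))%R by rewrite divr_gt0 ?mulr_gt0.
have p4 : (0 < 4 * pi :> R)%R by rewrite mulr_gt0 ?pi_gt0.
have q0 (u : R) : (0 < u)%R -> (0 <= 4 * pi * u)%R by move=> u0; rewrite mulr_ge0 ?ltW.
rewrite /heat_kernel mulrACA [RHS]mulrACA -!expRD -!powRM ?q0//.
congr (_ `^ _ * expR _)%R; first by field; lra.
by field; lra.
Qed.

End gaussian.

Section measurability.
Context (R : realType).
Notation hk := (@heat_kernel R).

Lemma measurable_funV d (T : measurableType d) (D : set T) (f : T -> R) :
  measurable_fun D f -> measurable_fun D (fun x => (f x)^-1)%R.
Proof.
move=> mf.
have minv : measurable_fun [set: measurableTypeR R] (fun x : measurableTypeR R => (x : R)^-1%R).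
  rewrite (_ : (fun _ => _) = (fun x : R => if (0 <= x)%R then (x `^ (-1))%R
      else (- ((- x) `^ (-1)))%R)); last first.
    apply/funext => x; case: ifPn => x0; first by rewrite powR_inv1.
    by rewrite powR_inv1 ?invrN ?opprK// oppr_ge0 ltW// ltNge.
  apply: measurable_fun_ifT.
  - exact: measurable_fun_ler.
  - exact: measurable_powR.
  - apply: measurableT_comp => //.
    by apply: (measurableT_comp (measurable_powR _)).
exact: measurableT_comp minv mf.
Qed.

Lemma measurable_heat_kernel d (T : measurableType d) (D : set T) n (a t : T -> R) :
  measurable_fun D a -> measurable_fun D t ->
  measurable_fun D (fun w => hk n (a w) (t w)).
Proof.
move=> ma mt; have m4t (c : R) : measurable_fun D (fun w => c * t w)%R.
  exact: measurable_funM.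
apply: measurable_funM.
  by apply: (measurableT_comp (measurable_powR _)); exact: m4t.
apply: measurableT_comp => //; apply: measurableT_comp => //.
by apply: measurable_funM => //; apply: measurable_funV; exact: m4t.
Qed.

Lemma measurable_set_bool d (T : measurableType d) (b : T -> bool) :
  measurable_fun setT b -> measurable [set x | b x].
Proof. by move=> mb; rewrite -[X in measurable X]setTI; exact: mb. Qed.

End measurability.

(** * The Dirichlet kernel of the half-line *)
Section half_line.
Context (R : realType).
Notation leb := (@lebesgue_measure R).
Notation hk := (@heat_kernel R).

(** Method of images: the heat kernel of the line minus its reflection. *)
Definition half_line_kernel (x y t : R) : R :=
  (hk 1 ((x - y) ^+ 2) t - hk 1 ((x + y) ^+ 2) t)%R.

Lemma half_line_kernelE (x y t : R) : (0 < t)%R ->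
  half_line_kernel x y t = (hk 1 ((x - y) ^+ 2) t * (1 - expR (- (x * y / t))))%R.
Proof.
move=> t0; rewrite /half_line_kernel mulrBr mulr1; congr (_ - _)%R.
rewrite /heat_kernel -[RHS]mulrA -expRD; congr (_ * expR _)%R.
by field; lra.
Qed.

Lemma half_line_kernel_ge0 (x y t : R) : (0 < t)%R -> (0 <= x)%R -> (0 <= y)%R ->
  (0 <= half_line_kernel x y t)%R.
Proof.
move=> t0 x0 y0; rewrite half_line_kernelE// mulr_ge0 ?heat_kernel_ge0// subr_ge0.
by rewrite -expR0 ler_expR oppr_le0 divr_ge0 ?mulr_ge0// ltW.
Qed.

Let mgauss (m t : R) :
  measurable_fun setT (fun z : measurableTypeR R => (hk 1 ((z - m) ^+ 2) t)%:E).
Proof.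
apply/measurable_EFinP; apply: measurable_heat_kernel; last exact: measurable_cst.
by apply: measurable_funX; exact: measurable_funB.
Qed.

(** The reflection z |-> -z turns the second Gaussian on the positive half-line into
    the first one on the negative half-line. *)
Lemma half_line_gaussian_pair (m t : R) : (0 < t)%R ->
  \int[leb]_(z in `]0%R, +oo[) (hk 1 ((z - m) ^+ 2) t + hk 1 ((z + m) ^+ 2) t)%:E = 1.
Proof.
move=> t0; have g0 (a : R) : (0 <= hk 1 a t)%R by exact: heat_kernel_ge0.
under eq_integral do rewrite EFinD.
have mgaussN : measurable_fun setT (fun z : measurableTypeR R => (hk 1 ((z + m) ^+ 2) t)%:E).
  by have := mgauss (- m) t; under eq_fun do rewrite opprK.
rewrite ge0_integralD//; last 4 first.
- by move=> z _; rewrite lee_fin.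
- exact: measurable_funTS.
- by move=> z _; rewrite lee_fin.
- exact: measurable_funTS.
rewrite [X in _ + X](_ : _ = \int[leb]_(z in `]-oo, 0%R]) (hk 1 ((z - m) ^+ 2) t)%:E).
  rewrite -ge0_integral_setU//=.
  - rewrite setUC -itv_bndbnd_setU ?bnd_simp// set_itvE; exact: integral_heat_kernel1.
  - by apply: measurable_funTS.
  - by move=> z _; rewrite lee_fin.
  - apply/disj_setPS => z [] /=; rewrite !in_itv/= andbT => z0 z1; lra.
rewrite integral_itv_obnd_cbnd; last exact: measurable_funTS.
rewrite ge0_integration_by_substitution0; [|exact: mgaussN|by move=> z; rewrite lee_fin].
by apply: eq_integral => z _; congr (hk 1 _ t)%:E; ring.
Qed.

(** The product of two kernels expands into four Gaussians in z, two of them with a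
    minus sign.  Moving these to the left gives an identity between nonnegative
    functions, where each side pairs a Gaussian with its mirror image. *)
Lemma half_line_semigroup (x y t s : R) : (0 < t)%R -> (0 < s)%R ->
  (0 < x)%R -> (0 < y)%R ->
  \int[leb]_(z in `]0%R, +oo[) (half_line_kernel x z t * half_line_kernel z y s)%:E =
  (half_line_kernel x y (t + s))%:E.
Proof.
move=> t0 s0 x0 y0.
have ts0 : (0 < t + s)%R by lra.
pose tau := (t * s / (t + s))%R.
have tau0 : (0 < tau)%R by rewrite divr_gt0 ?mulr_gt0.
pose pair m (z : R) := (hk 1 ((z - m) ^+ 2) tau + hk 1 ((z + m) ^+ 2) tau)%R.
pose m1 := ((x * s + y * t) / (t + s))%R.
pose m2 := ((x * s + - y * t) / (t + s))%R.
have key (z : R) : (half_line_kernel x z t * half_line_kernel z y s +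
    hk 1 ((x + y) ^+ 2) (t + s) * pair m2 z =
    hk 1 ((x - y) ^+ 2) (t + s) * pair m1 z)%R.
  have e1 := heat_kernel1_mul x y z t0 s0.
  have e2 := heat_kernel1_mul x (- y) z t0 s0.
  have e3 := heat_kernel1_mul (- x) y z t0 s0.
  have e4 := heat_kernel1_mul (- x) (- y) z t0 s0.
  rewrite /half_line_kernel /pair.
  rewrite (_ : (- x * s + y * t) / (t + s) = - m2)%R in e3; last by rewrite /m2; field; lra.
  rewrite (_ : (- x * s + - y * t) / (t + s) = - m1)%R in e4; last by rewrite /m1; field; lra.
  rewrite !opprK in e2 e3 e4.
  rewrite -/m1 -/tau in e1; rewrite -/m2 -/tau in e2; rewrite -/tau in e3; rewrite -/tau in e4.
  rewrite (_ : (- x - z) ^+ 2 = (x + z) ^+ 2)%R in e3; last by ring.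
  rewrite (_ : (- x - z) ^+ 2 = (x + z) ^+ 2)%R in e4; last by ring.
  rewrite (_ : (- x - y) ^+ 2 = (x + y) ^+ 2)%R in e3; last by ring.
  rewrite (_ : (- x + y) ^+ 2 = (x - y) ^+ 2)%R in e4; last by ring.
  rewrite !mulrDr -e1 -e2 -e3 -e4; ring.
have mpair m : measurable_fun setT (fun z : measurableTypeR R => (pair m z)%:E).
  apply/measurable_EFinP; apply: measurable_funD; apply: measurable_heat_kernel;
    try exact: measurable_cst; apply: measurable_funX;
    first [exact: measurable_funB|exact: measurable_funD].
have pair0 m z : (0 <= pair m z)%R by rewrite addr_ge0 ?heat_kernel_ge0.
have pair1 m c : (0 <= c)%R ->
    \int[leb]_(z in `]0%R, +oo[) (c%:E * (pair m z)%:E) = c%:E.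
  move=> c0; rewrite ge0_integralZl ?half_line_gaussian_pair ?mule1 ?lee_fin//.
  - exact: measurable_funTS.
  - by move=> z _; rewrite lee_fin.
have mD : measurable_fun setT (fun z : measurableTypeR R =>
    (half_line_kernel x z t * half_line_kernel z y s)%:E).
  apply/measurable_EFinP; apply: measurable_funM; apply: measurable_funB;
    apply: measurable_heat_kernel; try exact: measurable_cst;
    apply: measurable_funX; first [exact: measurable_funB|exact: measurable_funD].
have hg c d : (0 <= hk 1 c d)%R by exact: heat_kernel_ge0.
have : \int[leb]_(z in `]0%R, +oo[) (half_line_kernel x z t * half_line_kernel z y s)%:E +
    (hk 1 ((x + y) ^+ 2) (t + s))%:E = (hk 1 ((x - y) ^+ 2) (t + s))%:E.
  rewrite -[X in _ + X](pair1 m2)// -ge0_integralD//.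
  - rewrite -[RHS](pair1 m1)//; apply: eq_integral => z _.
    by rewrite -EFinM -EFinD key EFinM.
  - move=> z; rewrite /= in_itv/= andbT => z0.
    by rewrite lee_fin mulr_ge0// half_line_kernel_ge0// ltW.
  - exact: measurable_funTS.
  - by move=> z _; rewrite mule_ge0 ?lee_fin.
  - by apply: measurable_funTS; apply: emeasurable_funM.
by case: integral => [r [e]| |] //; rewrite /half_line_kernel -e addrK.
Qed.

End half_line.

(** * Product integrals *)
Section product_integrals.
Context d1 d2 (X : measurableType d1) (Y : measurableType d2) (R : realType).
Variables (m1 : {sigma_finite_measure set X -> \bar R})
          (m2 : {sigma_finite_measure set Y -> \bar R}).

Lemma integral_product1 (f : X * Y -> \bar R) :
  measurable_fun setT f -> (forall z, 0 <= f z) ->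
  \int[product_measure m1 m2]_z f z = \int[m1]_x \int[m2]_y f (x, y).
Proof. by move=> mf f0; exact: fubini_tonelli1. Qed.

Lemma integral_product2 (f : X * Y -> \bar R) :
  measurable_fun setT f -> (forall z, 0 <= f z) ->
  \int[product_measure m1 m2]_z f z = \int[m2]_y \int[m1]_x f (x, y).
Proof. by move=> mf f0; exact: fubini_tonelli2. Qed.

Lemma integral_product_mul (f : X -> R) (g : Y -> R) (a b : R) :
  measurable_fun setT f -> (forall x, 0 <= f x)%R ->
  measurable_fun setT g -> (forall y, 0 <= g y)%R ->
  \int[m1]_x (f x)%:E = a%:E -> \int[m2]_y (g y)%:E = b%:E ->
  \int[product_measure m1 m2]_z (f z.1 * g z.2)%:E = (a * b)%:E.
Proof.
move=> mf f0 mg g0 fa gb; rewrite integral_product1.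
- rewrite EFinM -fa -ge0_integralZr//; last 3 first.
  + exact/measurable_EFinP.
  + by move=> x _; rewrite lee_fin.
  + by rewrite -gb integral_ge0// => y _; rewrite lee_fin.
  apply: eq_integral => x _ /=.
  under eq_integral do rewrite EFinM.
  rewrite ge0_integralZl ?gb ?lee_fin//; last by move=> y _; rewrite lee_fin.
  exact/measurable_EFinP.
- by apply/measurable_EFinP; apply: measurable_funM; exact: measurableT_comp.
- by move=> z; rewrite lee_fin mulr_ge0.
Qed.

End product_integrals.

Section euclid_products.
Context (R : realType).
Notation leb := (@lebesgue_measure R).

Lemma integral_euclid_cons n (f : euclid R n.+1 -> \bar R) :
  measurable_fun setT f -> (forall z, 0 <= f z) ->
  \int[lebesgue_euclid R n.+1]_z f z =
  \int[product_measure leb (lebesgue_euclid R n)]_z f (euclid_cons z).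
Proof.
move=> mf f0.
exact: (@ge0_integral_pushforward _ _ _ _ R _ (@measurable_euclid_cons R n)
  (product_measure leb (lebesgue_euclid R n)) setT f).
Qed.

Lemma measurable_euclid_prod n (phi : 'I_n -> R -> R) :
  (forall i, measurable_fun [set: measurableTypeR R] (phi i)) ->
  measurable_fun [set: euclid R n] (fun z : euclid R n => \prod_(i < n) phi i (tnth z i))%R.
Proof.
move=> mphi; apply: measurable_prod => i _.
apply: measurableT_comp; first exact: mphi.
exact: measurable_tnth.
Qed.

(** Every integral over R^n needed below has a product integrand: the total mass of
    the heat kernel, its semigroup law, and the mass near a point. *)
Lemma integral_euclid_prod n (phi : 'I_n -> R -> R) (c : 'I_n -> R) :
  (forall i, measurable_fun [set: measurableTypeR R] (phi i)) ->
  (forall i a, 0 <= phi i a)%R ->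
  (forall i, \int[leb]_a (phi i a)%:E = (c i)%:E) ->
  \int[lebesgue_euclid R n]_z (\prod_(i < n) phi i (tnth z i))%:E =
  (\prod_(i < n) c i)%:E.
Proof.
elim: n phi c => [|n IH] phi c mphi phi0 phic.
  under eq_integral do rewrite big_ord0.
  rewrite big_ord0 integral_dirac// diracE in_setT mul1e//.
rewrite integral_euclid_cons; last 2 first.
- by apply/measurable_EFinP; exact: measurable_euclid_prod.
- by move=> z; rewrite lee_fin prodr_ge0.
rewrite big_ord_recl.
rewrite -(@integral_product_mul _ _ _ _ R leb (lebesgue_euclid R n) (phi ord0)
   (fun z' => \prod_(i < n) phi (lift ord0 i) (tnth z' i))%R)//.
- apply: eq_integral => z _; congr EFin; rewrite big_ord_recl; congr (_ * _)%R.
  by apply: eq_bigr => i _; rewrite tnthS.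
- exact: (@measurable_euclid_prod n (fun i => phi (lift ord0 i))).
- by move=> y; exact: prodr_ge0.
- exact: (IH (fun i => phi (lift ord0 i))).
Qed.

End euclid_products.

(** * The heat kernels of the space and of the half-space *)
Section euclid_heat.
Context (R : realType) (n : nat).
Notation leb := (@lebesgue_measure R).
Notation hk := (@heat_kernel R).
Notation E := (euclid R n).
Notation X := (ambient R n.+1).
Notation lebE := (lebesgue_euclid R n).
Notation lebX := (lebesgue_ambient R n.+1).
Notation bsq := (@boundary_sqdist R n.+1).
Notation sqd := (@sqdist R n.+1).

Lemma measurable_boundary_sqdist d (T : measurableType d) (x y : T -> E) :
  measurable_fun setT x -> measurable_fun setT y ->
  measurable_fun setT (fun w => bsq (x w) (y w)).
Proof.
move=> mx my; apply: measurable_sum => i.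
apply: measurable_funX; apply: measurable_funB.
- exact: (measurableT_comp (measurable_tnth i) mx).
- exact: (measurableT_comp (measurable_tnth i) my).
Qed.

Lemma measurable_sqdist d (T : measurableType d) (x y : T -> X) :
  measurable_fun setT x -> measurable_fun setT y ->
  measurable_fun setT (fun w => sqd (x w) (y w)).
Proof.
move=> mx my; apply: measurable_funD.
  by apply: measurable_boundary_sqdist; exact: measurableT_comp.
apply: measurable_funX; apply: measurable_funB.
- exact: (measurableT_comp measurable_snd mx).
- exact: (measurableT_comp measurable_snd my).
Qed.

Lemma heat_boundary_prod (x y : E) (t : R) : (0 < t)%R ->
  hk n (bsq x y) t = (\prod_(i < n) hk 1 ((tnth x i - tnth y i : R) ^+ 2) t)%R.
Proof. by move=> t0; rewrite heat_kernel_prod. Qed.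

Lemma heat_ambient_split (x y : X) (t : R) : (0 < t)%R ->
  hk n.+1 (sqd x y) t =
  (hk n (bsq x.1 y.1) t * hk 1 ((x.2 - y.2 : R) ^+ 2) t)%R.
Proof. by move=> t0; rewrite /sqdist -heat_kernelD// addn1. Qed.

Lemma measurable_gaussian (m t : R) :
  measurable_fun [set: measurableTypeR R] (fun z : R => hk 1 ((m - z) ^+ 2) t).
Proof.
apply: measurable_heat_kernel; last exact: measurable_cst.
by apply: measurable_funX; exact: measurable_funB.
Qed.

Lemma integral_heat_boundary (x : E) (t : R) : (0 < t)%R ->
  \int[lebE]_z (hk n (bsq x z) t)%:E = 1.
Proof.
move=> t0; under eq_integral do rewrite heat_boundary_prod//.
rewrite (@integral_euclid_prod R n (fun i a => hk 1 ((tnth x i - a) ^+ 2) t)%R (fun=> 1%R)).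
- by rewrite big1.
- by move=> i; exact: measurable_gaussian.
- by move=> i a; exact: heat_kernel_ge0.
- move=> i; rewrite -(integral_heat_kernel1 (tnth x i) t0).
  by apply: eq_integral => z _; congr (hk 1 _ t)%:E; ring.
Qed.

Lemma heat_boundary_semigroup (x y : E) (t s : R) : (0 < t)%R -> (0 < s)%R ->
  \int[lebE]_z (hk n (bsq x z) t * hk n (bsq z y) s)%:E =
  (hk n (bsq x y) (t + s))%:E.
Proof.
move=> t0 s0.
have ts0 : (0 < t + s)%R by lra.
have tau0 : (0 < t * s / (t + s))%R by rewrite divr_gt0 ?mulr_gt0.
under eq_integral do rewrite !heat_boundary_prod// -big_split/=.
rewrite heat_boundary_prod//.
apply: (@integral_euclid_prod R n
  (fun i a => hk 1 ((tnth x i - a) ^+ 2) t * hk 1 ((a - tnth y i) ^+ 2) s)%R).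
- move=> i; apply: measurable_funM; first exact: measurable_gaussian.
  apply: measurable_heat_kernel; last exact: measurable_cst.
  by apply: measurable_funX; exact: measurable_funB.
- by move=> i a; rewrite mulr_ge0 ?heat_kernel_ge0.
- move=> i; under eq_integral do rewrite heat_kernel1_mul// EFinM.
  rewrite ge0_integralZl ?integral_heat_kernel1 ?mule1 ?lee_fin ?heat_kernel_ge0//.
  + apply/measurable_EFinP; apply: measurable_heat_kernel; last exact: measurable_cst.
    by apply: measurable_funX; exact: measurable_funB.
  + by move=> z _; rewrite lee_fin heat_kernel_ge0.
Qed.

Lemma integral_heat_ambient (x : X) (t : R) : (0 < t)%R ->
  \int[lebX]_z (hk n.+1 (sqd x z) t)%:E = 1.
Proof.
move=> t0; under eq_integral do rewrite heat_ambient_split//.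
rewrite (@integral_product_mul _ _ _ _ R lebE leb (fun z => hk n (bsq x.1 z) t)
  (fun z => hk 1 ((x.2 - z : R) ^+ 2) t) 1 1) ?mul1r//.
- apply: measurable_heat_kernel; last exact: measurable_cst.
  by apply: measurable_boundary_sqdist => //; exact: measurable_cst.
- by move=> z; exact: heat_kernel_ge0.
- exact: measurable_gaussian.
- by move=> z; exact: heat_kernel_ge0.
- exact: integral_heat_boundary.
- rewrite -(integral_heat_kernel1 (x.2 : R) t0).
  by apply: eq_integral => z _; congr (hk 1 _ t)%:E; ring.
Qed.

(** The Dirichlet kernel extended by zero, so that it is nonnegative and jointly
    measurable on the whole space-time. *)
Definition dirichlet0 (x y : X) (t : R) : R :=
  if [&& (0 < t)%R, (0 < x.2 :> R)%R & (0 < y.2 :> R)%R] then dirichlet_kernel x y t else 0%R.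

Lemma dirichlet0_split (x y : X) (t : R) : (0 < t)%R -> (0 < x.2 :> R)%R -> (0 < y.2 :> R)%R ->
  dirichlet0 x y t = (hk n (bsq x.1 y.1) t * half_line_kernel x.2 y.2 t)%R.
Proof.
move=> t0 x0 y0; rewrite /dirichlet0 t0 x0 y0 /= /dirichlet_kernel heat_ambient_split//.
by rewrite half_line_kernelE// mulrA.
Qed.

Lemma dirichlet0_ge0 x y t : (0 <= dirichlet0 x y t)%R.
Proof.
rewrite {1}/dirichlet0; case: ifPn => [/and3P[t0 x0 y0]|//].
rewrite mulr_ge0 ?heat_kernel_ge0// subr_ge0 -[leRHS]expR0 ler_expR oppr_le0.
by rewrite divr_ge0 ?mulr_ge0// ltW.
Qed.

Lemma dirichlet0_le_heat x y t : (dirichlet0 x y t <= hk n.+1 (sqd x y) t)%R.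
Proof.
rewrite /dirichlet0; case: ifPn => [_|_]; last exact: heat_kernel_ge0.
by rewrite ler_piMr ?heat_kernel_ge0// gerBl expR_ge0.
Qed.

Lemma measurable_dirichlet0 d (T : measurableType d) (x y : T -> X) (t : T -> R) :
  measurable_fun setT x -> measurable_fun setT y -> measurable_fun setT t ->
  measurable_fun setT (fun w => dirichlet0 (x w) (y w) (t w)).
Proof.
move=> mx my mt.
have mx2 : measurable_fun setT (fun w => (x w).2 : R).
  exact: (measurableT_comp measurable_snd mx).
have my2 : measurable_fun setT (fun w => (y w).2 : R).
  exact: (measurableT_comp measurable_snd my).
apply: measurable_fun_ifT; last exact: measurable_cst.
  by apply: measurable_and; [|apply: measurable_and]; exact: measurable_fun_ltr.
apply: measurable_funM.
  by apply: measurable_heat_kernel => //; exact: measurable_sqdist.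
apply: measurable_funB => //; apply: measurableT_comp => //; apply: measurableT_comp => //.
by apply: measurable_funM; [exact: measurable_funM|exact: measurable_funV].
Qed.

Lemma integral_dirichlet0_le1 x t : \int[lebX]_y (dirichlet0 x y t)%:E <= 1.
Proof.
have [t0|t0] := ltP 0%R t; last first.
  rewrite integral0_eq ?lee01// => y _; rewrite /dirichlet0 ltNge t0//.
rewrite -(integral_heat_ambient x t0); apply: ge0_le_integral => //.
- by move=> y _; rewrite lee_fin dirichlet0_ge0.
- apply/measurable_EFinP; exact: measurable_dirichlet0.
- apply/measurable_EFinP; apply: measurable_heat_kernel => //.
  exact: measurable_sqdist.
- by move=> y _; rewrite lee_fin dirichlet0_le_heat.
Qed.

(** The kernel is the product of the heat kernel of R^(N-1) and of the half-line
    kernel, so the two semigroup laws multiply. *)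
Lemma dirichlet0_semigroup (x y : X) (t s : R) : (0 < t)%R -> (0 < s)%R ->
  \int[lebX]_z (dirichlet0 x z t * dirichlet0 z y s)%:E = (dirichlet0 x y (t + s))%:E.
Proof.
move=> t0 s0; have ts0 : (0 < t + s)%R by lra.
have [/andP[x0 y0]|xy] := boolP ((0 < x.2 :> R)%R && (0 < y.2 :> R)%R); last first.
  rewrite (_ : dirichlet0 x y (t + s) = 0%R); last by rewrite /dirichlet0 ts0 (negbTE xy).
  rewrite integral0_eq// => z _.
  rewrite /dirichlet0 t0 s0 /=; move: xy; rewrite negb_and => /orP[/negbTE->|/negbTE->].
    by rewrite mul0r.
  by rewrite andbF mulr0.
rewrite dirichlet0_split//.
pose phi (z : E) : R := (hk n (bsq x.1 z) t * hk n (bsq z y.1) s)%R.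
pose psi (z : R) : R := (half_line_kernel x.2 z t * half_line_kernel z y.2 s *
   \1_(`]0%R, +oo[%classic) z)%R.
rewrite -(@integral_product_mul _ _ _ _ R lebE leb phi psi).
- apply: eq_integral => z _; congr EFin; rewrite /phi /psi indicE.
  case: (ltP 0%R (z.2 : R)) => z0.
    rewrite mem_set ?mulr1; last by rewrite /= in_itv/= z0.
    by rewrite !dirichlet0_split// mulrACA.
  rewrite memNset; last by rewrite /= in_itv/= andbT ltNge z0.
  by rewrite !mulr0 /dirichlet0 [(0 < z.2 :> R)%R]ltNge z0 !andbF/= mul0r.
- apply: measurable_funM; apply: measurable_heat_kernel; try exact: measurable_cst;
    by apply: measurable_boundary_sqdist => //; exact: measurable_cst.
- by move=> z; rewrite mulr_ge0 ?heat_kernel_ge0.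
- apply: measurable_funM; last exact: measurable_indic.
  apply: measurable_funM; apply: measurable_funB;
    apply: measurable_heat_kernel; try exact: measurable_cst;
    apply: measurable_funX; first [exact: measurable_funB|exact: measurable_funD].
- move=> z; rewrite /psi indicE; case: (ltP 0%R z) => z0.
    by apply: mulr_ge0 => //; apply: mulr_ge0; apply: half_line_kernel_ge0 => //; exact: ltW.
  by rewrite memNset ?mulr0//= in_itv/= andbT ltNge z0.
- exact: heat_boundary_semigroup.
- rewrite -half_line_semigroup//.
  rewrite [RHS]integral_mkcond; apply: eq_integral => z _.
  rewrite patchE /psi indicE; case: ifPn => _; by rewrite ?mulr1 ?mulr0.
Qed.

End euclid_heat.

(** * The Poisson kernel *)
Section boundary_kernel.
Context (R : realType) (n : nat).
Notation leb := (@lebesgue_measure R).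
Notation hk := (@heat_kernel R).
Notation E := (euclid R n).
Notation X := (ambient R n.+1).
Notation lebE := (lebesgue_euclid R n).
Notation lebX := (lebesgue_ambient R n.+1).
Notation bsq := (@boundary_sqdist R n.+1).
Notation sqd := (@sqdist R n.+1).

(** The kernel K at a boundary point (the parabolic Poisson kernel), extended by
    zero like [dirichlet0]. *)
Definition poisson0 (x : X) (y' : E) (t : R) : R :=
  if (0 < t)%R && (0 < x.2 :> R)%R then weighted_kernel x (y', 0%R : R) t else 0%R.

Lemma poisson0E (x : X) (y' : E) (t : R) : (0 < t)%R -> (0 < x.2 :> R)%R ->
  poisson0 x y' t = (x.2 / t * heat_kernel 1 ((x.2 : R) ^+ 2) t * hk n (bsq x.1 y') t)%R.
Proof.
move=> t0 x0; rewrite /poisson0 t0 x0 /weighted_kernel /last_coord /= ltxx.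
by rewrite heat_ambient_split// subr0 [RHS]mulrAC mulrA.
Qed.

Lemma poisson0_ge0 x y' t : (0 <= poisson0 x y' t)%R.
Proof.
have [/andP[t0 x0]|tx] := boolP ((0 < t)%R && (0 < x.2 :> R)%R); last first.
  by rewrite /poisson0 (negbTE tx).
rewrite poisson0E//; apply: mulr_ge0; last exact: heat_kernel_ge0.
by apply: mulr_ge0; [apply: divr_ge0; exact: ltW|exact: heat_kernel_ge0].
Qed.

Lemma measurable_poisson0 d (T : measurableType d) (x : T -> X) (y' : T -> E) (t : T -> R) :
  measurable_fun setT x -> measurable_fun setT y' -> measurable_fun setT t ->
  measurable_fun setT (fun w => poisson0 (x w) (y' w) (t w)).
Proof.
move=> mx my mt.
have mx2 : measurable_fun setT (fun w => (x w).2 : R).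
  exact: (measurableT_comp measurable_snd mx).
apply: measurable_fun_ifT; last exact: measurable_cst.
  by apply: measurable_and; exact: measurable_fun_ltr.
rewrite /weighted_kernel /last_coord /= ltxx.
apply: measurable_funM; first by apply: measurable_funM => //; exact: measurable_funV.
apply: measurable_heat_kernel => //; apply: measurable_sqdist => //.
by apply: measurable_fun_pair => //; exact: measurable_cst.
Qed.

(** K at the boundary is the normal derivative of G, tested here along the heights
    1 / (m + 1). *)
Lemma cvg_dirichlet0_poisson0 (x : X) (y' : E) (t : R) : (0 < t)%R ->
  (m.+1%:R * dirichlet0 x (y', m.+1%:R^-1 : R) t)%R @[m --> \oo] --> poisson0 x y' t.
Proof.
move=> t0.
have [x0|x0] := ltP 0%R (x.2 : R); last first.
  rewrite /poisson0 t0 ltNge x0 /=.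
  rewrite (_ : (fun _ => _) = cst 0%R); first exact: cvg_cst.
  by apply/funext => m; rewrite /dirichlet0 t0 [(0 < x.2 :> R)%R]ltNge x0/= mulr0.
have [dv dE] := @weighted_kernel_derive R n.+1 x y' t t0.
rewrite /poisson0 t0 x0/= -dE.
move: dv; rewrite /derivable => dv.
have /cvgr_dnbhsP/(_ (@harmonic R)) : (fun h : R => h^-1 *:
   (((fun s : R => dirichlet_kernel x (y', s) t) \o shift 0%R) (h *: (1%R : R)) -
    dirichlet_kernel x (y', 0%R : R) t))%R @ 0%R^' -->
   ('D_1 (fun s : R => dirichlet_kernel x (y', s) t) (0 : R))%R by exact: dv.
move=> /(_ (conj (fun m => lt0r_neq0 (harmonic_gt0 m)) cvg_harmonic)).
move=> H; apply: cvg_trans H; apply: near_eq_cvg; apply: nearW => m /=.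
rewrite /dirichlet0 t0 x0 invr_gt0 ltr0Sn/= invrK addr0 /GRing.scale/= mulr1.
by rewrite {2}/dirichlet_kernel /last_coord/= mulr0 mul0r oppr0 expR0 subrr mulr0 subr0.
Qed.

(** Fatou's lemma in the semigroup law of G, divided by the height of the second
    point as this point reaches the boundary. *)
Lemma dirichlet0_poisson0_le (x : X) (y' : E) (t s : R) : (0 < t)%R -> (0 < s)%R ->
  \int[lebX]_z (dirichlet0 x z t * poisson0 z y' s)%:E <= (poisson0 x y' (t + s))%:E.
Proof.
move=> t0 s0; have ts0 : (0 < t + s)%R by lra.
pose f (m : nat) (z : X) : \bar R :=
  (dirichlet0 x z t * (m.+1%:R * dirichlet0 z (y', m.+1%:R^-1 : R) s))%:E.
have fcvg z : f m z @[m --> \oo] --> (dirichlet0 x z t * poisson0 z y' s)%:E.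
  apply: cvg_EFin; first exact: nearW.
  by apply: cvgMr; exact: cvg_dirichlet0_poisson0.
have fint m : \int[lebX]_z f m z = (m.+1%:R * dirichlet0 x (y', m.+1%:R^-1 : R) (t + s))%:E.
  rewrite EFinM -dirichlet0_semigroup// -ge0_integralZl//.
  - by apply: eq_integral => z _; rewrite -EFinM /f mulrCA.
  - apply/measurable_EFinP; apply: measurable_funM; apply: measurable_dirichlet0 => //;
    exact: measurable_cst.
  - by move=> z _; rewrite lee_fin mulr_ge0 ?dirichlet0_ge0.
have cvgint : \int[lebX]_z f m z @[m --> \oo] --> (poisson0 x y' (t + s))%:E.
  under eq_cvg do rewrite fint.
  by apply: cvg_EFin; [exact: nearW|exact: cvg_dirichlet0_poisson0].
have [<- _] := cvg_limn_einf_sup cvgint.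
apply: le_trans (fatou lebX measurableT _ _).
- rewrite le_eqVlt; apply/orP; left; apply/eqP; apply: eq_integral => z _.
  by have [-> _] := cvg_limn_einf_sup (fcvg z).
- move=> m; apply/measurable_EFinP; apply: measurable_funM.
    by apply: measurable_dirichlet0 => //; exact: measurable_cst.
  apply: measurable_funM; first exact: measurable_cst.
  by apply: measurable_dirichlet0 => //; exact: measurable_cst.
- by move=> m z _; rewrite lee_fin !mulr_ge0 ?dirichlet0_ge0.
Qed.

End boundary_kernel.

(** * Sup bounds from averages over balls *)
Section heat_bounds.
Context (R : realType) (n : nat).
Notation leb := (@lebesgue_measure R).
Notation hk := (@heat_kernel R).
Notation E := (euclid R n).
Notation X := (ambient R n.+1).
Notation lebE := (lebesgue_euclid R n).
Notation lebX := (lebesgue_ambient R n.+1).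
Notation bsq := (@boundary_sqdist R n.+1).
Notation sqd := (@sqdist R n.+1).

(** A cube of side sqrt(s) / (n + 2) in at most n + 1 dimensions has diameter less
    than sqrt(s), and it is a product set, which a ball is not. *)
Definition box_side (s : R) : R := (Num.sqrt s / n.+2%:R)%R.

Definition box_cst : R := ((4 * pi * 4) `^ (- 2^-1) * expR (- 8^-1) / n.+2%:R)%R.

Lemma box_cst_gt0 : (0 < box_cst)%R.
Proof.
by rewrite divr_gt0// mulr_gt0 ?expR_gt0// powR_gt0// !mulr_gt0 ?pi_gt0.
Qed.

(** A lower bound for z |-> Gamma_1(a - z, 4s) on the interval of length [box_side]
    that starts at b.  It comes from (a-z)^2 <= 2(a-b)^2 + 2(z-b)^2, where the last
    term is at most 2s. *)
Definition box (s a b z : R) : R :=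
  ((4 * pi * (4 * s)) `^ (- (1%:R / 2)) * expR (- 8^-1) *
   expR (- ((a - b) ^+ 2 / (8 * s))) * \1_(`[b, (b + box_side s)%R]%classic) z)%R.

Lemma box_ge0 s a b z : (0 <= box s a b z)%R.
Proof. by rewrite !mulr_ge0 ?powR_ge0 ?expR_ge0. Qed.

Lemma measurable_box s a b : measurable_fun [set: measurableTypeR R] (box s a b).
Proof.
apply: measurable_funM; first exact: measurable_cst.
exact: measurable_indic.
Qed.

Lemma box_side_ge0 s : (0 <= box_side s)%R.
Proof. by rewrite divr_ge0 ?sqrtr_ge0. Qed.

Lemma box_side_sq s : (0 <= s)%R -> (box_side s ^+ 2 * n.+2%:R ^+ 2 = s)%R.
Proof.
by move=> s0; rewrite -exprMn /box_side divfK ?sqr_sqrtr// pnatr_eq0.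
Qed.

Lemma integral_box s a b : (0 < s)%R ->
  \int[leb]_z (box s a b z)%:E = (box_cst * expR (- ((a - b) ^+ 2 / (8 * s))))%:E.
Proof.
move=> s0; rewrite /box; set c := (_ * _ * _)%R.
have c0 : (0 <= c)%R by rewrite !mulr_ge0 ?powR_ge0 ?expR_ge0.
under eq_integral do rewrite EFinM.
rewrite ge0_integralZl//; last first.
  by apply/measurable_EFinP; exact: measurable_indic.
have leb_itv : leb `[b, (b + box_side s)%R]%classic = (box_side s)%:E.
  rewrite lebesgue_measure_itv/= lte_fin ltrDl divr_gt0 ?sqrtr_gt0//.
  by rewrite -EFinB addrAC subrr add0r.
rewrite integral_indic// setIT -[X in _ * X]/(leb _) leb_itv -EFinM; congr EFin.
have e : ((4 * pi * (4 * s)) `^ (- (1%:R / 2)) * Num.sqrt s = (4 * pi * 4) `^ (- 2^-1))%R.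
  rewrite mulrA powRM ?(ltW s0)//; last by rewrite !mulr_ge0 ?pi_ge0.
  rewrite mul1r -mulrA -(powR12_sqrt (ltW s0)) -powRD ?(gt_eqF s0) ?implybT//.
  by rewrite addNr powRr0 mulr1.
by rewrite /c /box_side /box_cst -e; field.
Qed.

Lemma box_supp s a b z : box s a b z != 0%R -> (b <= z <= b + box_side s)%R.
Proof.
rewrite /box mulf_eq0 negb_or => /andP[_]; rewrite indicE.
by case: (boolP (z \in _)); rewrite ?eqxx// inE /= in_itv.
Qed.

Lemma box_le s a b z : (0 < s)%R -> (box s a b z <= hk 1 ((a - z) ^+ 2) (4 * s))%R.
Proof.
move=> s0; have [->|/box_supp/andP[bz zb]] := eqVneq (box s a b z) 0%R.
  exact: heat_kernel_ge0.
have r2 := box_side_sq (ltW s0).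
have r0 := box_side_ge0 s.
have n2 : (1 <= n.+2%:R ^+ 2 :> R)%R by rewrite exprn_ege1// ler1n.
rewrite /box /heat_kernel; set P := (_ `^ _)%R.
rewrite -2!(mulrA P) ler_wpM2l ?powR_ge0// -expRD.
apply: (@le_trans _ _ (expR (- 8^-1 - (a - b) ^+ 2 / (8 * s)))%R).
  by rewrite ler_piMr ?expR_ge0// indicE; case: (_ \in _).
rewrite ler_expR -opprD lerN2.
have zb2 : ((z - b) ^+ 2 <= s)%R.
  apply: (@le_trans _ _ (box_side s ^+ 2)%R).
    by rewrite ler_pXn2r ?nnegrE ?lerBlDl// subr_ge0.
  by rewrite -[leRHS]r2 ler_peMr// sqr_ge0.
have az : ((a - z) ^+ 2 <= 2 * (a - b) ^+ 2 + 2 * s)%R.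
  have uv : ((a - z) ^+ 2 = 2 * (a - b) ^+ 2 + 2 * (z - b) ^+ 2 - (a - b + (z - b)) ^+ 2)%R by ring.
  by have := sqr_ge0 (a - b + (z - b)); rewrite uv; lra.
rewrite ler_pdivrMr; last by lra.
have -> : ((8^-1 + (a - b) ^+ 2 / (8 * s)) * (4 * (4 * s)) = 2 * (a - b) ^+ 2 + 2 * s)%R.
  by field; lra.
exact: az.
Qed.

Lemma prod_box_le (s : R) (x y z : E) : (0 < s)%R ->
  (\prod_(i < n) box s (tnth x i) (tnth y i) (tnth z i) <= hk n (bsq x z) (4 * s))%R.
Proof.
move=> s0; rewrite heat_boundary_prod ?mulr_gt0//; apply: ler_prod => i _.
by rewrite box_ge0 box_le.
Qed.

Lemma prod_box_supp (s : R) (x y z : E) : (0 < s)%R ->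
  (\prod_(i < n) box s (tnth x i) (tnth y i) (tnth z i) != 0)%R ->
  (bsq z y <= n%:R * box_side s ^+ 2)%R.
Proof.
move=> s0 /prodf_neq0 nz.
apply: (@le_trans _ _ (\sum_(i < n) box_side s ^+ 2)%R); last first.
  by rewrite sumr_const card_ord mulr_natl.
apply: ler_sum => i _; have /box_supp/andP[yz zy] := nz i isT.
by rewrite ler_pXn2r ?nnegrE ?box_side_ge0 ?subr_ge0// lerBlDl.
Qed.

Lemma integral_prod_box (s : R) (x y : E) : (0 < s)%R ->
  \int[lebE]_z (\prod_(i < n) box s (tnth x i) (tnth y i) (tnth z i))%:E =
  (box_cst ^+ n * expR (- (bsq x y / (8 * s))))%:E.
Proof.
move=> s0.
rewrite (@integral_euclid_prod R n (fun i => box s (tnth x i) (tnth y i))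
  (fun i => box_cst * expR (- ((tnth x i - tnth y i : R) ^+ 2 / (8 * s))))%R).
- congr EFin; rewrite big_split/= prodr_const card_ord; congr (_ * _)%R.
  by rewrite -expR_sum sumrN mulr_suml.
- by move=> i; exact: measurable_box.
- by move=> i a; exact: box_ge0.
- by move=> i; exact: integral_box.
Qed.

Lemma measurable_prod_box s x y :
  measurable_fun [set: E] (fun z : E => \prod_(i < n) box s (tnth x i) (tnth y i) (tnth z i))%R.
Proof.
apply: (@measurable_euclid_prod R n (fun i => box s (tnth x i) (tnth y i))) => i.
exact: measurable_box.
Qed.

(** k squared sides add up to k s / (n+2)^2 < s. *)
Lemma box_side_lt (k : nat) (s d : R) : (k < n.+2)%N -> (0 < s)%R ->
  (d <= k%:R * box_side s ^+ 2)%R -> (d < s)%R.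
Proof.
move=> kn s0 dk; apply: le_lt_trans dk _.
rewrite -[ltRHS](box_side_sq (ltW s0)) mulrC ltr_pM2l; last first.
  by rewrite exprn_gt0// divr_gt0// sqrtr_gt0.
by rewrite -natrX ltr_nat (leq_trans kn)// -{1}(expn1 n.+2) leq_pexp2l.
Qed.

Definition near_boundary (s : R) : set (E * E) := [set w | (bsq w.1 w.2 < s)%R].

Lemma measurable_near_boundary s : measurable (near_boundary s).
Proof.
apply: measurable_set_bool; apply: measurable_fun_ltr; last exact: measurable_cst.
exact: measurable_boundary_sqdist.
Qed.

(** The product of the lower bounds [box] vanishes unless z lies in the cube at y,
    whose points are within sqrt(s) of y. *)
Lemma boundary_gaussian_le_average (s : R) (x y : E) : (0 < s)%R ->
  (box_cst ^+ n * expR (- (bsq x y / (8 * s))))%:E <=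
  \int[lebE]_z (hk n (bsq x z) (4 * s) * \1_(near_boundary s) (z, y))%:E.
Proof.
move=> s0; rewrite -integral_prod_box//; apply: ge0_le_integral => //.
- by move=> z _; rewrite lee_fin prodr_ge0// => i _; exact: box_ge0.
- by apply/measurable_EFinP; exact: measurable_prod_box.
- apply/measurable_EFinP; apply: measurable_funM.
    apply: measurable_heat_kernel; last exact: measurable_cst.
    by apply: measurable_boundary_sqdist => //; exact: measurable_cst.
  have m1 : measurable_fun setT (\1_(near_boundary s) : E * E -> R).
    by apply: measurable_indic; exact: measurable_near_boundary.
  exact: (measurableT_comp m1).
- move=> z _; rewrite lee_fin.
  have [->|nz] := eqVneq (\prod_(i < n) box s (tnth x i) (tnth y i) (tnth z i))%R 0%R.
    by rewrite mulr_ge0 ?heat_kernel_ge0.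
  rewrite indicE mem_set ?mulr1; first exact: prod_box_le.
  apply: (@box_side_lt n) => //; exact: prod_box_supp nz.
Qed.

(** The cube at y extends upwards from y, so its points z stay in the half-space. *)
Definition near_ambient (s : R) : set (X * X) :=
  [set w | [&& (0 < w.1.2 :> R)%R, (0 < w.2.2 :> R)%R & (sqd w.1 w.2 < s)%R]].

Lemma measurable_near_ambient s : measurable (near_ambient s).
Proof.
apply: measurable_set_bool.
apply: measurable_and; [|apply: measurable_and]; apply: measurable_fun_ltr;
  try exact: measurable_cst.
- exact: (measurableT_comp measurable_snd measurable_fst).
- exact: (measurableT_comp measurable_snd measurable_snd).
- exact: measurable_sqdist.
Qed.

Lemma ambient_gaussian_le_average (s : R) (x y : X) : (0 < s)%R -> (0 < y.2 :> R)%R ->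
  (box_cst ^+ n.+1 * expR (- (sqd x y / (8 * s))))%:E <=
  \int[lebX]_z (hk n.+1 (sqd x z) (4 * s) * \1_(near_ambient s) (z, y))%:E.
Proof.
move=> s0 y0.
pose phi (z : E) : R := (\prod_(i < n) box s (tnth x.1 i) (tnth y.1 i) (tnth z i))%R.
pose psi (z : R) : R := box s x.2 y.2 z.
have mphi : measurable_fun setT phi by exact: measurable_prod_box.
have mpsi : measurable_fun [set: measurableTypeR R] psi by exact: measurable_box.
have phi0 z : (0 <= phi z)%R by apply: prodr_ge0 => i _; exact: box_ge0.
have psi0 z : (0 <= psi z)%R by exact: box_ge0.
rewrite (_ : (box_cst ^+ n.+1 * _)%:E = \int[lebX]_z (phi z.1 * psi z.2)%:E); last first.
  rewrite (@integral_product_mul _ _ _ _ R lebE leb phi psi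
   (box_cst ^+ n * expR (- (bsq x.1 y.1 / (8 * s))))%R
   (box_cst * expR (- ((x.2 - y.2 : R) ^+ 2 / (8 * s))))%R)//.
  - congr EFin; rewrite mulrACA -exprSr -expRD; congr (_ * expR _)%R.
    by rewrite /sqdist mulrDl opprD.
  - exact: integral_prod_box.
  - exact: integral_box.
apply: ge0_le_integral => //.
- by move=> z _; rewrite lee_fin mulr_ge0.
- by apply/measurable_EFinP; apply: measurable_funM; exact: measurableT_comp.
- apply/measurable_EFinP; apply: measurable_funM.
    apply: measurable_heat_kernel; last exact: measurable_cst.
    by apply: measurable_sqdist => //; exact: measurable_cst.
  have m1 : measurable_fun setT (\1_(near_ambient s) : X * X -> R).
    by apply: measurable_indic; exact: measurable_near_ambient.
  exact: (measurableT_comp m1).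
- move=> z _; rewrite lee_fin.
  have [->|nz] := eqVneq (phi z.1 * psi z.2)%R 0%R.
    by rewrite mulr_ge0 ?heat_kernel_ge0.
  move: nz; rewrite mulf_eq0 negb_or => /andP[nphi npsi].
  have /andP[yz zy] := box_supp npsi.
  have dz := prod_box_supp s0 nphi.
  rewrite heat_ambient_split ?mulr_gt0// indicE mem_set ?mulr1.
    by apply: ler_pM => //; [exact: prod_box_le|exact: box_le].
  rewrite /near_ambient/= y0 (lt_le_trans y0 yz)/=.
  apply: (@box_side_lt n.+1) => //.
  rewrite /sqdist -natr1 mulrDl mul1r lerD// /last_coord.
  by rewrite ler_pXn2r ?nnegrE ?box_side_ge0 ?subr_ge0// lerBlDl.
Qed.

(** With u = x - y, exp(u^2 / (8 sigma^2)) >= 1 + u^2 / (8 sigma^2), and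
    24 sigma^2 + 3 u^2 - 8 sigma (u + sigma) is a positive quadratic form. *)
Lemma le_expR_cst (x y sigma : R) : (0 < sigma)%R -> (0 < y < sigma)%R ->
  (x * expR (- ((x - y) ^+ 2 / (8 * sigma ^+ 2))) <= 3 * sigma)%R.
Proof.
move=> s0 /andP[y0 ys].
rewrite expRN ler_pdivrMr ?expR_gt0//.
set e := ((x - y) ^+ 2 / (8 * sigma ^+ 2))%R.
apply: (@le_trans _ _ (3 * sigma * (1 + e))%R); last first.
  by rewrite ler_wpM2l ?expR_ge1Dx// mulr_ge0// ltW.
have s2 : (0 < 8 * sigma)%R by lra.
rewrite -(ler_pM2r s2).
have -> : (3 * sigma * (1 + e) * (8 * sigma) = 24 * sigma ^+ 2 + 3 * (x - y) ^+ 2)%R.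
  by rewrite /e; field; lra.
have h : (0 <= 3 * (x - y) ^+ 2 - 8 * (x - y) * sigma + 16 * sigma ^+ 2)%R.
  have -> : (3 * (x - y) ^+ 2 - 8 * (x - y) * sigma + 16 * sigma ^+ 2 =
    3 * ((x - y) - 4 / 3 * sigma) ^+ 2 + 32 / 3 * sigma ^+ 2)%R by field.
  by apply: addr_ge0; apply: mulr_ge0; rewrite ?sqr_ge0.
have ysig : (y * sigma <= sigma ^+ 2)%R by rewrite expr2 ler_pM2r// ltW.
lra.
Qed.

(** The factor 1 - exp(- x_N y_N / s) is at most both 1 and x_N y_N / s.  For
    y_N >= sqrt(s) the first bound suffices.  For y_N < sqrt(s), half of the Gaussian
    absorbs x_N / sqrt(s), which leaves y_N / sqrt(s). *)
Lemma dirichlet0_le (x y : X) (s : R) : (0 < s)%R -> (0 < y.2 :> R)%R ->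
  (dirichlet0 x y s <= 6 * (4 * pi) `^ (- (n.+1%:R / 2)) * s `^ (- (n.+1%:R / 2)) *
     ((y.2 : R) / ((y.2 : R) + Num.sqrt s)) * expR (- (sqd x y / (8 * s))))%R.
Proof.
move=> s0 y0; have sig0 : (0 < Num.sqrt s)%R by rewrite sqrtr_gt0.
have [x0|x0] := ltP 0%R (x.2 : R); last first.
  rewrite /dirichlet0 s0 [(0 < x.2 :> R)%R]ltNge x0/=.
  by rewrite !mulr_ge0 ?powR_ge0 ?expR_ge0// ?invr_ge0 ?addr_ge0// ltW.
rewrite /dirichlet0 s0 x0 y0/= /dirichlet_kernel /heat_kernel.
rewrite powRM ?(ltW s0)//; last by rewrite mulr_ge0 ?pi_ge0.
set d := sqd x y; set A := ((4 * pi) `^ _)%R; set B := (s `^ _)%R.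
(* One half of the Gaussian is kept, the other half absorbs x_N. *)
have -> : (expR (- (d / (4 * s))) = expR (- (d / (8 * s))) * expR (- (d / (8 * s))))%R.
  by rewrite -expRD; congr expR; field; lra.
have -> : (A * B * (expR (- (d / (8 * s))) * expR (- (d / (8 * s)))) *
  (1 - expR (- (last_coord x * last_coord y / s))) =
  A * B * (expR (- (d / (8 * s))) *
  (1 - expR (- (last_coord x * last_coord y / s)))) * expR (- (d / (8 * s))))%R by ring.
rewrite [leRHS](_ : _ = A * B * (6 * ((y.2 : R) / ((y.2 : R) + Num.sqrt s))) *
   expR (- (d / (8 * s))))%R; last by ring.
rewrite ler_wpM2r ?expR_ge0// ler_wpM2l ?mulr_ge0 ?powR_ge0//.
rewrite /last_coord; set a : R := x.2; set b : R := y.2; set sg := Num.sqrt s.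
have q0 : (0 <= 1 - expR (- (a * b / s)))%R.
  rewrite subr_ge0 -[leRHS]expR0 ler_expR oppr_le0.
  by rewrite divr_ge0 ?mulr_ge0 ?(ltW x0) ?(ltW y0) ?(ltW s0).
have e1 : (expR (- (d / (8 * s))) <= 1)%R.
  rewrite -[leRHS]expR0 ler_expR oppr_le0 divr_ge0//; last by lra.
  by rewrite addr_ge0 ?sqr_ge0// sumr_ge0// => i _; exact: sqr_ge0.
have bs : (0 < b + sg)%R by rewrite addr_gt0.
have [sgb|bsg] := lerP sg b.
  apply: (@le_trans _ _ 1%R).
    by rewrite mulr_ile1 ?expR_ge0// gerBl expR_ge0.
  by rewrite mulrA ler_pdivlMr// mul1r; lra.
apply: (@le_trans _ _ (expR (- (d / (8 * s))) * (a * b / s))%R).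
  rewrite ler_wpM2l ?expR_ge0//.
  by have := expR_ge1Dx (- (a * b / s)); lra.
apply: (@le_trans _ _ (expR (- ((a - b) ^+ 2 / (8 * s))) * (a * b / s))%R).
  rewrite ler_wpM2r ?divr_ge0 ?mulr_ge0 ?(ltW x0) ?(ltW y0) ?(ltW s0)// ler_expR lerN2.
  rewrite ler_pM2r ?invr_gt0; last by lra.
  by rewrite /d /sqdist lerDr sumr_ge0// => i _; exact: sqr_ge0.
have sE : s = (sg ^+ 2)%R by rewrite sqr_sqrtr// ltW.
have := @le_expR_cst a b sg sig0; rewrite y0 bsg => /(_ isT) h.
apply: (@le_trans _ _ (3 * sg * (b / s))%R).
  rewrite [leLHS](_ : _ = a * expR (- ((a - b) ^+ 2 / (8 * s))) * (b / s))%R; last by field; lra.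
  by rewrite ler_wpM2r ?divr_ge0 ?(ltW x0) ?(ltW y0) ?(ltW s0)// {1}sE.
rewrite mulrA ler_pdivlMr//.
have -> : (3 * sg * (b / s) * (b + sg) = 3 * (b / sg) * (b + sg))%R by rewrite sE; field; lra.
have b1 : (b / sg < 1)%R by rewrite ltr_pdivrMr// mul1r.
have -> : (3 * (b / sg) * (b + sg) = 3 * (b / sg * b) + 3 * b)%R by field; lra.
have : (b / sg * b <= b)%R by rewrite ler_piMl ?(ltW y0) ?(ltW b1).
lra.
Qed.

Definition ambient_bound_cst : R :=
  (6 * (4 * pi) `^ (- (n.+1%:R / 2)) * (box_cst ^+ n.+1)^-1)%R.

Definition boundary_bound_cst : R :=
  ((4 * pi) `^ (- (n%:R / 2)) * (box_cst ^+ n)^-1)%R.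

Lemma ambient_bound_cst_gt0 : (0 < ambient_bound_cst)%R.
Proof.
apply: mulr_gt0; last by rewrite invr_gt0 exprn_gt0// box_cst_gt0.
by rewrite mulr_gt0// powR_gt0// mulr_gt0// pi_gt0.
Qed.

Lemma boundary_bound_cst_gt0 : (0 < boundary_bound_cst)%R.
Proof.
apply: mulr_gt0; last by rewrite invr_gt0 exprn_gt0// box_cst_gt0.
by rewrite powR_gt0// mulr_gt0// pi_gt0.
Qed.

(** [averaging] for the measure y_N / (y_N + sqrt s) F(y) dy. *)
Lemma ambient_bound (s M : R) (F : X -> \bar R) : (0 < s)%R -> (0 <= M)%R ->
  measurable_fun setT F -> (forall y, 0 <= F y) ->
  (forall z, (0 <= z.2 :> R)%R ->
     \int[lebX]_(y in @halfspace_ball R n.+1 z (Num.sqrt s))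
        ((last_coord y / (last_coord y + Num.sqrt s))%:E * F y) <= M%:E) ->
  forall x, \int[lebX]_y ((dirichlet0 x y s)%:E * F y) <=
    (ambient_bound_cst * s `^ (- (n.+1%:R / 2)) * M)%:E.
Proof.
move=> s0 M0 mF F0 FM x; have sig0 : (0 < Num.sqrt s)%R by rewrite sqrtr_gt0.
pose P (y : X) : bool := (0 < y.2 :> R)%R.
pose k (y : X) : R := if P y then expR (- (sqd x y / (8 * s)))%R else 0%R.
pose om (y : X) : R := if P y then ((y.2 : R) / ((y.2 : R) + Num.sqrt s))%R else 0%R.
have m2 : measurable_fun [set: X] (fun y : X => y.2 : R) by exact: measurable_snd.
have mP : measurable_fun [set: X] P by apply: measurable_fun_ltr => //; exact: measurable_cst.
have mk : measurable_fun setT k.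
  apply: measurable_fun_ifT => //; apply: measurableT_comp => //.
  apply: measurableT_comp => //; apply: measurable_funM => //.
  by apply: measurable_sqdist => //; exact: measurable_cst.
have mom : measurable_fun setT om.
  apply: measurable_fun_ifT => //; apply: measurable_funM => //.
  by apply: measurable_funV; exact: measurable_funD.
have k0 y : (0 <= k y)%R by rewrite /k; case: ifP => // _; exact: expR_ge0.
have om0 y : (0 <= om y)%R.
  by rewrite /om; case: ifPn => // y0; rewrite divr_ge0 ?addr_ge0// ltW.
pose c := (6 * (4 * pi) `^ (- (n.+1%:R / 2)) * s `^ (- (n.+1%:R / 2)))%R.
have c0 : (0 <= c)%R by rewrite !mulr_ge0 ?powR_ge0.
have bx0 : (0 < box_cst ^+ n.+1)%R by rewrite exprn_gt0// box_cst_gt0.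
have key : \int[lebX]_y ((k y)%:E * ((om y)%:E * F y)) <= ((box_cst ^+ n.+1)^-1 * M)%:E.
  apply: (@averaging _ _ _ lebX k (fun z => hk n.+1 (sqd x z) (4 * s)) (near_ambient s)) => //.
  - apply: measurable_heat_kernel; last exact: measurable_cst.
    by apply: measurable_sqdist => //; exact: measurable_cst.
  - by move=> z; exact: heat_kernel_ge0.
  - exact: measurable_near_ambient.
  - by apply: emeasurable_funM => //; exact/measurable_EFinP.
  - by move=> y; rewrite mule_ge0 ?lee_fin.
  - by rewrite invr_ge0 ltW.
  - by rewrite integral_heat_ambient// mulr_gt0.
  - move=> y; rewrite /k; case: ifPn => y0; last first.
      rewrite mule_ge0 ?lee_fin ?invr_ge0 ?(ltW bx0)// integral_ge0// => z _.
      by rewrite lee_fin mulr_ge0 ?heat_kernel_ge0.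
    rewrite -[leLHS]mul1e -[1](_ : ((box_cst ^+ n.+1)^-1 * box_cst ^+ n.+1)%:E = 1); last first.
      by rewrite mulVf ?gt_eqF.
    rewrite EFinM -muleA lee_wpmul2l ?lee_fin ?invr_ge0 ?(ltW bx0)//.
    by rewrite -EFinM; exact: ambient_gaussian_le_average.
  - move=> z; have [z0|z0] := ltP 0%R (z.2 : R); last first.
      rewrite integral0_eq ?lee_fin// => y _.
      by rewrite indicE memNset ?mul0e// /near_ambient/= ltNge z0.
    apply: le_trans (FM z (ltW z0)); rewrite [leRHS]integral_mkcond.
    apply: ge0_le_integral_nonmeas => y _; first by rewrite !mule_ge0 ?lee_fin.
    rewrite patchE indicE; case: (boolP ((z, y) \in near_ambient s)) => [|_]; last first.
      rewrite mul0e; case: ifPn => // /set_mem[_ /= y0].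
      by rewrite mule_ge0// lee_fin divr_ge0// addr_ge0// ltW.
    rewrite inE => /and3P[/= _ y0 zy]; rewrite mul1e /om /P y0.
    rewrite mem_set// /halfspace_ball; split => /=; last exact: ltW.
    by rewrite ltr_sqrt.
apply: (@le_trans _ _ (\int[lebX]_y (c%:E * ((k y)%:E * ((om y)%:E * F y))))).
  apply: ge0_le_integral_nonmeas => y _.
    by rewrite mule_ge0 ?lee_fin ?dirichlet0_ge0.
  rewrite !muleA -!EFinM lee_wpmul2r// lee_fin /k /om; case: ifPn => y0; last first.
    by rewrite !mulr0 /dirichlet0 -/(P y) (negbTE y0) !andbF.
  by apply: le_trans (dirichlet0_le x s0 y0) _; rewrite /c mulrAC.
rewrite ge0_integralZl//; last 2 first.
- apply: emeasurable_funM; first exact/measurable_EFinP.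
  by apply: emeasurable_funM => //; exact/measurable_EFinP.
- by move=> y _; rewrite !mule_ge0 ?lee_fin.
apply: (@le_trans _ _ (c%:E * ((box_cst ^+ n.+1)^-1 * M)%:E)).
  by rewrite lee_wpmul2l ?lee_fin.
by rewrite -EFinM lee_fin /c /ambient_bound_cst le_eqVlt; apply/orP; left; apply/eqP; ring.
Qed.

Lemma boundary_bound (s M : R) (H : E -> \bar R) : (0 < s)%R -> (0 <= M)%R ->
  measurable_fun setT H -> (forall y, 0 <= H y) ->
  (forall z, \int[lebE]_(y in @boundary_ball R n.+1 z (Num.sqrt s)) H y <= M%:E) ->
  forall x, \int[lebE]_y ((hk n (bsq x y) s)%:E * H y) <=
    (boundary_bound_cst * s `^ (- (n%:R / 2)) * M)%:E.
Proof.
move=> s0 M0 mH H0 HM x.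
pose k (y : E) : R := expR (- (bsq x y / (8 * s)))%R.
have mk : measurable_fun setT k.
  apply: measurableT_comp => //.
  apply: measurableT_comp => //; apply: measurable_funM => //.
  by apply: measurable_boundary_sqdist => //; exact: measurable_cst.
have k0 y : (0 <= k y)%R by exact: expR_ge0.
pose c := ((4 * pi) `^ (- (n%:R / 2)) * s `^ (- (n%:R / 2)))%R.
have c0 : (0 <= c)%R by rewrite !mulr_ge0 ?powR_ge0.
have bx0 : (0 < box_cst ^+ n)%R by rewrite exprn_gt0// box_cst_gt0.
have key : \int[lebE]_y ((k y)%:E * H y) <= ((box_cst ^+ n)^-1 * M)%:E.
  apply: (@averaging _ _ _ lebE k (fun z => hk n (bsq x z) (4 * s)) (near_boundary s)) => //.
  - apply: measurable_heat_kernel; last exact: measurable_cst.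
    by apply: measurable_boundary_sqdist => //; exact: measurable_cst.
  - by move=> z; exact: heat_kernel_ge0.
  - exact: measurable_near_boundary.
  - by rewrite invr_ge0 ltW.
  - by rewrite integral_heat_boundary// mulr_gt0.
  - move=> y; rewrite /k.
    rewrite -[leLHS]mul1e -[1](_ : ((box_cst ^+ n)^-1 * box_cst ^+ n)%:E = 1); last first.
      by rewrite mulVf ?gt_eqF.
    rewrite EFinM -muleA lee_wpmul2l ?lee_fin ?invr_ge0 ?(ltW bx0)//.
    by rewrite -EFinM; exact: boundary_gaussian_le_average.
  - move=> z; apply: le_trans (HM z); rewrite [leRHS]integral_mkcond.
    apply: ge0_le_integral_nonmeas => y _; first by rewrite mule_ge0 ?lee_fin.
    rewrite patchE indicE; case: (boolP ((z, y) \in near_boundary s)) => [|_]; last first.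
      by rewrite mul0e; case: ifPn.
    rewrite inE /near_boundary/= => zy; rewrite mul1e mem_set// /boundary_ball/=.
    by rewrite ltr_sqrt.
apply: (@le_trans _ _ (\int[lebE]_y (c%:E * ((k y)%:E * H y)))).
  apply: ge0_le_integral_nonmeas => y _.
    by rewrite mule_ge0 ?lee_fin ?heat_kernel_ge0.
  rewrite !muleA -!EFinM lee_wpmul2r// lee_fin /k /heat_kernel.
  rewrite powRM ?(ltW s0)//; last by rewrite mulr_ge0 ?pi_ge0.
  rewrite ler_wpM2l// ler_expR lerN2 ler_wpM2l//.
    by apply: sumr_ge0 => i _; exact: sqr_ge0.
  by rewrite lef_pV2 ?posrE; lra.
rewrite ge0_integralZl//; last 2 first.
- by apply: emeasurable_funM => //; exact/measurable_EFinP.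
- by move=> y _; rewrite mule_ge0 ?lee_fin.
apply: (@le_trans _ _ (c%:E * ((box_cst ^+ n)^-1 * M)%:E)).
  by rewrite lee_wpmul2l ?lee_fin.
by rewrite -EFinM lee_fin /c /boundary_bound_cst le_eqVlt; apply/orP; left; apply/eqP; ring.
Qed.

End heat_bounds.

(** * Heat evolution of the data *)
Section data.
Context (R : realType) (n : nat).
Notation leb := (@lebesgue_measure R).
Notation hk := (@heat_kernel R).
Notation E := (euclid R n).
Notation X := (ambient R n.+1).
Notation Z := (X * measurableTypeR R)%type.
Notation lebE := (lebesgue_euclid R n).
Notation lebX := (lebesgue_ambient R n.+1).
Notation bsq := (@boundary_sqdist R n.+1).
Notation sqd := (@sqdist R n.+1).
Variables (F : X -> \bar R) (H : E -> \bar R).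
Hypotheses (mF : measurable_fun setT F) (F0 : forall y, 0 <= F y).
Hypotheses (mH : measurable_fun setT H) (H0 : forall y, 0 <= H y).

(** [interior_heat] is G(t) F^b, [lateral_heat] is Gamma_(N-1)(t) H^b, and
    [lateral_potential] is the integral of K(x, (y', 0), t) against H(y')^b. *)
Definition interior_heat (b : R) (z : Z) : \bar R :=
  \int[lebX]_y ((dirichlet0 z.1 y z.2)%:E * F y `^ b).

Definition lateral_heat (b : R) (z : Z) : \bar R :=
  \int[lebE]_y ((hk n (bsq z.1.1 y) z.2)%:E * H y `^ b).

Definition lateral_potential (b : R) (z : Z) : \bar R :=
  \int[lebE]_y ((poisson0 z.1 y z.2)%:E * H y `^ b).

(** The factor x_N / t Gamma_1(x_N, t) of K at the boundary. *)
Definition normal_factor (z : Z) : R :=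
  if ((0 < z.2 :> R) && (0 < z.1.2 :> R))%R
  then ((z.1.2 : R) / z.2 * hk 1 ((z.1.2 : R) ^+ 2) z.2)%R else 0%R.

Let mpow d (T : measurableType d) (g : T -> \bar R) b :
  measurable_fun setT g -> measurable_fun setT (fun y => g y `^ b).
Proof. by move=> mg; exact: (measurableT_comp (measurable_poweR _)). Qed.

Let mz1 : measurable_fun [set: Z * X] (fun w : Z * X => w.1.1).
Proof. exact: (measurableT_comp measurable_fst measurable_fst). Qed.
Let mz2 : measurable_fun [set: Z * X] (fun w : Z * X => w.1.2 : R).
Proof. exact: (measurableT_comp measurable_snd measurable_fst). Qed.
Let mze1 : measurable_fun [set: Z * E] (fun w : Z * E => w.1.1).
Proof. exact: (measurableT_comp measurable_fst measurable_fst). Qed.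
Let mze2 : measurable_fun [set: Z * E] (fun w : Z * E => w.1.2 : R).
Proof. exact: (measurableT_comp measurable_snd measurable_fst). Qed.

Lemma interior_heat_ge0 b z : 0 <= interior_heat b z.
Proof.
by apply: integral_ge0 => y _; rewrite mule_ge0 ?poweR_ge0// lee_fin dirichlet0_ge0.
Qed.

Lemma lateral_heat_ge0 b z : 0 <= lateral_heat b z.
Proof.
by apply: integral_ge0 => y _; rewrite mule_ge0 ?poweR_ge0// lee_fin heat_kernel_ge0.
Qed.

Lemma lateral_potential_ge0 b z : 0 <= lateral_potential b z.
Proof.
by apply: integral_ge0 => y _; rewrite mule_ge0 ?poweR_ge0// lee_fin poisson0_ge0.
Qed.

Lemma normal_factor_ge0 z : (0 <= normal_factor z)%R.
Proof.
rewrite /normal_factor; case: ifPn => // /andP[t0 x0].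
by apply: mulr_ge0; [apply: divr_ge0; exact: ltW|exact: heat_kernel_ge0].
Qed.

Lemma measurable_interior_heat b : measurable_fun setT (interior_heat b).
Proof.
apply: (measurable_integral_snd lebX
  (f := fun w : Z * X => (dirichlet0 w.1.1 w.2 w.1.2)%:E * F w.2 `^ b)).
- apply: emeasurable_funM; last by apply: mpow; exact: measurableT_comp.
  by apply/measurable_EFinP; exact: measurable_dirichlet0.
- by move=> w; rewrite mule_ge0 ?poweR_ge0// lee_fin dirichlet0_ge0.
Qed.

Lemma measurable_lateral_heat b : measurable_fun setT (lateral_heat b).
Proof.
apply: (measurable_integral_snd lebE
  (f := fun w : Z * E => (hk n (bsq w.1.1.1 w.2) w.1.2)%:E * H w.2 `^ b)).
- apply: emeasurable_funM; last by apply: mpow; exact: measurableT_comp.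
  apply/measurable_EFinP; apply: measurable_heat_kernel => //.
  by apply: measurable_boundary_sqdist => //; exact: measurableT_comp.
- by move=> w; rewrite mule_ge0 ?poweR_ge0// lee_fin heat_kernel_ge0.
Qed.

Lemma measurable_lateral_potential b : measurable_fun setT (lateral_potential b).
Proof.
apply: (measurable_integral_snd lebE
  (f := fun w : Z * E => (poisson0 w.1.1 w.2 w.1.2)%:E * H w.2 `^ b)).
- apply: emeasurable_funM; last by apply: mpow; exact: measurableT_comp.
  by apply/measurable_EFinP; exact: measurable_poisson0.
- by move=> w; rewrite mule_ge0 ?poweR_ge0// lee_fin poisson0_ge0.
Qed.

Lemma measurable_normal_factor : measurable_fun setT normal_factor.
Proof.
have m2 : measurable_fun [set: Z] (fun z : Z => z.2 : R) by exact: measurable_snd.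
have m12 : measurable_fun [set: Z] (fun z : Z => z.1.2 : R).
  exact: (measurableT_comp measurable_snd measurable_fst).
apply: measurable_fun_ifT => //.
  by apply: measurable_and; exact: measurable_fun_ltr.
apply: measurable_funM; first by apply: measurable_funM => //; exact: measurable_funV.
by apply: measurable_heat_kernel => //; exact: measurable_funX.
Qed.

Lemma lateral_potentialE b (z : Z) : (0 < z.2 :> R)%R -> (0 < z.1.2 :> R)%R ->
  lateral_potential b z = (normal_factor z)%:E * lateral_heat b z.
Proof.
move=> t0 x0; rewrite /lateral_potential /lateral_heat -ge0_integralZl//.
- apply: eq_integral => y _; rewrite poisson0E// EFinM muleA; congr (_%:E * _ * _).
  by rewrite /normal_factor t0 x0.
- apply: emeasurable_funM; last exact: mpow.
  apply/measurable_EFinP; apply: measurable_heat_kernel => //.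
  by apply: measurable_boundary_sqdist => //; exact: measurable_cst.
- by move=> y _; rewrite mule_ge0 ?poweR_ge0// lee_fin heat_kernel_ge0.
- by rewrite lee_fin normal_factor_ge0.
Qed.

(** With q = x_N / sqrt(t), q exp(- q^2 / 4) <= 1 because 1 + q^2 / 4 >= q. *)
Lemma normal_factor_le (z : Z) : (0 < z.2 :> R)%R -> (normal_factor z <= (z.2 : R)^-1)%R.
Proof.
move=> t0; rewrite /normal_factor t0/=; case: ifPn => [x0|_]; last by rewrite invr_ge0 ltW.
set x : R := z.1.2; set t : R := z.2.
have st0 : (0 < Num.sqrt t)%R by rewrite sqrtr_gt0.
have pi1 : (1 <= 4 * pi :> R)%R by have := @pi_ge2 R; lra.
have le1 : ((4 * pi * t) `^ (- (1%:R / 2)) <= (Num.sqrt t)^-1)%R.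
  rewrite powRN mul1r powR12_sqrt; last by rewrite !mulr_ge0 ?pi_ge0 ?ltW.
  rewrite lef_pV2 ?posrE ?sqrtr_gt0 ?mulr_gt0 ?pi_gt0//.
  apply: ler_wsqrtr.
  by rewrite ler_peMl// ltW.
set q := (x / Num.sqrt t)%R.
have xq : x = (q * Num.sqrt t)%R by rewrite divfK// gt_eqF.
have qe : (q <= expR (x ^+ 2 / (4 * t)))%R.
  apply: le_trans (expR_ge1Dx _).
  have -> : (x ^+ 2 / (4 * t) = q ^+ 2 / 4)%R.
    rewrite /q -[in LHS](@sqr_sqrtr _ t) ?(ltW t0)//; field; lra.
  by have := sqr_ge0 (1 - q / 2); lra.
rewrite /heat_kernel expRN.
apply: (@le_trans _ _ (x / t * ((Num.sqrt t)^-1 / expR (x ^+ 2 / (4 * t))))%R).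
  rewrite ler_wpM2l ?divr_ge0 ?(ltW x0) ?(ltW t0)//.
  by rewrite ler_wpM2r// invr_ge0 expR_ge0.
rewrite -[leRHS]mul1r [leLHS](_ : _ = q / expR (x ^+ 2 / (4 * t)) * t^-1)%R; last first.
  by rewrite /q; ring.
by rewrite ler_wpM2r ?invr_ge0 ?(ltW t0)// ler_pdivrMr ?expR_gt0// mul1r.
Qed.

Lemma dirichlet0_interior_heat b (x : X) (t s : R) : (0 < s < t)%R ->
  \int[lebX]_y ((dirichlet0 x y (t - s))%:E * interior_heat b (y, s)) = interior_heat b (x, t).
Proof.
move=> /andP[s0 st]; have ts0 : (0 < t - s)%R by rewrite subr_gt0.
have mf : measurable_fun setT (fun w : X * X =>
    (dirichlet0 x w.1 (t - s) * dirichlet0 w.1 w.2 s)%:E * F w.2 `^ b).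
  apply: emeasurable_funM; last by apply: mpow; exact: measurableT_comp.
  apply/measurable_EFinP; apply: measurable_funM; apply: measurable_dirichlet0 => //;
    exact: measurable_cst.
have f0 (w : X * X) : 0 <= (dirichlet0 x w.1 (t - s) * dirichlet0 w.1 w.2 s)%:E * F w.2 `^ b.
  by rewrite mule_ge0 ?poweR_ge0// lee_fin mulr_ge0 ?dirichlet0_ge0.
transitivity (\int[lebX]_y \int[lebX]_y0
    ((dirichlet0 x y (t - s) * dirichlet0 y y0 s)%:E * F y0 `^ b)).
  apply: eq_integral => y _; rewrite /interior_heat/= -ge0_integralZl//.
  - by apply: eq_integral => y0 _; rewrite EFinM muleA.
  - apply: emeasurable_funM; last exact: mpow.
    by apply/measurable_EFinP; apply: measurable_dirichlet0 => //; exact: measurable_cst.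
  - by move=> y0 _; rewrite mule_ge0 ?poweR_ge0// lee_fin dirichlet0_ge0.
  - by rewrite lee_fin dirichlet0_ge0.
have /= -> := exchange_integral lebX lebX mf f0.
apply: eq_integral => y _; rewrite /= ge0_integralZr ?poweR_ge0//; last 2 first.
- apply/measurable_EFinP; apply: measurable_funM; apply: measurable_dirichlet0 => //;
    exact: measurable_cst.
- by move=> z _; rewrite lee_fin mulr_ge0 ?dirichlet0_ge0.
by rewrite dirichlet0_semigroup// subrK.
Qed.

Lemma dirichlet0_lateral_potential b (x : X) (t s : R) : (0 < s < t)%R ->
  \int[lebX]_y ((dirichlet0 x y (t - s))%:E * lateral_potential b (y, s)) <=
  lateral_potential b (x, t).
Proof.
move=> /andP[s0 st]; have ts0 : (0 < t - s)%R by rewrite subr_gt0.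
have mf : measurable_fun setT (fun w : X * E =>
    (dirichlet0 x w.1 (t - s) * poisson0 w.1 w.2 s)%:E * H w.2 `^ b).
  apply: emeasurable_funM; last by apply: mpow; exact: measurableT_comp.
  apply/measurable_EFinP; apply: measurable_funM;
   [apply: measurable_dirichlet0|apply: measurable_poisson0] => //; exact: measurable_cst.
have f0 (w : X * E) : 0 <= (dirichlet0 x w.1 (t - s) * poisson0 w.1 w.2 s)%:E * H w.2 `^ b.
  by rewrite mule_ge0 ?poweR_ge0// lee_fin mulr_ge0 ?dirichlet0_ge0 ?poisson0_ge0.
rewrite [leLHS](_ : _ = \int[lebX]_y \int[lebE]_y0
    ((dirichlet0 x y (t - s) * poisson0 y y0 s)%:E * H y0 `^ b)); last first.
  apply: eq_integral => y _; rewrite /lateral_potential/= -ge0_integralZl//.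
  - by apply: eq_integral => y0 _; rewrite EFinM muleA.
  - apply: emeasurable_funM; last exact: mpow.
    by apply/measurable_EFinP; apply: measurable_poisson0 => //; exact: measurable_cst.
  - by move=> y0 _; rewrite mule_ge0 ?poweR_ge0// lee_fin poisson0_ge0.
  - by rewrite lee_fin dirichlet0_ge0.
have /= -> := exchange_integral lebX lebE mf f0.
apply: ge0_le_integral => //.
- by move=> y _; apply: integral_ge0 => z _; exact: (f0 (z, y)).
- exact: (measurable_integral_fst lebX mf f0).
- apply: emeasurable_funM; last exact: mpow.
  by apply/measurable_EFinP; apply: measurable_poisson0 => //; exact: measurable_cst.
move=> y _; rewrite /= ge0_integralZr ?poweR_ge0//; last 2 first.
- apply/measurable_EFinP; apply: measurable_funM;
   [apply: measurable_dirichlet0|apply: measurable_poisson0] => //; exact: measurable_cst.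
- by move=> z _; rewrite lee_fin mulr_ge0 ?dirichlet0_ge0 ?poisson0_ge0.
rewrite lee_wpmul2r ?poweR_ge0//.
by have := dirichlet0_poisson0_le x y ts0 s0; rewrite subrK.
Qed.

End data.

(** * Barriers *)

(** The exponents -1/(p-1) and (p-2)/(p-1) of the sup bounds are those of the scaling
    of the equation; they make all powers of t cancel below. *)
Section estimates.
Context (R : realType) (n : nat).
Notation leb := (@lebesgue_measure R).
Notation hk := (@heat_kernel R).
Notation E := (euclid R n).
Notation X := (ambient R n.+1).
Notation Z := (X * measurableTypeR R)%type.
Notation lebE := (lebesgue_euclid R n).
Notation lebX := (lebesgue_ambient R n.+1).
Variables (F : X -> \bar R) (H : E -> \bar R).
Hypotheses (mF : measurable_fun setT F) (F0 : forall y, 0 <= F y).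
Hypotheses (mH : measurable_fun setT H) (H0 : forall y, 0 <= H y).
Variables (p a eps T : R).
Hypotheses (p1 : (1 < p)%R) (a1 : (1 < a)%R) (ap : (a <= p)%R) (eps0 : (0 < eps)%R).

Definition interior_barrier (z : Z) : \bar R := interior_heat F a z `^ a^-1.
Definition lateral_barrier (z : Z) : \bar R :=
  (normal_factor z)%:E * lateral_heat H a z `^ a^-1.

Hypothesis interior_small : forall z : Z, (0 < z.2 < T)%R ->
  interior_barrier z <= (eps * z.2 `^ (- (p - 1)^-1))%:E.
Hypothesis lateral_small : forall z : Z, (0 < z.2 < T)%R ->
  lateral_heat H a z `^ a^-1 <= (eps * z.2 `^ ((p - 2) / (p - 1)))%:E.
Hypothesis lateral_zero : (2 <= p)%R -> forall y, H y = 0.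

Let a0 : (0 < a)%R. Proof. exact: lt_trans a1. Qed.
Let p0 : (0 < p)%R. Proof. exact: lt_trans p1. Qed.

Lemma interior_barrier_ge0 z : 0 <= interior_barrier z.
Proof. exact: poweR_ge0. Qed.

Lemma lateral_barrier_ge0 z : 0 <= lateral_barrier z.
Proof. by rewrite mule_ge0 ?poweR_ge0// lee_fin normal_factor_ge0. Qed.

Lemma measurable_interior_barrier : measurable_fun setT interior_barrier.
Proof.
by apply: (measurableT_comp (measurable_poweR _)); exact: measurable_interior_heat.
Qed.

Lemma measurable_lateral_barrier : measurable_fun setT lateral_barrier.
Proof.
apply: emeasurable_funM; first by apply/measurable_EFinP; exact: measurable_normal_factor.
by apply: (measurableT_comp (measurable_poweR _)); exact: measurable_lateral_heat.
Qed.

Let mker (x : X) (t : R) :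
  measurable_fun [set: Z] (fun z : Z => dirichlet0 x z.1 (t - z.2)).
Proof.
apply: measurable_dirichlet0; [exact: measurable_cst|exact: measurable_fst|].
by apply: measurable_funB; [exact: measurable_cst|exact: measurable_snd].
Qed.

(** [duhamel_le] with P = G(s) F^a, A = eps^(p-a), B = eps^(a-1) and
    theta = (p-a)/(p-1), so that 1 - theta = (a-1)/(p-1). *)
Lemma duhamel_interior (x : X) (t : R) : (0 < t < T)%R ->
  \int[leb]_(s in `]0%R, t[) \int[lebX]_y
     ((dirichlet0 x y (t - s))%:E * interior_barrier (y, s) `^ p) <=
  (eps `^ (p - 1) * ((p - 1) / (a - 1)))%:E * interior_barrier (x, t).
Proof.
move=> /andP[t0 tT].
have := p1; have := a1; have := ap => ap' a1' p1'.
have p10 : (0 < p - 1)%R by lra.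
have th1 : ((p - a) / (p - 1) < 1)%R by rewrite ltr_pdivrMr//; lra.
have expo : (1 - (p - a) / (p - 1) = (a - 1) / (p - 1))%R by field; lra.
have -> : (eps `^ (p - 1) * ((p - 1) / (a - 1)) =
    eps `^ (p - a) * eps `^ (a - 1) / (1 - (p - a) / (p - 1)))%R.
  rewrite -powRD; last by rewrite (gt_eqF eps0) implybT.
  by rewrite expo invf_div; congr (_ `^ _ * _)%R; ring.
apply: (@duhamel_le _ X R lebX t _ _ _ p (fun z : Z => dirichlet0 x z.1 (t - z.2))
  interior_barrier (interior_heat F a) (interior_heat F a (x, t))) => //.
- exact: powR_ge0.
- exact: powR_ge0.
- by move=> z; exact: dirichlet0_ge0.
- exact: measurable_interior_barrier.
- exact: measurable_interior_heat.
- by move=> z; exact: interior_heat_ge0.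
- exact: interior_heat_ge0.
- exact: interior_barrier_ge0.
- move=> s y /andP[s0 st]; rewrite muleCA lee_wpmul2l ?lee_fin ?dirichlet0_ge0//.
  have sT : (0 < s < T)%R by rewrite s0 (lt_trans st).
  have bnd := interior_small (z := (y, s)) sT.
  apply: le_trans (poweR_le_bound (interior_barrier_ge0 _) bnd _ a0 ap) _.
    by rewrite mulr_gt0// powR_gt0.
  rewrite /interior_barrier poweRK ?interior_heat_ge0//.
  rewrite powRM ?(ltW eps0) ?powR_ge0// -powRrM /=.
  by rewrite (_ : - (p - 1)^-1 * (p - a) = - ((p - a) / (p - 1)))%R//; ring.
- by move=> s st; rewrite /= dirichlet0_interior_heat.
- have tt : (0 < t < T)%R by rewrite t0.
  rewrite -{1}(poweRK a0 (interior_heat_ge0 F a (x, t))) -/(interior_barrier (x, t)).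
  have bnd := interior_small (z := (x, t)) tt.
  apply: le_trans (poweR_le_bound (interior_barrier_ge0 _) bnd _ ltr01 (ltW a1)) _.
    by rewrite mulr_gt0// powR_gt0.
  rewrite poweRe1 ?interior_barrier_ge0// powRM ?(ltW eps0) ?powR_ge0// -powRrM /=.
  by rewrite expo (_ : - (p - 1)^-1 * (a - 1) = - ((a - 1) / (p - 1)))%R//; ring.
Qed.

Lemma lateral_barrier_zero z : (2 <= p)%R -> lateral_barrier z = 0.
Proof.
move=> p2; rewrite /lateral_barrier /lateral_heat integral0_eq.
  by rewrite poweR0r ?mule0// invr_eq0 gt_eqF.
by move=> y _; rewrite lateral_zero// poweR0r ?mule0// gt_eqF.
Qed.

Definition lateral_cst : R := ((p - 1) / ((2 - p) * (a - 1)))%R.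

(** Write v = k g with k = [normal_factor].  Then v^p = k^(p-1) g^(p-a) (k g^a), where
    k <= 1/s and k g^a is the Poisson integral of H^a.  The exponent is
    theta = (p-1) + (2-p)(p-a)/(p-1), and theta < 1 is (2-p)(p-a) < (2-p)(p-1). *)
Lemma duhamel_lateral (x : X) (t : R) : (p < 2)%R -> (0 < t < T)%R -> (0 < x.2 :> R)%R ->
  \int[leb]_(s in `]0%R, t[) \int[lebX]_y
     ((dirichlet0 x y (t - s))%:E * lateral_barrier (y, s) `^ p) <=
  (eps `^ (p - 1) * lateral_cst)%:E * lateral_barrier (x, t).
Proof.
move=> p2 /andP[t0 tT] x0.
have := p1; have := a1; have := ap => ap' a1' p1'.
pose theta := ((p - 1) + (2 - p) * (p - a) / (p - 1))%R.
have expo : (1 - theta = (2 - p) * (a - 1) / (p - 1))%R by rewrite /theta; field; lra.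
have th1 : (theta < 1)%R.
  by rewrite -subr_gt0 expo divr_gt0 ?mulr_gt0//; lra.
have -> : (eps `^ (p - 1) * lateral_cst =
    eps `^ (p - a) * eps `^ (a - 1) / (1 - theta))%R.
  rewrite -powRD; last by rewrite (gt_eqF eps0) implybT.
  by rewrite expo invf_div /lateral_cst; congr (_ `^ _ * _)%R; ring.
apply: (@duhamel_le _ X R lebX t _ _ theta p (fun z : Z => dirichlet0 x z.1 (t - z.2))
  lateral_barrier (lateral_potential H a) (lateral_potential H a (x, t))) => //.
- exact: powR_ge0.
- exact: powR_ge0.
- by move=> z; exact: dirichlet0_ge0.
- exact: measurable_lateral_barrier.
- exact: measurable_lateral_potential.
- by move=> z; exact: lateral_potential_ge0.
- exact: lateral_potential_ge0.
- exact: lateral_barrier_ge0.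
- move=> s y /andP[s0 st].
  have [y0|y0] := ltP 0%R (y.2 : R); last first.
    by rewrite /dirichlet0 [(0 < y.2 :> R)%R]ltNge y0 !andbF !mul0e mule0.
  rewrite muleCA lee_wpmul2l ?lee_fin ?dirichlet0_ge0//.
  have sT : (0 < s < T)%R by rewrite s0 (lt_trans st).
  rewrite /lateral_barrier poweRM ?poweR_ge0 ?lee_fin ?normal_factor_ge0//.
  set k := normal_factor (y, s).
  have k0 : (0 <= k)%R by exact: normal_factor_ge0.
  have ks : k%:E <= (s^-1)%:E by rewrite lee_fin; exact: (@normal_factor_le _ _ (y, s)).
  have si0 : (0 < s^-1)%R by rewrite invr_gt0.
  have k1 := poweR_le_bound (u := k%:E) k0 ks si0 ltr01 (ltW p1).
  set g := lateral_heat H a (y, s) `^ a^-1.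
  have g0 : 0 <= g by exact: poweR_ge0.
  have se0 : (0 < eps * s `^ ((p - 2) / (p - 1)))%R by rewrite mulr_gt0// powR_gt0.
  have g1 := poweR_le_bound g0 (lateral_small (z := (y, s)) sT) se0 a0 ap.
  apply: le_trans (lee_pmul _ _ k1 g1) _; rewrite ?poweR_ge0//.
  rewrite (poweRe1 (x := k%:E))// /g poweRK ?lateral_heat_ge0//.
  rewrite lateral_potentialE// muleACA -EFinM.
  apply: lee_wpmul2r; first by rewrite mule_ge0 ?lateral_heat_ge0.
  rewrite lee_fin powRM ?(ltW eps0) ?powR_ge0// -powRrM mulrCA -(powR_inv1 (ltW s0)).
  rewrite -powRrM -powRD; last by rewrite (gt_eqF s0) implybT.
  by rewrite (_ : -1 * (p - 1) + (p - 2) / (p - 1) * (p - a) = - theta)%R// /theta; field; lra.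
- by move=> s st; rewrite /= dirichlet0_lateral_potential.
- have tt : (0 < t < T)%R by rewrite t0.
  rewrite lateral_potentialE// /lateral_barrier muleCA lee_wpmul2l ?lee_fin ?normal_factor_ge0//.
  set g := lateral_heat H a (x, t) `^ a^-1.
  have g0 : 0 <= g by exact: poweR_ge0.
  have se0 : (0 < eps * t `^ ((p - 2) / (p - 1)))%R by rewrite mulr_gt0// powR_gt0.
  have g1 := poweR_le_bound g0 (lateral_small (z := (x, t)) tt) se0 ltr01 (ltW a1).
  rewrite -[leLHS](poweRK a0 (lateral_heat_ge0 H a (x, t))) -/g.
  apply: le_trans g1 _; rewrite poweRe1// powRM ?(ltW eps0) ?powR_ge0// -powRrM /=.
  by rewrite expo (_ : (p - 2) / (p - 1) * (a - 1) = - ((2 - p) * (a - 1) / (p - 1)))%R//; ring.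
Qed.

(** [lateral_cst] is negative for p > 2; the lateral barrier is zero there. *)
Definition barrier_cst : R :=
  ((p - 1) / (a - 1) + (if (p < 2)%R then lateral_cst else 0))%R.

Definition barrier (z : Z) : \bar R :=
  2%:E * interior_barrier z + 2%:E * lateral_barrier z.

Lemma measurable_barrier : measurable_fun setT barrier.
Proof.
apply: emeasurable_funD; apply: emeasurable_funM => //.
- exact: measurable_interior_barrier.
- exact: measurable_lateral_barrier.
Qed.

Lemma barrier_cst_ge : (0 <= (p - 1) / (a - 1) <= barrier_cst)%R.
Proof.
have p1' := p1; have a1' := a1.
have h : (0 <= (p - 1) / (a - 1))%R by rewrite divr_ge0//; lra.
rewrite h /= /barrier_cst; case: ifPn => p2; last by rewrite addr0.
by rewrite lerDl /lateral_cst divr_ge0 ?mulr_ge0//; lra.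
Qed.

Lemma duhamel_lateral_le (x : X) (t : R) : (0 < t < T)%R -> (0 < x.2 :> R)%R ->
  \int[leb]_(s in `]0%R, t[) \int[lebX]_y
     ((dirichlet0 x y (t - s))%:E * lateral_barrier (y, s) `^ p) <=
  (eps `^ (p - 1) * barrier_cst)%:E * lateral_barrier (x, t).
Proof.
move=> tT x0; have [p2|p2] := ltP p 2%R; last first.
  rewrite lateral_barrier_zero// mule0 integral0_eq// => s _.
  rewrite integral0_eq// => y _.
  by rewrite lateral_barrier_zero// poweR0r ?mule0// gt_eqF.
apply: le_trans (duhamel_lateral p2 tT x0) _.
rewrite lee_wpmul2r ?lateral_barrier_ge0// lee_fin ler_wpM2l ?powR_ge0//.
have p1' := p1; have a1' := a1.
by rewrite /barrier_cst p2 lerDr divr_ge0//; lra.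
Qed.

Lemma duhamel_barrier (x : X) (t : R) :
  (4 `^ p * (eps `^ (p - 1) * barrier_cst) <= 1)%R ->
  (0 < t < T)%R -> (0 < x.2 :> R)%R ->
  \int[leb]_(s in `]0%R, t[) \int[lebX]_y
     ((dirichlet0 x y (t - s))%:E * barrier (y, s) `^ p) <=
  interior_barrier (x, t) + lateral_barrier (x, t).
Proof.
move=> small tT x0.
have mpw (g : Z -> \bar R) : measurable_fun setT g ->
    measurable_fun setT (fun z : Z => (dirichlet0 x z.1 (t - z.2))%:E * g z `^ p).
  move=> mg; apply: emeasurable_funM.
    by apply/measurable_EFinP; exact: mker.
  exact: (measurableT_comp (measurable_poweR _)).
have pw0 (g : Z -> \bar R) z : 0 <= (dirichlet0 x z.1 (t - z.2))%:E * g z `^ p.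
  by rewrite mule_ge0 ?poweR_ge0// lee_fin dirichlet0_ge0.
have mI := mpw _ measurable_interior_barrier.
have mL := mpw _ measurable_lateral_barrier.
have mB := mpw _ measurable_barrier.
have slice (g : Z -> \bar R) s : measurable_fun setT g ->
    measurable_fun setT (fun y => g (y, s)).
  by move=> mg; exact: (measurableT_comp mg (measurable_pair2 s)).
have imI := measurable_integral_fst lebX mI (pw0 interior_barrier).
have imL := measurable_integral_fst lebX mL (pw0 lateral_barrier).
have imB := measurable_integral_fst lebX mB (pw0 barrier).
have iI0 s : 0 <= \int[lebX]_y ((dirichlet0 x y (t - s))%:E * interior_barrier (y, s) `^ p).
  by apply: integral_ge0 => y _; exact: (pw0 interior_barrier (y, s)).
have iL0 s : 0 <= \int[lebX]_y ((dirichlet0 x y (t - s))%:E * lateral_barrier (y, s) `^ p).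
  by apply: integral_ge0 => y _; exact: (pw0 lateral_barrier (y, s)).
have c0 : (0 <= 4 `^ p :> R)%R by exact: powR_ge0.
apply: (@le_trans _ _ (\int[leb]_(s in `]0%R, t[) ((4 `^ p)%:E *
   (\int[lebX]_y ((dirichlet0 x y (t - s))%:E * interior_barrier (y, s) `^ p) +
    \int[lebX]_y ((dirichlet0 x y (t - s))%:E * lateral_barrier (y, s) `^ p))))).
  apply: ge0_le_integral => //.
  - by move=> s _; apply: integral_ge0 => y _; exact: (pw0 barrier (y, s)).
  - exact: measurable_funTS.
  - apply: measurable_funTS; apply: emeasurable_funM => //.
    exact: emeasurable_funD.
  move=> s _; rewrite -ge0_integralD//; last 4 first.
  - by move=> y _; exact: (pw0 interior_barrier (y, s)).
  - exact: (slice _ s mI).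
  - by move=> y _; exact: (pw0 lateral_barrier (y, s)).
  - exact: (slice _ s mL).
  rewrite -ge0_integralZl//; last 2 first.
  - by apply: emeasurable_funD; [exact: (slice _ s mI)|exact: (slice _ s mL)].
  - move=> y _; rewrite adde_ge0//; first exact: (pw0 interior_barrier (y, s)).
    exact: (pw0 lateral_barrier (y, s)).
  apply: ge0_le_integral_nonmeas => y _; first exact: (pw0 barrier (y, s)).
  rewrite -ge0_muleDr ?poweR_ge0// muleCA lee_wpmul2l ?lee_fin ?dirichlet0_ge0//.
  by apply: poweR_sum_le => //; [exact: interior_barrier_ge0|exact: lateral_barrier_ge0].
rewrite ge0_integralZl//; last 2 first.
- by apply: measurable_funTS; exact: emeasurable_funD.
- by move=> s _; rewrite adde_ge0.
rewrite ge0_integralD//; last 2 first.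
- exact: measurable_funTS.
- exact: measurable_funTS.
have bI : \int[leb]_(s in `]0%R, t[) \int[lebX]_y
     ((dirichlet0 x y (t - s))%:E * interior_barrier (y, s) `^ p) <=
  (eps `^ (p - 1) * barrier_cst)%:E * interior_barrier (x, t).
  apply: le_trans (duhamel_interior x tT) _.
  rewrite lee_wpmul2r ?interior_barrier_ge0// lee_fin ler_wpM2l ?powR_ge0//.
  by have /andP[] := barrier_cst_ge.
apply: (@le_trans _ _ ((4 `^ p)%:E * ((eps `^ (p - 1) * barrier_cst)%:E *
   (interior_barrier (x, t) + lateral_barrier (x, t))))).
  rewrite lee_wpmul2l ?lee_fin// ge0_muleDr ?interior_barrier_ge0 ?lateral_barrier_ge0//.
  by rewrite leeD// duhamel_lateral_le.
rewrite muleA -EFinM -[leRHS]mul1e lee_wpmul2r ?lee_fin//.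
by rewrite adde_ge0 ?interior_barrier_ge0 ?lateral_barrier_ge0.
Qed.

(** Jensen's inequality for G in the interior, and for Gamma_(N-1) after the factor
    depending on x_N has been taken out of K on the boundary. *)
Lemma free_evolution_le (x : X) (t : R) : (0 < t)%R -> (0 < x.2 :> R)%R ->
  \int[lebX]_y ((dirichlet0 x y t)%:E * F y) + \int[lebE]_y ((poisson0 x y t)%:E * H y) <=
  interior_barrier (x, t) + lateral_barrier (x, t).
Proof.
move=> t0 x0; apply: leeD.
- apply: jensen => //.
  + by apply: measurable_dirichlet0 => //; exact: measurable_cst.
  + by move=> y; exact: dirichlet0_ge0.
  + exact: integral_dirichlet0_le1.
  + exact: ltW.
- rewrite [leLHS](_ : _ = lateral_potential H 1 (x, t)); last first.
    by apply: eq_integral => y _; rewrite poweRe1.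
  rewrite lateral_potentialE// /lateral_barrier lee_wpmul2l ?lee_fin ?normal_factor_ge0//.
  rewrite /lateral_heat; under eq_integral do rewrite poweRe1//.
  apply: jensen => //.
  + apply: measurable_heat_kernel => //.
    by apply: measurable_boundary_sqdist => //; exact: measurable_cst.
  + by move=> y; exact: heat_kernel_ge0.
  + by rewrite integral_heat_boundary.
  + exact: ltW.
Qed.

End estimates.

(** * From the hypotheses on balls to sup bounds *)
Section small_data.
Context (R : realType) (n : nat).
Notation leb := (@lebesgue_measure R).
Notation hk := (@heat_kernel R).
Notation E := (euclid R n).
Notation X := (ambient R n.+1).
Notation Z := (X * measurableTypeR R)%type.
Notation lebE := (lebesgue_euclid R n).
Notation lebX := (lebesgue_ambient R n.+1).
Variables (F : X -> \bar R) (H : E -> \bar R).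
Hypotheses (mF : measurable_fun setT F) (F0 : forall y, 0 <= F y).
Hypotheses (mH : measurable_fun setT H) (H0 : forall y, 0 <= H y).

(** Taking sigma = sqrt(s), the powers of s add up to -N/2 + N/2 - alpha/(p-1). *)
Lemma interior_heat_small (alpha p gamma eps s : R) :
  (1 < p)%R -> (0 < s)%R -> (0 < alpha)%R -> (0 <= gamma)%R -> (0 <= eps)%R ->
  (ambient_bound_cst R n * gamma <= eps `^ alpha)%R ->
  (forall z, (0 <= z.2 :> R)%R ->
     \int[lebX]_(y in @halfspace_ball R n.+1 z (Num.sqrt s))
        ((last_coord y / (last_coord y + Num.sqrt s))%:E * F y `^ alpha)
     <= (gamma * Num.sqrt s `^ (n.+1%:R - 2 * alpha / (p - 1)))%:E) ->
  forall x, interior_heat F alpha (x, s) `^ alpha^-1 <= (eps * s `^ (- (p - 1)^-1))%:E.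
Proof.
move=> p1 s0 al0 g0 e0 small hyp x.
have mFa : measurable_fun setT (fun y => F y `^ alpha).
  exact: (measurableT_comp (measurable_poweR _)).
have M0 : (0 <= gamma * Num.sqrt s `^ (n.+1%:R - 2 * alpha / (p - 1)))%R.
  by rewrite mulr_ge0 ?powR_ge0.
have := ambient_bound s0 M0 mFa (fun y => poweR_ge0 _ _) hyp x.
rewrite -/(interior_heat F alpha (x, s)) => le1.
have ->: (eps * s `^ (- (p - 1)^-1))%:E =
    ((eps `^ alpha * s `^ (- (p - 1)^-1 * alpha))%:E) `^ alpha^-1.
  rewrite poweR_EFin powRM ?powR_ge0// -!powRrM -mulrA divff ?gt_eqF// mulr1.
  by rewrite powRr1.
apply: le_poweR; rewrite ?interior_heat_ge0 ?invr_ge0 ?(ltW al0)//.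
apply: le_trans le1 _; rewrite lee_fin powR_sqrt ?(ltW s0)//.
rewrite [leLHS](_ : _ = (ambient_bound_cst R n * gamma) *
  (s `^ (- (n.+1%:R / 2)) * s `^ ((n.+1%:R - 2 * alpha / (p - 1)) / 2)))%R; last by ring.
rewrite -powRD; last by rewrite (gt_eqF s0) implybT.
rewrite (_ : (- (n.+1%:R / 2) + (n.+1%:R - 2 * alpha / (p - 1)) / 2 =
  - (p - 1)^-1 * alpha)%R); last by field; lra.
by rewrite ler_wpM2r ?powR_ge0.
Qed.

Lemma lateral_heat_small (alpha p gamma eps s : R) :
  (1 < p)%R -> (0 < s)%R -> (0 < alpha)%R -> (0 <= gamma)%R -> (0 <= eps)%R ->
  (boundary_bound_cst R n * gamma <= eps `^ alpha)%R ->
  (forall z, \int[lebE]_(y in @boundary_ball R n.+1 z (Num.sqrt s)) H y `^ alpha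
     <= (gamma * Num.sqrt s `^ (n.+1%:R - 1 + 2 * alpha * ((p - 2) / (p - 1))))%:E) ->
  forall x : X, lateral_heat H alpha (x, s) `^ alpha^-1 <= (eps * s `^ ((p - 2) / (p - 1)))%:E.
Proof.
move=> p1 s0 al0 g0 e0 small hyp x.
have mHa : measurable_fun setT (fun y => H y `^ alpha).
  exact: (measurableT_comp (measurable_poweR _)).
have M0 : (0 <= gamma * Num.sqrt s `^ (n.+1%:R - 1 + 2 * alpha * ((p - 2) / (p - 1))))%R.
  by rewrite mulr_ge0 ?powR_ge0.
have := boundary_bound s0 M0 mHa (fun y => poweR_ge0 _ _) hyp x.1.
rewrite -/(lateral_heat H alpha (x, s)) => le1.
have ->: (eps * s `^ ((p - 2) / (p - 1)))%:E =
    ((eps `^ alpha * s `^ ((p - 2) / (p - 1) * alpha))%:E) `^ alpha^-1.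
  rewrite poweR_EFin powRM ?powR_ge0// -!powRrM -mulrA divff ?gt_eqF// mulr1.
  by rewrite powRr1.
apply: le_poweR; rewrite ?lateral_heat_ge0 ?invr_ge0 ?(ltW al0)//.
apply: le_trans le1 _; rewrite lee_fin powR_sqrt ?(ltW s0)//.
rewrite [leLHS](_ : _ = (boundary_bound_cst R n * gamma) *
  (s `^ (- (n%:R / 2)) * s `^ ((n.+1%:R - 1 + 2 * alpha * ((p - 2) / (p - 1))) / 2)))%R;
  last by ring.
rewrite -powRD; last by rewrite (gt_eqF s0) implybT.
rewrite (_ : (- (n%:R / 2) + (n.+1%:R - 1 + 2 * alpha * ((p - 2) / (p - 1))) / 2 =
  (p - 2) / (p - 1) * alpha)%R); last by rewrite -natr1; field; lra.
by rewrite ler_wpM2r ?powR_ge0.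
Qed.

Lemma interior_barrier_mono (a b : R) (z : Z) : (0 < a)%R -> (a <= b)%R ->
  interior_barrier F a z <= interior_heat F b z `^ b^-1.
Proof.
move=> a0 ab; apply: jensen_power => //.
- by apply: measurable_dirichlet0 => //; exact: measurable_cst.
- by move=> y; exact: dirichlet0_ge0.
- exact: integral_dirichlet0_le1.
Qed.

Lemma lateral_heat_mono (a b : R) (z : Z) : (0 < z.2 :> R)%R -> (0 < a)%R -> (a <= b)%R ->
  lateral_heat H a z `^ a^-1 <= lateral_heat H b z `^ b^-1.
Proof.
move=> t0 a0 ab; apply: jensen_power => //.
- apply: measurable_heat_kernel => //.
  by apply: measurable_boundary_sqdist => //; exact: measurable_cst.
- by move=> y; exact: heat_kernel_ge0.
- by rewrite integral_heat_boundary.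
Qed.

End small_data.

(** * Existence below a supersolution *)
Section existence.
Context (R : realType) (n : nat).
Notation leb := (@lebesgue_measure R).
Notation E := (euclid R n).
Notation X := (ambient R n.+1).
Notation Z := (X * measurableTypeR R)%type.
Notation lebE := (lebesgue_euclid R n).
Notation lebX := (lebesgue_ambient R n.+1).
Variables (p T : R) (p0 : (0 < p)%R) (u0 U : Z -> \bar R).
Hypotheses (mu0 : measurable_fun setT u0) (u00 : forall z, 0 <= u0 z).
Hypotheses (mU : measurable_fun setT U).
Hypothesis supersol : forall (x : X) (t : R), (0 < x.2 :> R)%R -> (0 < t < T)%R ->
  u0 (x, t) + \int[leb]_(s in `]0%R, t[) \int[lebX]_y
     ((dirichlet0 x y (t - s))%:E * U (y, s) `^ p) <= U (x, t).

(** The Duhamel operator as one kernel on space-time.  The cut at T makes it ignore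
    what happens outside the cylinder, where no bound is available. *)
Definition causal_kernel (zw : Z * Z) : R :=
  if ((0 < zw.2.2 :> R) && (zw.2.2 < zw.1.2 :> R) && (zw.2.2 < T :> R))%R
  then dirichlet0 zw.1.1 zw.2.1 ((zw.1.2 : R) - zw.2.2) else 0%R.

Lemma measurable_causal_kernel : measurable_fun setT causal_kernel.
Proof.
have m1 : measurable_fun [set: Z * Z] (fun w : Z * Z => w.1.2 : R).
  exact: (measurableT_comp measurable_snd measurable_fst).
have m2 : measurable_fun [set: Z * Z] (fun w : Z * Z => w.2.2 : R).
  exact: (measurableT_comp measurable_snd measurable_snd).
apply: measurable_fun_ifT => //.
  apply: measurable_and; first apply: measurable_and; exact: measurable_fun_ltr.
apply: measurable_dirichlet0.
- exact: (measurableT_comp measurable_fst measurable_fst).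
- exact: (measurableT_comp measurable_fst measurable_snd).
- exact: measurable_funB.
Qed.

Lemma causal_kernel_ge0 z : (0 <= causal_kernel z)%R.
Proof. by rewrite /causal_kernel; case: ifP => // _; exact: dirichlet0_ge0. Qed.

Lemma integral_causal_kernel (u : Z -> \bar R) (x : X) (t : R) :
  measurable_fun setT u -> (0 < t < T)%R ->
  \int[lebesgue_cylinder R n.+1]_w ((causal_kernel ((x, t), w))%:E * u w `^ p) =
  \int[leb]_(s in `]0%R, t[) \int[lebX]_y ((dirichlet0 x y (t - s))%:E * u (y, s) `^ p).
Proof.
move=> mu /andP[t0 tT].
rewrite (integral_product2 lebX leb); last 2 first.
- apply: emeasurable_funM; last exact: (measurableT_comp (measurable_poweR _)).
  apply/measurable_EFinP.
  exact: (measurableT_comp measurable_causal_kernel (measurable_pair1 (x, t))).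
- by move=> z; rewrite mule_ge0 ?poweR_ge0// lee_fin causal_kernel_ge0.
rewrite [RHS]integral_mkcond; apply: eq_integral => s _; rewrite patchE.
case: ifPn => [|st].
  rewrite inE /= in_itv/= => /andP[s0 st]; apply: eq_integral => y _.
  by rewrite /causal_kernel /= s0 st (lt_trans st).
rewrite integral0_eq// => y _; rewrite /causal_kernel /=.
case: ifPn => [/andP[/andP[s0 sst] _]|]; last by rewrite mul0e.
by move: st; rewrite notin_setE /= in_itv/= s0 sst.
Qed.

Lemma existence_below : exists u : Z -> \bar R,
  [/\ measurable_fun setT u, forall z, 0 <= u z,
      forall (x : X) (t : R), (0 < t < T)%R -> u (x, t) = u0 (x, t) +
        \int[leb]_(s in `]0%R, t[) \int[lebX]_y ((dirichlet0 x y (t - s))%:E * u (y, s) `^ p) &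
      forall (x : X) (t : R), (0 < x.2 :> R)%R -> (0 < t < T)%R -> u (x, t) <= U (x, t)].
Proof.
have [||u [mu u0' ueq uU]] := @monotone_iteration _ Z R (lebesgue_cylinder R n.+1)
  causal_kernel p (@cylinder R n.+1 T) u0 U measurable_causal_kernel causal_kernel_ge0 p0
  _ mu0 u00 mU _.
- move=> z w nDw; rewrite /causal_kernel; case: ifPn => // /andP[/andP[s0 _] sT].
  rewrite /dirichlet0; case: ifPn => // /and3P[_ _ w0]; exfalso; apply: nDw; split => //.
  by rewrite s0.
- move=> [x t] [/= x0 tT]; rewrite integral_causal_kernel//; exact: supersol.
exists u; split => //.
- by move=> x t tT; rewrite ueq integral_causal_kernel.
- by move=> x t x0 tT; apply: uU.
Qed.

End existence.

(** * The initial measure *)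
Section initial_measure.
Context (R : realType) (n : nat).
Notation leb := (@lebesgue_measure R).
Notation hk := (@heat_kernel R).
Notation E := (euclid R n).
Notation X := (ambient R n.+1).
Notation lebE := (lebesgue_euclid R n).
Notation lebX := (lebesgue_ambient R n.+1).
Notation sqd := (@sqdist R n.+1).
Variables (F : X -> \bar R) (H : E -> \bar R).
Hypotheses (mF : measurable_fun setT F) (F0 : forall y, 0 <= F y).
Hypotheses (mH : measurable_fun setT H) (H0 : forall y, 0 <= H y).

(** The coordinate x_N, cut to 0 outside the half-space. *)
Definition height (y : X) : R := if (0 < y.2 :> R)%R then y.2 else 0%R.

Lemma height_ge0 y : (0 <= height y)%R.
Proof. by rewrite /height; case: ifP => // /ltW. Qed.

Lemma measurable_height : measurable_fun setT height.
Proof.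
have m2 : measurable_fun [set: X] (fun y : X => y.2 : R) by exact: measurable_snd.
by apply: measurable_fun_ifT => //; apply: measurable_fun_ltr => //; exact: measurable_cst.
Qed.

Let mwF : measurable_fun setT (fun y => (height y)%:E * F y).
Proof. by apply: emeasurable_funM => //; apply/measurable_EFinP; exact: measurable_height. Qed.

Let wF0 y : 0 <= (height y)%:E * F y.
Proof. by rewrite mule_ge0// lee_fin height_ge0. Qed.

Definition boundary_embed (y' : E) : X := (y', 0%R).

Let mbe : measurable_fun setT boundary_embed.
Proof. by apply: measurable_fun_pair => //; exact: measurable_cst. Qed.

Definition lateral_measure : {measure set X -> \bar R} :=
  measure_function_pushforward__canonical__measure_function_Measure
    (density_measure lebE mH H0) mbe.

Definition initial_measure : {measure set X -> \bar R} :=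
  measure_add (density_measure lebX mwF wF0) lateral_measure.

Lemma initial_measureE A :
  initial_measure A = \int[lebX]_(y in A) ((height y)%:E * F y) +
    \int[lebE]_(y' in [set x' | A (x', 0%R)]) H y'.
Proof. exact: measure_addE. Qed.

(** The weight y_N of the measure cancels the factor 1 / y_N of K in the interior. *)
Lemma integral_initial_measure (x : X) (t : R) : (0 < t)%R -> (0 < x.2 :> R)%R ->
  \int[initial_measure]_(y in @halfspace_closure R n.+1) (weighted_kernel x y t)%:E =
  \int[lebX]_y ((dirichlet0 x y t)%:E * F y) + \int[lebE]_y ((poisson0 x y t)%:E * H y).
Proof.
move=> t0 x0.
have m2 : measurable_fun [set: X] (fun y : X => y.2 : R) by exact: measurable_snd.
have mhc : measurable (@halfspace_closure R n.+1).
  by apply: measurable_set_bool; apply: measurable_fun_ler => //; exact: measurable_cst.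
pose K (y : X) : R :=
  if (0 < y.2 :> R)%R then ((y.2 : R)^-1 * dirichlet0 x y t)%R else poisson0 x y.1 t.
have mK : measurable_fun setT K.
  apply: measurable_fun_ifT.
  - by apply: measurable_fun_ltr => //; exact: measurable_cst.
  - apply: measurable_funM; first exact: measurable_funV.
    by apply: measurable_dirichlet0 => //; exact: measurable_cst.
  - by apply: measurable_poisson0 => //; exact: measurable_cst.
have K0 y : (0 <= K y)%R.
  rewrite /K; case: ifPn => [y0|_]; last exact: poisson0_ge0.
  by rewrite mulr_ge0 ?dirichlet0_ge0// invr_ge0 ltW.
transitivity (\int[initial_measure]_(y in @halfspace_closure R n.+1) (K y)%:E).
  apply: eq_integral => y; rewrite inE /halfspace_closure/= /last_coord => y0.
  congr EFin; rewrite /K; case: ifPn => [y0'|].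
    by rewrite /dirichlet0 t0 x0 y0' /weighted_kernel /last_coord y0'.
  rewrite -leNgt => y0'; have y00 : y.2 = 0%R :> R by apply/eqP; rewrite eq_le y0 y0'.
  by rewrite /poisson0 t0 x0 /=; congr weighted_kernel; rewrite -y00; case: (y).
have mKe : measurable_fun setT (EFin \o K) by exact/measurable_EFinP.
rewrite /initial_measure ge0_integral_measure_add//; last 2 first.
- by move=> y _; rewrite lee_fin.
- exact: measurable_funTS.
congr (_ + _).
- rewrite integral_density// integral_mkcond; apply: eq_integral => y _; rewrite patchE.
  rewrite /height /K; case: (ltP 0%R (y.2 : R)) => y0.
    rewrite mem_set; last exact: ltW.
    by rewrite muleA -EFinM mulrAC mulVf ?mul1r// gt_eqF.
  rewrite mul0e mule0 /dirichlet0 [(0 < y.2 :> R)%R]ltNge y0 !andbF mul0e.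
  by case: ifP.
- rewrite /lateral_measure ge0_integral_pushforward//; last 2 first.
  + exact: measurable_funTS.
  + by move=> y _; rewrite lee_fin.
  rewrite (_ : boundary_embed @^-1` _ = setT); last first.
    by apply/seteqP; split => // y _; rewrite /boundary_embed /halfspace_closure/= /last_coord/=.
  rewrite (eq_integral (fun y => (poisson0 x y t)%:E)).
    rewrite integral_density//; last by move=> y; exact: poisson0_ge0.
    by apply: measurable_poisson0 => //; exact: measurable_cst.
  by move=> y _; rewrite /= /K /boundary_embed /= ltxx.
Qed.

Lemma initial_measure_is (f : X -> \bar R) (h : E -> \bar R) :
  (forall x, @halfspace R n.+1 x -> 0 <= f x) -> (forall x, 0 <= h x) ->
  {ae lebX, forall x, @halfspace R n.+1 x -> f x = F x} ->
  {ae lebE, forall x, h x = H x} ->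
  @is_initial_measure R n.+1 f h initial_measure.
Proof.
move=> f0 h0 fF hH A mA; rewrite initial_measureE.
have m2 : measurable_fun [set: X] (fun y : X => y.2 : R) by exact: measurable_snd.
have mhs : measurable (@halfspace R n.+1).
  by apply: measurable_set_bool; apply: measurable_fun_ltr => //; exact: measurable_cst.
have mA0 : measurable [set x' : E | A (x', 0%R)].
  by rewrite -[X in measurable X]setTI; exact: (mbe measurableT mA).
congr (_ + _); apply/esym.
- rewrite (@ge0_ae_eq_integral_nonmeas _ _ _ _ _ _ (fun y => (height y)%:E * F y)).
  + rewrite integral_mkcondr; apply: eq_integral => y _; rewrite patchE; case: ifPn => //.
    rewrite notin_setE /halfspace/= /last_coord => /negP; rewrite /height => /negbTE ->.
    by rewrite mul0e.
  + exact: measurableI.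
  + exact: measurable_funTS.
  + by move=> y [_ y0]; rewrite mule_ge0 ?f0// lee_fin ltW.
  + by move=> y _; exact: wF0.
  + by apply: filterS fF => y fFy [_ y0]; rewrite fFy// /height ifT.
- apply: ge0_ae_eq_integral_nonmeas => //.
  + exact: measurable_funTS.
  + by apply: filterS hH => y hHy _.
Qed.

Lemma compact_coords_bounded (A : set X) : compact (@ambient_rV R n.+1 @` A) ->
  exists M : R, [/\ (0 < M)%R, forall y, A y -> (`|y.2 : R| <= M)%R &
    forall y i, A y -> (`|tnth y.1 i : R| <= M)%R].
Proof.
move=> /compact_bounded[M0 [_ M0P]]; pose M := (Num.max M0 0 + 1)%R.
have M0M : (M0 < M)%R by rewrite /M ltr_pwDr// le_max lexx.
have Mgt0 : (0 < M)%R by rewrite /M ltr_pwDr// le_max lexx orbT.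
have AM y : A y -> (`|@ambient_rV R n.+1 y| <= M)%R.
  by move=> Ay; apply: (M0P M M0M); exists y.
exists M; split => //.
- by move=> y /AM; rewrite prod_normE/= ge_max => /andP[].
- move=> y i /AM; rewrite prod_normE/= ge_max => /andP[+ _].
  rewrite [`|_ : 'rV_n|%R]mx_normrE => /(le_trans _); apply.
  have := le_bigmax (0 : R)%R (fun ij : 'I_1 * 'I_n =>
    `|(\row_(k < n) (tnth y.1 k : R))%R ij.1 ij.2|%R) (ord0, i).
  by rewrite /= mxE.
Qed.

End initial_measure.

Section radon.
Context (R : realType) (n : nat).
Notation leb := (@lebesgue_measure R).
Notation hk := (@heat_kernel R).
Notation E := (euclid R n).
Notation X := (ambient R n.+1).
Notation lebE := (lebesgue_euclid R n).
Notation lebX := (lebesgue_ambient R n.+1).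
Notation sqd := (@sqdist R n.+1).
Variables (F : X -> \bar R) (H : E -> \bar R).
Hypotheses (mF : measurable_fun setT F) (F0 : forall y, 0 <= F y).
Hypotheses (mH : measurable_fun setT H) (H0 : forall y, 0 <= H y).

Definition base_point : X := ([tuple (0%R : R) | i < n], 1%R).

(** On bounded sets the Gaussian is bounded below, and
    1 - exp(-q) >= q exp(-q) keeps the factor y_N. *)
Lemma kernel_lower_bound (M t : R) : (0 < M)%R -> (0 < t)%R ->
  exists2 C : R, (0 < C)%R & forall y : X, (`|y.2 : R| <= M)%R ->
    (forall i, `|tnth y.1 i : R| <= M)%R ->
    (height y <= C * dirichlet0 base_point y t)%R /\ (1 <= C * poisson0 base_point y.1 t)%R.
Proof.
move=> M0 t0.
pose B := (\sum_(i < n) M ^+ 2 + (1 + M) ^+ 2)%R.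
pose c := hk n.+1 B t.
have c0 : (0 < c)%R.
  by rewrite mulr_gt0 ?expR_gt0// powR_gt0// !mulr_gt0 ?pi_gt0.
have hk_ge (r : R) : (r <= B)%R -> (c <= hk n.+1 r t)%R.
  move=> rB; rewrite /c /heat_kernel ler_wpM2l ?powR_ge0// ler_expR lerN2.
  by rewrite ler_wpM2r// invr_ge0 mulr_ge0// ltW.
have coord (y : E) : (forall i, `|tnth y i : R| <= M)%R ->
    (@boundary_sqdist R n.+1 base_point.1 y <= \sum_(i < n) M ^+ 2)%R.
  move=> yM; apply: ler_sum => i _.
  rewrite /= tnth_mktuple sub0r sqrrN -real_normK ?num_real//.
  by rewrite ler_pXn2r ?nnegrE// ?yM// ltW.
have C1 : (0 < t * expR (M / t) / c)%R by rewrite divr_gt0// mulr_gt0// expR_gt0.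
have C2 : (0 < t / c)%R by rewrite divr_gt0.
exists (t * expR (M / t) / c + t / c)%R; first exact: addr_gt0.
move=> y y2M y1M; split.
- rewrite /height; case: ifPn => y0; last first.
    by rewrite mulr_ge0 ?dirichlet0_ge0// addr_ge0 ?(ltW C1) ?(ltW C2).
  have yM : (y.2 <= M :> R)%R by rewrite (le_trans _ y2M)// ler_norm.
  apply: (@le_trans _ _ (t * expR (M / t) / c * dirichlet0 base_point y t)%R); last first.
    by rewrite ler_wpM2r ?dirichlet0_ge0// lerDl (ltW C2).
  rewrite /dirichlet0 t0 ltr01 y0 /= /dirichlet_kernel /last_coord/= mul1r.
  set b : R := y.2.
  have q1 : (b / t * expR (- (M / t)) <= 1 - expR (- (b / t)))%R.
    have e1 := expR_ge1Dx (b / t)%R.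
    apply: (@le_trans _ _ (b / t * expR (- (b / t)))%R).
      rewrite ler_wpM2l ?divr_ge0 ?(ltW t0) ?(ltW y0)// ler_expR lerN2.
      by rewrite ler_wpM2r// invr_ge0 ltW.
    have : ((1 + b / t) * expR (- (b / t)) <= 1)%R.
      by rewrite expRN ler_pdivrMr ?expR_gt0// mul1r.
    by rewrite mulrDl mul1r; lra.
  have sB : (sqd base_point y <= B)%R.
    rewrite /sqdist lerD ?coord// /last_coord/= -/b.
    move: y2M; rewrite -/b ler_norml => /andP[b1 b2].
    by rewrite -[leRHS](_ : (- 1 - M) ^+ 2 = _)%R; [nra|ring].
  apply: (@le_trans _ _ (t * expR (M / t) / c * (c * (b / t * expR (- (M / t)))))%R).
    rewrite [leRHS](_ : _ = b * (expR (M / t) * expR (- (M / t))))%R.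
      by rewrite -expRD subrr expR0 mulr1.
    by field; lra.
  apply: ler_wpM2l; first exact: ltW.
  apply: ler_pM => //; [exact: ltW| |exact: hk_ge].
  by rewrite mulr_ge0 ?expR_ge0// divr_ge0// ltW.
- apply: (@le_trans _ _ (t / c * poisson0 base_point y.1 t)%R); last first.
    by rewrite ler_wpM2r ?poisson0_ge0// lerDr (ltW C1).
  rewrite /poisson0 t0 ltr01/= /weighted_kernel /last_coord/= ltxx.
  have sB : (sqd base_point (y.1, 0%R : R) <= B)%R.
    rewrite /sqdist lerD ?coord// /last_coord/= subr0 expr1n.
    by rewrite -[leLHS](expr1n _ 2) ler_pXn2r ?nnegrE//; lra.
  have h := hk_ge _ sB.
  apply: (@le_trans _ _ (t / c * (1 / t * c))%R).
    by rewrite le_eqVlt; apply/orP; left; apply/eqP; field; lra.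
  apply: ler_wpM2l; first exact: ltW.
  by rewrite ler_wpM2l// divr_ge0// ltW.
Qed.

(** One finite value of the free evolution controls the measure of all compact
    sets. *)
Lemma initial_measure_radon (t : R) : (0 < t)%R ->
  \int[lebX]_y ((dirichlet0 base_point y t)%:E * F y) +
    \int[lebE]_y ((poisson0 base_point y t)%:E * H y) < +oo ->
  @radon_halfspace R n.+1 (initial_measure mF F0 mH H0).
Proof.
move=> t0 fin; split.
  rewrite initial_measureE !integral0_eq ?adde0//.
  - by move=> x'; rewrite /halfspace_closure/= /last_coord/= lexx.
  - move=> y; rewrite /halfspace_closure/= /last_coord => /negP; rewrite -ltNge => y0.
    by rewrite /height ltNge (ltW y0) mul0e.
move=> A mA /compact_coords_bounded[M [M0 A2 A1]].
have [C C0 CP] := kernel_lower_bound M0 t0.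
rewrite initial_measureE.
have mk : measurable_fun setT (fun y => (dirichlet0 base_point y t)%:E * F y).
  apply: emeasurable_funM => //; apply/measurable_EFinP.
  by apply: measurable_dirichlet0 => //; exact: measurable_cst.
have mb : measurable_fun setT (fun y => (poisson0 base_point y t)%:E * H y).
  apply: emeasurable_funM => //; apply/measurable_EFinP.
  by apply: measurable_poisson0 => //; exact: measurable_cst.
have k0 y : 0 <= (dirichlet0 base_point y t)%:E * F y by rewrite mule_ge0// lee_fin dirichlet0_ge0.
have b0 y : 0 <= (poisson0 base_point y t)%:E * H y by rewrite mule_ge0// lee_fin poisson0_ge0.
apply: (@le_lt_trans _ _ (C%:E * (\int[lebX]_y ((dirichlet0 base_point y t)%:E * F y) +
    \int[lebE]_y ((poisson0 base_point y t)%:E * H y)))); last first.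
  by rewrite lte_mul_pinfty ?lee_fin ?ltW.
rewrite ge0_muleDr; [|exact: integral_ge0|exact: integral_ge0].
rewrite -!ge0_integralZl ?lee_fin ?(ltW C0)//.
apply: leeD; rewrite [leLHS]integral_mkcond.
- apply: ge0_le_integral_nonmeas => y _.
    by apply: erestrict_ge0 => z _; rewrite mule_ge0// lee_fin height_ge0.
  rewrite patchE; case: ifPn => [/set_mem Ay|_]; last by rewrite mule_ge0// lee_fin ltW.
  rewrite muleA -EFinM lee_wpmul2r// lee_fin.
  by have [] := CP y (A2 y Ay) (fun i => A1 y i Ay).
- apply: ge0_le_integral_nonmeas => y _; first by apply: erestrict_ge0.
  rewrite patchE; case: ifPn => [/set_mem /= Ay|_]; last by rewrite mule_ge0// lee_fin ltW.
  rewrite muleA -EFinM -[leLHS]mul1e lee_wpmul2r// lee_fin.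
  by have [] := CP _ (A2 _ Ay) (fun i => A1 _ i Ay).
Qed.

End radon.

(** * Borel representatives of the data *)
Section representatives.
Context d (T : measurableType d) (R : realType).
Variable mu : {measure set T -> \bar R}.

Lemma borel_representative (D : set T) (f : T -> \bar R) : measurable D ->
  nonneg_measurable mu D f ->
  exists F : T -> \bar R, [/\ measurable_fun setT F, forall x, 0 <= F x &
    {ae mu, forall x, D x -> f x = F x}].
Proof.
move=> mD [f0 [g mg fg]].
exists ((fun x => maxe (g x) 0) \_ D); split.
- by apply/(measurable_restrictT _ mD); apply: measurable_maxe.
- by move=> x; apply: erestrict_ge0 => y _; rewrite le_max lexx orbT.
- apply: filterS fg => x fgx Dx.
  by rewrite patchE mem_set// max_l -?fgx ?f0.
Qed.

End representatives.

Section borel_data.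
Context (R : realType) (n : nat).
Notation leb := (@lebesgue_measure R).
Notation hk := (@heat_kernel R).
Notation E := (euclid R n).
Notation X := (ambient R n.+1).
Notation Z := (X * measurableTypeR R)%type.
Notation lebE := (lebesgue_euclid R n).
Notation lebX := (lebesgue_ambient R n.+1).

Lemma measurable_halfspace : measurable (@halfspace R n.+1).
Proof.
have m2 : measurable_fun [set: X] (fun y : X => y.2 : R) by exact: measurable_snd.
by apply: measurable_set_bool; apply: measurable_fun_ltr => //; exact: measurable_cst.
Qed.

Lemma measurable_halfspace_ball (z : X) (s : R) : (0 < s)%R ->
  measurable (@halfspace_ball R n.+1 z (Num.sqrt s)).
Proof.
move=> s0; have m2 : measurable_fun [set: X] (fun y : X => y.2 : R) by exact: measurable_snd.
rewrite (_ : halfspace_ball z _ =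
   [set y | (sqdist z y < s)%R && (0 <= last_coord y)%R]); last first.
  apply/seteqP; split => y /=; rewrite /halfspace_ball /halfspace_closure/= ltr_sqrt//.
    by move=> [-> ->].
  by move=> /andP[-> ->].
apply: measurable_set_bool; apply: measurable_and.
  apply: measurable_fun_ltr; last exact: measurable_cst.
  by apply: measurable_sqdist => //; exact: measurable_cst.
by apply: measurable_fun_ler => //; exact: measurable_cst.
Qed.

Lemma measurable_boundary_ball (z : E) (s : R) : (0 < s)%R ->
  measurable (@boundary_ball R n.+1 z (Num.sqrt s)).
Proof.
move=> s0.
rewrite (_ : @boundary_ball R n.+1 z _ = [set y | (@boundary_sqdist R n.+1 z y < s)%R]); last first.
  by apply/seteqP; split => y /=; rewrite /boundary_ball/= ltr_sqrt.
apply: measurable_set_bool.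
apply: measurable_fun_ltr; last exact: measurable_cst.
by apply: measurable_boundary_sqdist => //; exact: measurable_cst.
Qed.

(** f is only known on the open half-space.  Half-balls also meet the boundary, where
    both integrands vanish with the weight y_N. *)
Section interior_datum.
Variables (f F : X -> \bar R).
Hypotheses (mF : measurable_fun setT F) (F0 : forall y, 0 <= F y).
Hypothesis fF : {ae lebX, forall y, @halfspace R n.+1 y -> f y = F y}.

Let mpow b : measurable_fun setT (fun y => F y `^ b).
Proof. exact: (measurableT_comp (measurable_poweR _)). Qed.

Lemma halfspace_ball_integral_ae (z : X) (s b : R) : (0 < s)%R ->
  \int[lebX]_(y in @halfspace_ball R n.+1 z (Num.sqrt s))
    ((last_coord y / (last_coord y + Num.sqrt s))%:E * f y `^ b) =
  \int[lebX]_(y in @halfspace_ball R n.+1 z (Num.sqrt s))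
    ((last_coord y / (last_coord y + Num.sqrt s))%:E * F y `^ b).
Proof.
move=> s0; have m2 : measurable_fun [set: X] (fun y : X => y.2 : R) by exact: measurable_snd.
have coef0 y : @halfspace_ball R n.+1 z (Num.sqrt s) y ->
    (0 <= last_coord y / (last_coord y + Num.sqrt s))%R.
  by move=> [_ y0]; rewrite divr_ge0// addr_ge0// sqrtr_ge0.
apply: ge0_ae_eq_integral_nonmeas.
- exact: measurable_halfspace_ball.
- apply: measurable_funTS; apply: emeasurable_funM; last exact: mpow.
  apply/measurable_EFinP; apply: measurable_funM => //.
  by apply: measurable_funV; apply: measurable_funD => //; exact: measurable_cst.
- by move=> y By; rewrite mule_ge0 ?poweR_ge0// lee_fin coef0.
- by move=> y By; rewrite mule_ge0 ?poweR_ge0// lee_fin coef0.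
- apply: filterS fF => y fFy [_ y0].
  move: y0; rewrite /halfspace_closure/= le_eqVlt => /predU1P[<-|y0].
    by rewrite mul0r !mul0e.
  by rewrite fFy.
Qed.

Lemma dirichlet_heatE (x : X) (t b : R) : (0 < t)%R -> (0 < x.2 :> R)%R ->
  dirichlet_heat t (fun y => f y `^ b) x = interior_heat F b (x, t).
Proof.
move=> t0 x0; rewrite /dirichlet_heat
  (@ge0_ae_eq_integral_nonmeas _ _ _ _ _ _ (fun y => (dirichlet0 x y t)%:E * F y `^ b)).
- rewrite integral_mkcond; apply: eq_integral => y _; rewrite patchE.
  case: ifPn => //; rewrite notin_setE => /negP; rewrite /halfspace/= /last_coord => /negbTE y0.
  by rewrite /dirichlet0 y0 !andbF mul0e.
- exact: measurable_halfspace.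
- apply: measurable_funTS; apply: emeasurable_funM; last exact: mpow.
  by apply/measurable_EFinP; apply: measurable_dirichlet0 => //; exact: measurable_cst.
- move=> y y0; rewrite mule_ge0 ?poweR_ge0// lee_fin.
  by have := dirichlet0_ge0 x y t; rewrite /dirichlet0 t0 x0 y0.
- by move=> y _; rewrite mule_ge0 ?poweR_ge0// lee_fin dirichlet0_ge0.
- by apply: filterS fF => y fFy y0; rewrite fFy// /dirichlet0 t0 x0 y0.
Qed.

End interior_datum.

Section lateral_datum.
Variables (h H : E -> \bar R).
Hypotheses (mH : measurable_fun setT H) (H0 : forall y, 0 <= H y).
Hypothesis hH : {ae lebE, forall y, h y = H y}.

Let mpow b : measurable_fun setT (fun y => H y `^ b).
Proof. exact: (measurableT_comp (measurable_poweR _)). Qed.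

Lemma boundary_ball_integral_ae (z : E) (s b : R) : (0 < s)%R ->
  \int[lebE]_(y in @boundary_ball R n.+1 z (Num.sqrt s)) h y `^ b =
  \int[lebE]_(y in @boundary_ball R n.+1 z (Num.sqrt s)) H y `^ b.
Proof.
move=> s0; apply: ge0_ae_eq_integral_nonmeas.
- exact: measurable_boundary_ball.
- by apply: measurable_funTS; exact: mpow.
- by move=> y _; exact: poweR_ge0.
- by move=> y _; exact: poweR_ge0.
- by apply: filterS hH => y hHy _; rewrite hHy.
Qed.

Lemma boundary_heatE (x : X) (t b : R) :
  @boundary_heat R n.+1 t (fun y => h y `^ b) x.1 = lateral_heat H b (x, t).
Proof.
apply: ge0_ae_eq_integral_nonmeas => //.
- apply: measurable_funTS; apply: emeasurable_funM; last exact: mpow.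
  apply/measurable_EFinP; apply: measurable_heat_kernel => //.
  by apply: measurable_boundary_sqdist => //; exact: measurable_cst.
- by move=> y _; rewrite mule_ge0 ?poweR_ge0// lee_fin heat_kernel_ge0.
- by move=> y _; rewrite mule_ge0 ?poweR_ge0// lee_fin heat_kernel_ge0.
- by apply: filterS hH => y hHy _; rewrite hHy.
Qed.

End lateral_datum.

Section mild_solution.
Variables (F : X -> \bar R) (H : E -> \bar R).
Hypotheses (mF : measurable_fun setT F) (F0 : forall y, 0 <= F y).
Hypotheses (mH : measurable_fun setT H) (H0 : forall y, 0 <= H y).

Lemma is_solution_dirichlet0 (p T : R) (u : Z -> \bar R) :
  measurable_fun setT u -> (forall z, 0 <= u z) ->
  (forall (x : X) (t : R), (0 < x.2 :> R)%R -> (0 < t < T)%R -> u (x, t) < +oo) ->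
  (forall (x : X) (t : R), (0 < x.2 :> R)%R -> (0 < t < T)%R ->
    u (x, t) = \int[lebX]_y ((dirichlet0 x y t)%:E * F y) +
               \int[lebE]_y ((poisson0 x y t)%:E * H y) +
      \int[leb]_(s in `]0%R, t[) \int[lebX]_y ((dirichlet0 x y (t - s))%:E * u (y, s) `^ p)) ->
  @is_solution R n.+1 p T (initial_measure mF F0 mH H0) (fun x t => u (x, t)).
Proof.
move=> mu u0 ufin ueq; split.
- split; first by move=> z _; exact: u0.
  exists u; first exact: measurable_funTS.
  by apply: aeW => -[x t] _.
- by apply: aeW => -[x t] [x0 tT]; rewrite ge0_fin_numE//; exact: ufin.
- apply: aeW => -[x t] [/= x0 tT]; have /andP[t0 _] := tT.
  rewrite (ueq x t x0 tT) -(integral_initial_measure mF F0 mH H0 t0 x0).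
  apply: congr2; first by [].
  apply: eq_integral => s; rewrite inE/= in_itv/= => /andP[s0 st].
  rewrite [RHS]integral_mkcond; apply: eq_integral => y _; rewrite patchE.
  case: ifPn => [/set_mem y0|].
    by rewrite /dirichlet0 subr_gt0 st x0 y0.
  rewrite notin_setE => /negP; rewrite /halfspace/= /last_coord => /negbTE y0.
  by rewrite /dirichlet0 y0 !andbF mul0e.
Qed.

End mild_solution.

End borel_data.

(** * Solutions for small data *)
Section small_borel_data.
Context (R : realType) (n : nat).
Notation E := (euclid R n).
Notation X := (ambient R n.+1).
Notation Z := (X * measurableTypeR R)%type.
Variables (F : X -> \bar R) (H : E -> \bar R).
Hypotheses (mF : measurable_fun setT F) (F0 : forall y, 0 <= F y).
Hypotheses (mH : measurable_fun setT H) (H0 : forall y, 0 <= H y).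
Variables (p alpha a eps T : R).
Hypotheses (p1 : (1 < p)%R) (a1 : (1 < a)%R) (ap : (a <= p)%R) (aal : (a <= alpha)%R).
Hypotheses (eps0 : (0 < eps)%R) (T0 : (0 < T)%R).
Hypothesis eps_small : (4 `^ p * (eps `^ (p - 1) * barrier_cst p a) <= 1)%R.
Hypothesis interior_small : forall s : R, (0 < s < T)%R -> forall x,
  interior_heat F alpha (x, s) `^ alpha^-1 <= (eps * s `^ (- (p - 1)^-1))%:E.
Hypothesis lateral_small : forall s : R, (0 < s < T)%R -> forall x : X,
  lateral_heat H alpha (x, s) `^ alpha^-1 <= (eps * s `^ ((p - 2) / (p - 1)))%:E.
Hypothesis lateral_zero : (2 <= p)%R -> forall y, H y = 0.

Let a0 : (0 < a)%R. Proof. exact: lt_trans a1. Qed.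

Let int_bound (z : Z) : (0 < z.2 < T)%R ->
  interior_barrier F a z <= (eps * z.2 `^ (- (p - 1)^-1))%:E.
Proof.
move=> zT; apply: le_trans (interior_barrier_mono mF F0 z a0 aal) _.
by case: z zT => x s sT; exact: interior_small.
Qed.

Let lat_bound (z : Z) : (0 < z.2 < T)%R ->
  lateral_heat H a z `^ a^-1 <= (eps * z.2 `^ ((p - 2) / (p - 1)))%:E.
Proof.
move=> zT; have /andP[z0 _] := zT.
apply: le_trans (lateral_heat_mono mH H0 z0 a0 aal) _.
by case: z zT {z0} => x s sT; exact: lateral_small.
Qed.

Let sum_barrier (z : Z) : \bar R := interior_barrier F a z + lateral_barrier H a z.

Let sum_barrier_ge0 z : 0 <= sum_barrier z.
Proof. by rewrite adde_ge0 ?interior_barrier_ge0 ?lateral_barrier_ge0. Qed.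

Let sum_barrier_fin z : (0 < z.2 < T)%R -> sum_barrier z < +oo.
Proof.
move=> zT; have fin (u : \bar R) (r : R) : 0 <= u -> u <= r%:E -> u \is a fin_num.
  by move=> u0 ur; rewrite ge0_fin_numE// (le_lt_trans ur) ?ltry.
rewrite -ge0_fin_numE ?sum_barrier_ge0// fin_numD; apply/andP; split.
  exact: fin _ _ (interior_barrier_ge0 F a z) (int_bound zT).
apply: fin_numM => //.
exact: fin (poweR_ge0 _ _) (lat_bound zT).
Qed.

Let barrierE z : barrier F H a z = sum_barrier z + sum_barrier z.
Proof.
rewrite /barrier -ge0_muleDr ?interior_barrier_ge0 ?lateral_barrier_ge0//.
rewrite (_ : 2%:E = 1 + 1); last by rewrite -EFinD.
by rewrite ge0_muleDl// !mul1e.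
Qed.

Let barrier_fin z : (0 < z.2 < T)%R -> barrier F H a z < +oo.
Proof. by move=> zT; rewrite barrierE lte_add_pinfty// sum_barrier_fin. Qed.

Let free (z : Z) : \bar R := interior_heat F 1 z + lateral_potential H 1 z.

Let freeE x t : free (x, t) =
  \int[lebesgue_ambient R n.+1]_y ((dirichlet0 x y t)%:E * F y) +
  \int[lebesgue_euclid R n]_y ((poisson0 x y t)%:E * H y).
Proof. by congr (_ + _); apply: eq_integral => y _; rewrite poweRe1. Qed.

Let free_ge0 z : 0 <= free z.
Proof. by rewrite adde_ge0 ?interior_heat_ge0 ?lateral_potential_ge0. Qed.

Let measurable_free : measurable_fun setT free.
Proof.
by apply: emeasurable_funD; [exact: measurable_interior_heat|exact: measurable_lateral_potential].
Qed.

Let free_le x t : (0 < t)%R -> (0 < x.2 :> R)%R -> free (x, t) <= sum_barrier (x, t).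
Proof. by move=> t0 x0; rewrite freeE; exact: free_evolution_le. Qed.

Lemma small_data_radon : @radon_halfspace R n.+1 (initial_measure mF F0 mH H0).
Proof.
have T20 : (0 < T / 2)%R by rewrite divr_gt0.
have T2T : (T / 2 < T)%R by rewrite ltr_pdivrMr// ltr_pMr// ltr1n.
apply: (initial_measure_radon mF F0 mH H0 T20).
rewrite -freeE; apply: le_lt_trans (free_le T20 _) _; first exact: ltr01.
by apply: sum_barrier_fin; rewrite /= T20.
Qed.

Lemma small_data_solution : exists u : Z -> \bar R,
  [/\ @is_solution R n.+1 p T (initial_measure mF F0 mH H0) (fun x t => u (x, t)),
      forall z, 0 <= u z &
      forall (x : X) (t : R), (0 < x.2 :> R)%R -> (0 < t < T)%R ->
        u (x, t) <= 2%:E * interior_heat F alpha (x, t) `^ alpha^-1 +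
          2%:E * ((normal_factor (x, t))%:E * lateral_heat H alpha (x, t) `^ alpha^-1)].
Proof.
have p0 : (0 < p)%R by exact: lt_trans p1.
have super (x : X) (t : R) : (0 < x.2 :> R)%R -> (0 < t < T)%R ->
    free (x, t) + \int[@lebesgue_measure R]_(s in `]0%R, t[)
      \int[lebesgue_ambient R n.+1]_y
        ((dirichlet0 x y (t - s))%:E * barrier F H a (y, s) `^ p) <= barrier F H a (x, t).
  move=> x0 tT; have /andP[t0 _] := tT; rewrite barrierE; apply: leeD; first exact: free_le.
  exact: (duhamel_barrier mF mH p1 a1 ap eps0 int_bound lat_bound
    lateral_zero eps_small tT x0).
have mbar : measurable_fun setT (barrier F H a) by exact: measurable_barrier.
have [u [mu u_ge0 u_eq uU]] := existence_below p0 measurable_free free_ge0 mbar super.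
exists u; split => //.
- apply: is_solution_dirichlet0 => // x t x0 tT.
  + by apply: le_lt_trans (uU x t x0 tT) _; exact: barrier_fin.
  + by rewrite (u_eq x t tT) freeE.
- move=> x t x0 tT; apply: le_trans (uU x t x0 tT) _; have /andP[t0 _] := tT.
  apply: leeD; rewrite lee_wpmul2l//; first exact: interior_barrier_mono.
  by rewrite lee_wpmul2l ?lee_fin ?normal_factor_ge0//; exact: lateral_heat_mono.
Qed.

End small_borel_data.

(** This choice gives 4^p eps^(p-1) = 1 / (C + 1) for C = [barrier_cst]. *)
Lemma exists_small_eps (R : realType) (p a : R) : (1 < p)%R -> (1 < a)%R ->
  exists2 eps : R, (0 < eps)%R & (4 `^ p * (eps `^ (p - 1) * barrier_cst p a) <= 1)%R.
Proof.
move=> p1 a1; set bc := barrier_cst p a.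
have bc0 : (0 <= bc)%R by have /andP[h /(le_trans h)] := barrier_cst_ge p1 a1.
have den0 : (0 < 4 `^ p * (bc + 1))%R by rewrite mulr_gt0 ?powR_gt0//; lra.
exists ((4 `^ p * (bc + 1)) `^ (- (p - 1)^-1))%R; first exact: powR_gt0.
rewrite -powRrM mulNr mulVf; last by lra.
rewrite (powR_inv1 (ltW den0)) invfM mulrA mulrA mulfV ?gt_eqF ?powR_gt0// mul1r.
by rewrite mulrC ler_pdivrMr; lra.
Qed.

Theorem theorem5p3 (R : realType) (N : nat) (hN : (1 <= N)%N)
    (p : R) (hp : (1 < p)%R) (alpha : R) (halpha : (1 < alpha)%R) :
  exists2 gamma : R, (0 < gamma)%R &
  forall (f : ambient R N -> \bar R) (h : euclid R N.-1 -> \bar R),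
    nonneg_measurable (lebesgue_ambient R N) (halfspace R N) f ->
    nonneg_measurable (lebesgue_euclid R N.-1) setT h ->
    ((2 <= p)%R -> forall x', h x' = 0) ->
  forall T : R, (0 < T)%R ->
    (forall sigma : R, (0 < sigma < Num.sqrt T)%R ->
      ereal_sup [set \int[lebesgue_ambient R N]_(y in halfspace_ball x sigma)
                       ((last_coord y / (last_coord y + sigma))%:E
                          * f y `^ alpha)
                | x in halfspace_closure R N]
        <= (gamma * sigma `^ (N%:R - 2 * alpha / (p - 1)))%:E
      /\
      ereal_sup [set \int[lebesgue_euclid R N.-1]_(y' in boundary_ball x' sigma)
                       h y' `^ alpha
                | x' in [set: euclid R N.-1]]
        <= (gamma * sigma `^ (N%:R - 1 + 2 * alpha * ((p - 2) / (p - 1))))%:E) ->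
  exists2 mu : {measure set (ambient R N) -> \bar R},
    radon_halfspace mu /\ is_initial_measure f h mu &
  exists2 u : ambient R N -> R -> \bar R,
    is_solution p T mu u &
    {ae lebesgue_cylinder R N, forall z, cylinder T z ->
      let x := z.1 in let t : R := z.2 in
      0 <= u x t <=
          2%:E * (dirichlet_heat t (fun y => f y `^ alpha) x) `^ alpha^-1
        + (2 * (last_coord x / t) * heat_kernel 1 (last_coord x ^+ 2) t)%:E
            * (boundary_heat t (fun y' => h y' `^ alpha) x.1) `^ alpha^-1}.
Proof.
case: N hN => [//|n] _.
pose a := Num.min alpha p.
have a1 : (1 < a)%R by rewrite lt_min halpha hp.
have ap : (a <= p)%R by rewrite ge_min lexx orbT.
have aal : (a <= alpha)%R by rewrite ge_min lexx.
have al0 : (0 < alpha)%R by exact: lt_trans halpha.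
have [eps eps0 eps_small] := exists_small_eps hp a1.
pose C1 := ambient_bound_cst R n; pose C2 := boundary_bound_cst R n.
have C10 : (0 < C1)%R := ambient_bound_cst_gt0 R n.
have C20 : (0 < C2)%R := boundary_bound_cst_gt0 R n.
pose gamma := (eps `^ alpha / (C1 + C2))%R.
have gamma0 : (0 < gamma)%R by rewrite divr_gt0 ?powR_gt0// addr_gt0.
have g1 : (C1 * gamma <= eps `^ alpha)%R.
  by rewrite /gamma mulrCA ler_piMr ?powR_ge0// ler_pdivrMr ?addr_gt0// mul1r lerDl ltW.
have g2 : (C2 * gamma <= eps `^ alpha)%R.
  by rewrite /gamma mulrCA ler_piMr ?powR_ge0// ler_pdivrMr ?addr_gt0// mul1r lerDr ltW.
exists gamma => // f h nf nh h_zero T T0 hyp.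
have [F [mF F0 fF]] := borel_representative (@measurable_halfspace R n) nf.
have [H [mH H0 hH H_zero]] : exists H : euclid R n -> \bar R,
    [/\ measurable_fun setT H, forall y, 0 <= H y,
     {ae lebesgue_euclid R n, forall y, h y = H y} &
     ((2 <= p)%R -> forall y, H y = 0)].
  have [p2|p2] := leP 2%R p.
    by exists (cst 0); split => //; apply: aeW => y; exact: h_zero.
  have [H [mH H0 hH]] := borel_representative measurableT nh.
  by exists H; split => //; apply: filterS hH => y; exact.
have f0 : forall x, @halfspace R n.+1 x -> 0 <= f x by case: nf.
have h0 : forall x, 0 <= h x by move=> x; case: nh => + _; exact.
have sq (s : R) : (0 < s < T)%R -> (0 < Num.sqrt s < Num.sqrt T)%R.
  by move=> /andP[s0 sT]; rewrite sqrtr_gt0 s0 ltr_sqrt.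
have int_small (s : R) : (0 < s < T)%R -> forall x,
    interior_heat F alpha (x, s) `^ alpha^-1 <= (eps * s `^ (- (p - 1)^-1))%:E.
  move=> sT; have /andP[s0 _] := sT.
  apply: (interior_heat_small mF hp s0 al0 (ltW gamma0) (ltW eps0) g1) => z z0.
  have [+ _] := hyp _ (sq s sT); apply: le_trans.
  rewrite -(halfspace_ball_integral_ae mF fF z alpha s0).
  by apply: ereal_sup_ubound; exists z.
have lat_small (s : R) : (0 < s < T)%R -> forall x : ambient R n.+1,
    lateral_heat H alpha (x, s) `^ alpha^-1 <= (eps * s `^ ((p - 2) / (p - 1)))%:E.
  move=> sT; have /andP[s0 _] := sT.
  apply: (lateral_heat_small mH hp s0 al0 (ltW gamma0) (ltW eps0) g2) => z.
  have [_ +] := hyp _ (sq s sT); apply: le_trans.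
  rewrite -(boundary_ball_integral_ae mH hH z alpha s0).
  by apply: ereal_sup_ubound; exists z.
exists (initial_measure mF F0 mH H0).
  split; last exact: initial_measure_is.
  exact: (small_data_radon mF F0 mH H0 a1 aal T0 int_small lat_small).
have [u [usol u_ge0 u_le]] := small_data_solution mF F0 mH H0 hp a1 ap aal eps0
  eps_small int_small lat_small H_zero.
exists (fun x t => u (x, t)) => //.
apply: aeW => -[x t] [/= x0 tT]; have /andP[t0 _] := tT.
rewrite u_ge0 /= (dirichlet_heatE mF fF alpha t0 x0) (boundary_heatE mH hH x t alpha).
apply: le_trans (u_le x t x0 tT) _; rewrite leeD2l// muleA -EFinM.
by rewrite /normal_factor /= t0 x0 /= !mulrA.
Qed.
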